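(* Let $p=p'+p''$ with $p'\equiv3\pmod4$, $V=\mathbb R^{p,q}$, $W$ a $C\ell^0(V)$-module and $\Pi:\wedge^2W\to V$ an $\mathfrak o(V)$-equivariant linear map with canonical symmetric form $b$. Let $\hat K(p',p'')\subset\mathrm{Spin}(p,q)$ be the subgroup generated by $K(p',p'')$ and $\iota(\mathrm{Pin}(q))$. Then: (1) $\hat K(p',p'')$ consists of all elements of $\mathrm{Spin}(p,q)$ preserving (under $\mathrm{Ad}$) the orthogonal decomposition $V=E\oplus E'$ and preserving $b$; its identity component is $K(p',p'')=\hat K(p',p'')\cap\mathrm{Spin}_0(p,q)$. (2) The homogeneous space $\mathrm{Spin}(p,q)/\hat K(p',p'')$ is connected. (3) $\hat K(p',p'')$ is compact if and only if $q=0$ or $p''=0$. If $p''=0$ (so $p=p'$), then $\hat K(p,0)=\mathrm{Spin}(p)\cdot\iota(\mathrm{Pin}(q))$ is a maximal compact subgroup of $\mathrm{Spin}(p,q)$, $\hat K(p,0)\cong(\mathrm{Spin}(p)\times\mathrm{Pin}(q))/\{\pm1\}$, and the algebra $C\ell^0_{p,q}$ is generated by $1$ and $\hat K(p,0)$.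
   Context: Let $V=\mathbb{R}^{p,q}$ be $\mathbb R^{p+q}$ with the scalar product $\langle x,y\rangle=\sum_{i=1}^{p}x^iy^i-\sum_{j=p+1}^{p+q}x^jy^j$ and its standard orthonormal basis. The Clifford algebra $C\ell(V)=C\ell_{p,q}$ is generated by $V$ subject to $xy+yx=-2\langle x,y\rangle 1$, with even part $C\ell^0(V)$; $\mathrm{Pin}(V)$ is generated by unit vectors, $\mathrm{Spin}(V)=\mathrm{Pin}(V)\cap C\ell^0(V)$, $\mathrm{Spin}_0(V)$ its identity component, $\mathrm{Ad}(x)y=xyx^{-1}$. Identify $\mathfrak{o}(V)=\wedge^2V$ via $(x\wedge y)(z)=\langle y,z\rangle x-\langle x,z\rangle y$; $x\wedge y\mapsto-\frac14(xy-yx)$ identifies $\mathfrak o(V)$ with $\mathfrak{spin}(V)$, through which $\mathfrak o(V)$ acts on $C\ell^0(V)$-modules. Fix $p=p'+p''$ with $p'\equiv 3\pmod 4$; $e_1,\dots,e_{p'}$ are the first $p'$ standard basis vectors, spanning $E=\mathbb R^{p',0}$, and $E'=E^\perp\cong\mathbb R^{p'',q}$. The canonical symmetric form is $b(s,t)=\langle e_1,\Pi(e_2\cdots e_{p'}s\wedge t)\rangle$. $K(p',p'')=\mathrm{Spin}(p')\cdot\mathrm{Spin}_0(p'',q)$ is the connected subgroup of $\mathrm{Spin}_0(p,q)$ generated by $\mathrm{Spin}(E)$ and $\mathrm{Spin}_0(E')$. $\iota:C\ell_q\to C\ell^0_{p,q}$ is the algebra embedding extending $x\mapsto e_1\cdots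 e_{p'}\,x'$, where $C\ell_q=C\ell(\mathbb R^{q,0})$, $\mathrm{Pin}(q)=\mathrm{Pin}(\mathbb R^{q,0})$, and $x\mapsto x'$ sends the $k$-th standard basis vector of $\mathbb R^q$ to the $(p+k)$-th standard basis vector of $V$.
   Formalization: Π is assumed nonzero, since for Π = 0 and p'' > 0 part (1) fails (p'=3, p''=1, q=0: e_1e_4 preserves E, E' and b=0 but is not in K̂); the module W is taken finite-dimensional, to which the general case reduces by restricting to finite-dimensional submodules. *)

(* Defs.v *)
From HB Require Import structures.
From mathcomp Require Import all_boot all_order all_algebra.
From mathcomp Require Import boolp classical_sets functions reals.
From mathcomp Require Import topology_structure function_spaces connected compact.
From mathcomp Require Import product_topology num_topology subspace_topology.
Import Order.TTheory GRing.Theory Num.Theory numFieldTopology.Exports.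
Set Implicit Arguments.
Unset Strict Implicit.
Unset Printing Implicit Defensive.
Local Open Scope classical_set_scope.
Local Open Scope ring_scope.

(* The Clifford algebra Cl_{p,q} of R^{p,q}, n = p + q, realised on the    *)
(* standard basis of blades e_A (A a subset of {0..n-1}, e_A = e_{a1}...e_{ak} *)
(* with a1 < ... < ak).  Carrier: functions blade -> R with the product    *)
(* (= Euclidean, since finite-dimensional) topology.                       *)

Notation blade p q := {set 'I_(p + q)}.
Notation Cl R p q := {ptws blade p q -> R}.

Definition ip_sign (R : realType) (p q : nat) (i : 'I_(p + q)) : R :=
  if (i < p)%N then 1 else -1.

(* Clifford relation x y + y x = -2 <x,y> 1, so e_i^2 = - <e_i,e_i> *)
Definition blade_sign (R : realType) (p q : nat) (A B : blade p q) : R :=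
  (-1) ^+ #|[pred ab : 'I_(p + q) * 'I_(p + q) |
               [&& ab.1 \in A, ab.2 \in B & (ab.2 < ab.1)%N]]|
  * \prod_(i in A :&: B) (- ip_sign R i).

Definition symdiff (p q : nat) (A B : blade p q) : blade p q :=
  (A :\: B) :|: (B :\: A).

Definition cl_mul (R : realType) (p q : nat) (x y : Cl R p q) : Cl R p q :=
  fun C => \sum_(A : blade p q) \sum_(B : blade p q)
    (if symdiff A B == C then blade_sign R A B * x A * y B else 0).
Definition cl_add (R : realType) (p q : nat) (x y : Cl R p q) : Cl R p q :=
  fun C => x C + y C.
Definition cl_scale (R : realType) (p q : nat) (a : R) (x : Cl R p q) : Cl R p q :=
  fun C => a * x C.
Definition cl_zero (R : realType) (p q : nat) : Cl R p q := fun C => 0.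
Arguments cl_zero R p q : clear implicits.
Definition cl_one (R : realType) (p q : nat) : Cl R p q := fun C => (#|C| == 0)%N%:R.
Arguments cl_one R p q : clear implicits.
Definition cl_prod (R : realType) (p q : nat) (s : seq (Cl R p q)) : Cl R p q :=
  foldr (@cl_mul R p q) (cl_one R p q) s.

Definition cl_even (R : realType) (p q : nat) (x : Cl R p q) : Prop :=
  forall C : blade p q, odd #|C| -> x C = 0.

Notation Vec R p q := 'rV[R]_(p + q).
Definition ip (R : realType) (p q : nat) (v w : Vec R p q) : R :=
  \sum_(i < p + q) ip_sign R i * v ord0 i * w ord0 i.
Definition vec (R : realType) (p q : nat) (v : Vec R p q) : Cl R p q :=
  fun C => \sum_(i < p + q) (C == finset.set1 i)%:R * v ord0 i.
Definition basis_nat (R : realType) (p q : nat) (k : nat) : Vec R p q :=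
  \row_(j < p + q) (j == k :> nat)%:R.
Arguments basis_nat R p q k : clear implicits.

(* inverse in Cl (used only on invertible elements) *)
Definition cl_inv (R : realType) (p q : nat) (x : Cl R p q) : Cl R p q :=
  xget (cl_one R p q)
    (fun y => cl_mul x y = cl_one R p q /\ cl_mul y x = cl_one R p q).
Definition Ad (R : realType) (p q : nat) (x y : Cl R p q) : Cl R p q :=
  cl_mul (cl_mul x y) (cl_inv x).

Definition PinIn (R : realType) (p q : nat) (S : set (Vec R p q)) : set (Cl R p q) :=
  [set x | exists s : seq (Vec R p q),
     (forall v, v \in s -> S v /\ (ip v v = 1 \/ ip v v = -1))
     /\ x = cl_prod [seq vec v | v <- s]].
Definition SpinIn (R : realType) (p q : nat) (S : set (Vec R p q)) : set (Cl R p q) :=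
  PinIn S `&` @cl_even R p q.
Definition Spin0In (R : realType) (p q : nat) (S : set (Vec R p q)) : set (Cl R p q) :=
  connected_component (SpinIn S) (cl_one R p q).
Definition Pin (R : realType) (p q : nat) := PinIn (@setT (Vec R p q)).
Arguments Pin R p q : clear implicits.
Definition Spin (R : realType) (p q : nat) := SpinIn (@setT (Vec R p q)).
Arguments Spin R p q : clear implicits.
Definition Spin0 (R : realType) (p q : nat) := Spin0In (@setT (Vec R p q)).
Arguments Spin0 R p q : clear implicits.

Definition subgroup_closed (R : realType) (p q : nat) (G : set (Cl R p q)) : Prop :=
  [/\ G (cl_one R p q),
      (forall x y, G x -> G y -> G (cl_mul x y)) &
      (forall x, G x -> G (cl_inv x))].
Definition gen_group (R : realType) (p q : nat) (S : set (Cl R p q)) : set (Cl R p q) :=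
  [set x | forall G, subgroup_closed G -> S `<=` G -> G x].

Definition gen_alg (R : realType) (p q : nat) (X : set (Cl R p q)) : set (Cl R p q) :=
  [set x | forall S : set (Cl R p q),
     S (cl_one R p q) -> X `<=` S ->
     (forall y z, S y -> S z -> S (cl_add y z)) ->
     (forall a y, S y -> S (cl_scale a y)) ->
     (forall y z, S y -> S z -> S (cl_mul y z)) -> S x].

Definition EE (R : realType) (p q : nat) (p' : nat) : set (Vec R p q) :=
  [set v | forall i : 'I_(p + q), (p' <= i)%N -> v ord0 i = 0].
Arguments EE R p q p' : clear implicits.
Definition EE' (R : realType) (p q : nat) (p' : nat) : set (Vec R p q) :=
  [set v | forall i : 'I_(p + q), (i < p')%N -> v ord0 i = 0].
Arguments EE' R p q p' : clear implicits.

Definition Kgrp (R : realType) (p q : nat) (p' : nat) : set (Cl R p q) :=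
  gen_group (SpinIn (EE R p q p') `|` Spin0In (EE' R p q p')).
Arguments Kgrp R p q p' : clear implicits.

(* e_{k+1} e_{k+2} ... e_{l} (basis indices counted from 0: k .. l-1) *)
Definition eprod (R : realType) (p q : nat) (k l : nat) : Cl R p q :=
  cl_prod [seq vec (basis_nat R p q i) | i <- iota k (l - k)].
Arguments eprod R p q k l : clear implicits.

(* iota : Cl_q -> Cl^0_{p,q}, the algebra map extending x |-> e_1...e_p' x' *)
Definition cl_iota (R : realType) (p q : nat) (p' : nat) (x : Cl R q 0) : Cl R p q :=
  \big[@cl_add R p q/cl_zero R p q]_(A : blade q 0)
     cl_scale (x A)
       (cl_prod [seq cl_mul (eprod R p q 0 p') (vec (basis_nat R p q (p + nat_of_ord k)))
                | k <- enum A]).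

Arguments cl_iota R p q p' x : clear implicits.

Definition iotaPin (R : realType) (p q : nat) (p' : nat) : set (Cl R p q) :=
  [set y | exists x, Pin R q 0 x /\ y = cl_iota R p q p' x].
Arguments iotaPin R p q p' : clear implicits.
Definition Khat (R : realType) (p q : nat) (p' : nat) : set (Cl R p q) :=
  gen_group (Kgrp R p q p' `|` iotaPin R p q p').
Arguments Khat R p q p' : clear implicits.

Definition is_Cl0_module (R : realType) (p q m : nat) (rho : Cl R p q -> 'M[R]_m) : Prop :=
  [/\ rho (cl_one R p q) = 1%:M,
      (forall x y, cl_even x -> cl_even y -> rho (cl_add x y) = rho x + rho y),
      (forall a x, cl_even x -> rho (cl_scale a x) = a *: rho x) &
      (forall x y, cl_even x -> cl_even y -> rho (cl_mul x y) = rho x *m rho y)].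

(* Pi : wedge^2 W -> V, as a skew-symmetric bilinear map W x W -> V *)
Definition is_wedge2_map (R : realType) (p q m : nat) (Pi : 'cV[R]_m -> 'cV[R]_m -> Vec R p q) : Prop :=
  (forall s t, Pi s t = - Pi t s) /\
  (forall a s s' t, Pi (a *: s + s') t = a *: Pi s t + Pi s' t).

(* x /\ y in o(V): acts on V by z |-> <y,z> x - <x,z> y, and on W through
   x /\ y |-> -1/4 (x y - y x) in spin(V) *)
Definition wedge_act (R : realType) (p q : nat) (x y z : Vec R p q) : Vec R p q :=
  ip y z *: x - ip x z *: y.
Definition wedge_spin (R : realType) (p q : nat) (x y : Vec R p q) : Cl R p q :=
  cl_scale (- 4^-1)
    (cl_add (cl_mul (vec x) (vec y)) (cl_scale (-1) (cl_mul (vec y) (vec x)))).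
Definition equivariant (R : realType) (p q m : nat) (rho : Cl R p q -> 'M[R]_m)
    (Pi : 'cV[R]_m -> 'cV[R]_m -> Vec R p q) : Prop :=
  forall (x y : Vec R p q) (s t : 'cV[R]_m),
    Pi (rho (wedge_spin x y) *m s) t + Pi s (rho (wedge_spin x y) *m t)
    = wedge_act x y (Pi s t).

Definition bform (R : realType) (p q m : nat) (p' : nat) (rho : Cl R p q -> 'M[R]_m)
    (Pi : 'cV[R]_m -> 'cV[R]_m -> Vec R p q) (s t : 'cV[R]_m) : R :=
  ip (basis_nat R p q 0) (Pi (rho (eprod R p q 1 p') *m s) t).

Definition Ad_preserves (R : realType) (p q : nat) (g : Cl R p q) (S : set (Vec R p q)) : Prop :=
  forall v, S v -> exists w, S w /\ Ad g (vec v) = vec w.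

(* connectedness of G/H (right cosets gH, quotient topology from the topology
   of G as a subspace of Cl): no separation of G into two nonempty disjoint
   relatively open H-saturated subsets *)
Definition rel_open (R : realType) (p q : nat) (G A : set (Cl R p q)) : Prop :=
  exists U, open U /\ A = U `&` G.
Definition homog_connected (R : realType) (p q : nat) (G H : set (Cl R p q)) : Prop :=
  forall A B : set (Cl R p q),
    rel_open G A -> rel_open G B -> A `|` B = G -> A `&` B = set0 ->
    (forall g h, A g -> H h -> A (cl_mul g h)) ->
    (forall g h, B g -> H h -> B (cl_mul g h)) ->
    A = set0 \/ B = set0.

Definition max_compact_subgroup (R : realType) (p q : nat) (G K : set (Cl R p q)) : Prop :=
  [/\ K `<=` G, subgroup_closed K, compact K &
      forall H, H `<=` G -> subgroup_closed H -> compact H -> K `<=` H -> H = K].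

(* Main.v *)
Require Import Defs.
From HB Require Import structures.
From mathcomp Require Import all_boot all_order all_algebra.
From mathcomp Require Import boolp classical_sets functions reals.
From mathcomp Require Import topology_structure function_spaces connected compact.
From mathcomp Require Import product_topology num_topology subspace_topology.
From mathcomp Require Import supremum_topology normedtype realfun derive.
From mathcomp Require Import ring lra zify.
Import Order.TTheory GRing.Theory Num.Theory numFieldTopology.Exports.
Import numFieldNormedType.Exports.
Set Implicit Arguments.
Unset Strict Implicit.
Unset Printing Implicit Defensive.
Local Open Scope classical_set_scope.
Local Open Scope ring_scope.

(* The volume element omega = e_1 ... e_p' satisfies omega^2 = 1 because p' = 3 mod 4, commutes
   with E and anticommutes with E'. By Cartan-Dieudonne an element of Spin preserving E and
   E' is a product a c with a in Pin(E) and c in Pin(E'). Integrating the equivariance of Pi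
   gives Pi(g s, g t) = N(g) Ad(g) Pi(s, t) with N the spinor norm. Together with the identity
   <f, Pi(f v s, t)> = - <v, Pi(s, t)>, valid whenever <f, f> = 1, this yields
   b(a c s, a c t) = N(c) b(s, t), so that the stabiliser of b is given by N(c) = 1.

   Two unit vectors of equal norm are joined, up to sign, by the normalised segment between
   them, hence every element of spinor norm 1 lies in the identity component up to sign, and
   -1 lies there because p' > 1. The only other coset of Spin is that of omega f, where f is
   a negative basis vector; omega f belongs to iota(Pin(q)) and has spinor norm -1. This gives
   (1) and (2).

   A definite Pin group is compact since its elements are products of boundedly many unit
   vectors, and E' contains unbounded boosts when it is indefinite. If p'' = 0, let H be a
   compact subgroup containing Khat, let x in H move a basis vector e of E by the largest
   possible hyperbolic angle t, and let k in Khat fix the E-component of x e and negate its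
   E'-component. Then x^-1 k x moves e by 2 t, so t = 0, and H preserves E. *)

Local Notation blade0 := (@finset.set0 _).
Local Notation blade1 := (@finset.set1 _).

(** * Blades and their signs *)

Section Symdiff.
Variables (p q : nat).
Implicit Types A B C : blade p q.

Lemma in_symdiff A B i : (i \in symdiff A B) = (i \in A) (+) (i \in B).
Proof. by rewrite /symdiff !inE; case: (i \in A); case: (i \in B). Qed.

Lemma symdiffC A B : symdiff A B = symdiff B A.
Proof. by apply/setP => i; rewrite !in_symdiff addbC. Qed.

Lemma symdiffA A B C : symdiff A (symdiff B C) = symdiff (symdiff A B) C.
Proof. by apply/setP => i; rewrite !in_symdiff addbA. Qed.

Lemma symdiffKl A B : symdiff A (symdiff A B) = B.
Proof. by apply/setP => i; rewrite !in_symdiff addbA addbb. Qed.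

Lemma symdiffKr A B : symdiff (symdiff A B) B = A.
Proof. by rewrite symdiffC [symdiff A B]symdiffC symdiffKl. Qed.

Lemma symdiffss A : symdiff A A = blade0.
Proof. by apply/setP => i; rewrite in_symdiff addbb inE. Qed.

Lemma symdiffs0 A : symdiff A blade0 = A.
Proof. by apply/setP => i; rewrite in_symdiff inE addbF. Qed.

Lemma symdiff0s A : symdiff blade0 A = A.
Proof. by rewrite symdiffC symdiffs0. Qed.

Lemma symdiff_eq A B C : (symdiff A B == C) = (B == symdiff A C).
Proof. by apply/eqP/eqP => [<-|->]; rewrite symdiffKl. Qed.

Lemma card_symdiff1 i A : i \in A -> #|A| = #|symdiff (blade1 i) A|.+1.
Proof.
move=> iA; rewrite (cardsD1 i A) iA; congr _.+1; apply: eq_card => k.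
by rewrite in_symdiff !inE; case: eqP => // ->; rewrite iA.
Qed.

End Symdiff.

Section BladeSign.
Variables (R : realType) (p q : nat).
Implicit Types A B C : blade p q.

Definition inversion_sign A B : R :=
  \prod_(a : 'I_(p + q)) \prod_(b : 'I_(p + q))
    (-1) ^+ [&& a \in A, b \in B & (b < a)%N].

Definition square_sign A B : R :=
  \prod_(i : 'I_(p + q)) (- ip_sign R i) ^+ ((i \in A) && (i \in B)).

Lemma blade_signE A B : blade_sign R A B = inversion_sign A B * square_sign A B.
Proof.
rewrite /blade_sign; congr (_ * _).
  rewrite /inversion_sign pair_big /= -prodr_const big_mkcond /=.
  by apply: eq_bigr => -[a b] _; rewrite inE /=; case: ifP.
rewrite /square_sign big_mkcond /=; apply: eq_bigr => i _.
by rewrite inE; case: ifP.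
Qed.

Lemma inversion_sign_symdiffl A B C :
  inversion_sign (symdiff A B) C = inversion_sign A C * inversion_sign B C.
Proof.
rewrite /inversion_sign -big_split; apply: eq_bigr => a _ /=.
rewrite -big_split; apply: eq_bigr => b _ /=.
rewrite in_symdiff -signr_addb.
by case: (a \in A); case: (a \in B); case: (b \in C); case: (b < a)%N.
Qed.

Lemma inversion_sign_symdiffr A B C :
  inversion_sign A (symdiff B C) = inversion_sign A B * inversion_sign A C.
Proof.
rewrite /inversion_sign -big_split; apply: eq_bigr => a _ /=.
rewrite -big_split; apply: eq_bigr => b _ /=.
rewrite in_symdiff -signr_addb.
by case: (a \in A); case: (b \in B); case: (b \in C); case: (b < a)%N.
Qed.

Lemma inversion_sign1l i A :
  inversion_sign (blade1 i) A = \prod_(b : 'I_(p + q)) (-1) ^+ ((b \in A) && (b < i)%N).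
Proof.
rewrite /inversion_sign (bigD1 i) //= [X in _ * X]big1 ?mulr1 => [|a ai].
  by apply: eq_bigr => b _; rewrite !inE eqxx.
by rewrite big1 // => b _; rewrite inE (negbTE ai).
Qed.

Lemma inversion_sign1r i A :
  inversion_sign A (blade1 i) = \prod_(a : 'I_(p + q)) (-1) ^+ ((a \in A) && (i < a)%N).
Proof.
rewrite /inversion_sign exchange_big (bigD1 i) //= [X in _ * X]big1 ?mulr1 => [|b bi].
  by apply: eq_bigr => a _; rewrite !inE eqxx.
by rewrite big1 // => a _; rewrite inE (negbTE bi) /= andbF.
Qed.

Lemma inversion_sign_sqr A B : inversion_sign A B * inversion_sign A B = 1.
Proof.
rewrite /inversion_sign -big_split /= big1 // => i _.
rewrite -big_split big1 // => j _ /=.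
by rewrite -signr_addb addbb.
Qed.

Lemma square_signC A B : square_sign A B = square_sign B A.
Proof. by apply: eq_bigr => i _; rewrite andbC. Qed.

Lemma square_sign1l i A : square_sign (blade1 i) A = (- ip_sign R i) ^+ (i \in A).
Proof.
rewrite /square_sign (bigD1 i) //= big1 ?mulr1 => [|a ai]; first by rewrite inE eqxx.
by rewrite inE (negbTE ai).
Qed.

Lemma ip_sign_sqr (i : 'I_(p + q)) : ip_sign R i * ip_sign R i = 1.
Proof. by rewrite /ip_sign; case: ifP; rewrite ?mulr1 ?mulrNN ?mulr1. Qed.

Lemma ip_sign_definite (i : 'I_(p + q)) : q = 0%N -> ip_sign R i = 1.
Proof. by move=> q0; rewrite /ip_sign (leq_trans (ltn_ord i)) // q0 addn0. Qed.

Lemma square_sign_sqr A B : square_sign A B * square_sign A B = 1.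
Proof.
rewrite /square_sign -big_split big1 // => i _.
by case: (_ && _); rewrite /= ?expr1 ?expr0 ?mulr1 // mulrNN ip_sign_sqr.
Qed.

Lemma blade_sign_sqr A B : blade_sign R A B * blade_sign R A B = 1.
Proof. by rewrite blade_signE mulrACA inversion_sign_sqr mul1r square_sign_sqr. Qed.

Lemma blade_sign_neq0 A B : blade_sign R A B != 0.
Proof.
apply/eqP => sign0; have /eqP := blade_sign_sqr A B.
by rewrite sign0 mul0r eq_sym oner_eq0.
Qed.

Lemma blade_sign_cocycle A B C :
  blade_sign R A B * blade_sign R (symdiff A B) C =
  blade_sign R A (symdiff B C) * blade_sign R B C.
Proof.
rewrite !blade_signE inversion_sign_symdiffl inversion_sign_symdiffr.
rewrite !mulrA [LHS](ACl (1*3*4*(2*5))) [RHS](ACl (1*4*2*(3*5))) /=.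
rewrite [_ * inversion_sign A C * inversion_sign B C](ACl (1*3*2)) /=.
congr (_ * _); rewrite /square_sign -!big_split; apply: eq_bigr => i _ /=.
rewrite !in_symdiff; case: (i \in A); case: (i \in B); case: (i \in C) => /=;
  by rewrite ?expr0 ?expr1 ?mulr1 ?mul1r.
Qed.

Lemma blade_sign0s A : blade_sign R blade0 A = 1.
Proof.
rewrite blade_signE /inversion_sign /square_sign !big1 ?mulr1 // => i _.
  by rewrite inE.
by rewrite big1 // => j _; rewrite inE.
Qed.

Lemma blade_signs0 A : blade_sign R A blade0 = 1.
Proof.
rewrite blade_signE /inversion_sign /square_sign !big1 ?mulr1 // => i _.
  by rewrite inE andbF.
by rewrite big1 // => j _; rewrite !inE andbF.
Qed.

Lemma signr_cardE A : (-1) ^+ #|A| = \prod_(i : 'I_(p + q)) (-1) ^+ (i \in A) :> R.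
Proof.
rewrite -prodr_const big_mkcond; apply: eq_bigr => i _.
by case: (i \in A).
Qed.

Lemma signr_card_symdiff A B : (-1) ^+ #|symdiff A B| = (-1) ^+ #|A| * (-1) ^+ #|B| :> R.
Proof.
rewrite !signr_cardE -big_split; apply: eq_bigr => i _ /=.
by rewrite in_symdiff signr_addb.
Qed.

Lemma blade_sign1_swap i A : i \in A ->
  blade_sign R (blade1 i) A = - (blade_sign R A (blade1 i) * (-1) ^+ #|A|).
Proof.
move=> iA; have inversions :
    inversion_sign (blade1 i) A * inversion_sign A (blade1 i) = - (-1) ^+ #|A|.
  rewrite inversion_sign1l inversion_sign1r -big_split signr_cardE.
  rewrite (bigD1 i) //= [in RHS](bigD1 i) //= iA ltnn !mulr1 mul1r expr1 mulN1r opprK.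
  apply: eq_bigr => b bi; rewrite -signr_addb; congr (_ ^+ nat_of_bool _).
  by move: bi; rewrite -val_eqE /=; case: (b \in A); case: ltngtP.
rewrite !blade_signE (square_signC A) -mulrN -inversions.
by rewrite [RHS](AC (2*2) ((1*4)*(3*2))) /= inversion_sign_sqr mul1r.
Qed.

Definition reversal_sign A : R := inversion_sign A A.

Lemma reversal_sign_symdiff A B :
  reversal_sign (symdiff A B) * blade_sign R A B =
  reversal_sign A * reversal_sign B * blade_sign R B A.
Proof.
rewrite !blade_signE /reversal_sign inversion_sign_symdiffl !inversion_sign_symdiffr.
rewrite (square_signC B) !mulrA; congr (_ * _).
by rewrite [LHS](ACl (1*4*3*(2*5))) /= inversion_sign_sqr mulr1.
Qed.

End BladeSign.

(** * The Clifford algebra *)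

(* A separate carrier, because the canonical ring structure of [Cl] is the pointwise
   one of a function space; [clifford] gets the Clifford product instead. *)
Definition clifford (R : realType) (p q : nat) : Type := blade p q -> R.

Section CliffordAlgebra.
Variables (R : realType) (p q : nat).
Implicit Types (x y z : Cl R p q).

Lemma cl_mul_coef x y C :
  cl_mul x y C = \sum_A blade_sign R A (symdiff A C) * x A * y (symdiff A C).
Proof.
apply: eq_bigr => A _; rewrite (bigD1 (symdiff A C)) //= symdiffKl eqxx.
by rewrite big1 ?addr0 // => B BAC; rewrite symdiff_eq (negbTE BAC).
Qed.

Lemma cl_mulA : associative (@cl_mul R p q).
Proof.
move=> x y z; apply/funext => D; rewrite !cl_mul_coef.
transitivity (\sum_A \sum_B blade_sign R A (symdiff A D) *
   blade_sign R B (symdiff B (symdiff A D)) * x A * y B * z (symdiff B (symdiff A D))).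
  apply: eq_bigr => A _; rewrite cl_mul_coef mulr_sumr; apply: eq_bigr => B _.
  by ring.
transitivity (\sum_A \sum_C blade_sign R C (symdiff C D) *
   blade_sign R A (symdiff A C) * x A * y (symdiff A C) * z (symdiff C D)).
  apply: eq_bigr => A _.
  rewrite [RHS](reindex_inj (can_inj (symdiffKl A))); apply: eq_bigr => B _ /=.
  have -> : symdiff (symdiff A B) D = symdiff B (symdiff A D).
    by rewrite symdiffA (symdiffC B).
  rewrite symdiffKl; congr (_ * _ * _ * _).
  have := blade_sign_cocycle R A B (symdiff B (symdiff A D)).
  by rewrite symdiffKl => <-; rewrite mulrC.
rewrite exchange_big; apply: eq_bigr => C _ /=; rewrite cl_mul_coef mulr_sumr mulr_suml.
by apply: eq_bigr => A _; ring.
Qed.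

Lemma cl_mul1l : left_id (cl_one R p q) (@cl_mul R p q).
Proof.
move=> x; apply/funext => C; rewrite cl_mul_coef (bigD1 blade0) //=.
rewrite symdiff0s blade_sign0s /cl_one cards0 eqxx !mul1r big1 ?addr0 // => A A0.
by rewrite cards_eq0 (negbTE A0) mulr0 mul0r.
Qed.

Lemma cl_mul1r : right_id (cl_one R p q) (@cl_mul R p q).
Proof.
move=> x; apply/funext => C; rewrite cl_mul_coef (bigD1 C) //=.
rewrite symdiffss blade_signs0 /cl_one cards0 eqxx mulr1 mul1r big1 ?addr0 // => A neA.
by rewrite cards_eq0 symdiff_eq symdiffs0 eq_sym (negbTE neA) mulr0.
Qed.

Lemma cl_mulDl : left_distributive (@cl_mul R p q) (@cl_add R p q).
Proof.
move=> x y z; apply/funext => C; rewrite /cl_add !cl_mul_coef -big_split.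
by apply: eq_bigr => A _ /=; ring.
Qed.

Lemma cl_mulDr : right_distributive (@cl_mul R p q) (@cl_add R p q).
Proof.
move=> x y z; apply/funext => C; rewrite /cl_add !cl_mul_coef -big_split.
by apply: eq_bigr => A _ /=; ring.
Qed.

Lemma cl_one_neq0 : cl_one R p q <> cl_zero R p q.
Proof.
move/(congr1 (fun f => f blade0)); rewrite /cl_one /cl_zero cards0 eqxx.
by move/eqP; rewrite oner_eq0.
Qed.

End CliffordAlgebra.

Section CliffordInstances.
Variables (R : realType) (p q : nat).

HB.instance Definition _ := gen_eqMixin (clifford R p q).
HB.instance Definition _ := gen_choiceMixin (clifford R p q).

Fact clifford_addA :
  associative (@cl_add R p q : clifford R p q -> clifford R p q -> clifford R p q).
Proof. by move=> x y z; apply/funext => C; rewrite /cl_add addrA. Qed.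

Fact clifford_addC :
  commutative (@cl_add R p q : clifford R p q -> clifford R p q -> clifford R p q).
Proof. by move=> x y; apply/funext => C; rewrite /cl_add addrC. Qed.

Fact clifford_add0 : left_id (cl_zero R p q)
  (@cl_add R p q : clifford R p q -> clifford R p q -> clifford R p q).
Proof. by move=> x; apply/funext => C; rewrite /cl_add add0r. Qed.

Fact clifford_addN : left_inverse (cl_zero R p q) (@cl_scale R p q (-1))
  (@cl_add R p q : clifford R p q -> clifford R p q -> clifford R p q).
Proof. by move=> x; apply/funext => C; rewrite /cl_add /cl_scale mulN1r addNr. Qed.

HB.instance Definition _ := GRing.isZmodule.Build (clifford R p q)
  clifford_addA clifford_addC clifford_add0 clifford_addN.

Fact clifford_oner_neq0 : (cl_one R p q : clifford R p q) != 0.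
Proof. by apply/eqP/cl_one_neq0. Qed.

HB.instance Definition _ := GRing.Zmodule_isNzRing.Build (clifford R p q)
  (@cl_mulA R p q) (@cl_mul1l R p q) (@cl_mul1r R p q)
  (@cl_mulDl R p q) (@cl_mulDr R p q) clifford_oner_neq0.

Fact clifford_scaleA (a b : R) (x : clifford R p q) :
  cl_scale a (cl_scale b x) = cl_scale (a * b) x.
Proof. by apply/funext => C; rewrite /cl_scale mulrA. Qed.

Fact clifford_scale1 :
  left_id (1 : R) (@cl_scale R p q : R -> clifford R p q -> clifford R p q).
Proof. by move=> x; apply/funext => C; rewrite /cl_scale mul1r. Qed.

Fact clifford_scaleDr : right_distributive
  (@cl_scale R p q : R -> clifford R p q -> clifford R p q) (@GRing.add (clifford R p q)).
Proof. by move=> a x y; apply/funext => C; rewrite /cl_scale mulrDr. Qed.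

Fact clifford_scaleDl (x : clifford R p q) :
  {morph (@cl_scale R p q)^~ x : a b / a + b >-> (a + b : clifford R p q)}.
Proof. by move=> a b; apply/funext => C; rewrite /cl_scale mulrDl. Qed.

HB.instance Definition _ := GRing.Zmodule_isLmodule.Build R (clifford R p q)
  clifford_scaleA clifford_scale1 clifford_scaleDr clifford_scaleDl.

Fact clifford_scaleAl (a : R) (x y : clifford R p q) : a *: (x * y) = a *: x * y.
Proof.
apply/funext => C; rewrite [LHS](congr1 (fun t => a * t) (cl_mul_coef x y C)).
rewrite [RHS]cl_mul_coef mulr_sumr; apply: eq_bigr => A _.
by rewrite /GRing.scale /= /cl_scale; ring.
Qed.

HB.instance Definition _ :=
  GRing.Lmodule_isLalgebra.Build R (clifford R p q) clifford_scaleAl.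

Fact clifford_scaleAr (a : R) (x y : clifford R p q) : a *: (x * y) = x * (a *: y).
Proof.
apply/funext => C; rewrite [LHS](congr1 (fun t => a * t) (cl_mul_coef x y C)).
rewrite [RHS]cl_mul_coef mulr_sumr; apply: eq_bigr => A _.
by rewrite /GRing.scale /= /cl_scale; ring.
Qed.

HB.instance Definition _ :=
  GRing.Lalgebra_isAlgebra.Build R (clifford R p q) clifford_scaleAr.

End CliffordInstances.

Section BasisBlades.
Variables (R : realType) (p q : nat).
Implicit Types (A B C : blade p q) (x y : clifford R p q).
Local Notation clifford := (clifford R p q).

Lemma cl_mulE x y : cl_mul x y = x * y. Proof. by []. Qed.
Lemma cl_addE x y : cl_add x y = x + y. Proof. by []. Qed.
Lemma cl_scaleE a x : cl_scale a x = a *: x. Proof. by []. Qed.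

Lemma cl_coefM x y C :
  (x * y) C = \sum_A blade_sign R A (symdiff A C) * x A * y (symdiff A C).
Proof. exact: cl_mul_coef. Qed.

Lemma cl_coefD x y C : (x + y) C = x C + y C. Proof. by []. Qed.
Lemma cl_coefZ a x C : (a *: x) C = a * x C. Proof. by []. Qed.
Lemma cl_coefN x C : (- x) C = - x C. Proof. by rewrite -scaleN1r cl_coefZ mulN1r. Qed.
Lemma cl_coef1 C : (1 : clifford) C = (C == blade0)%:R.
Proof. by rewrite -cards_eq0. Qed.

Lemma cl_coef_sum (I : Type) (r : seq I) (P : pred I) (F : I -> clifford) C :
  (\sum_(i <- r | P i) F i) C = \sum_(i <- r | P i) F i C.
Proof. by elim/big_rec2: _ => // i y1 y2 _ <-. Qed.

Lemma cl_coef_scalar (a : R) : (a%:A : clifford) blade0 = a.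
Proof. by rewrite cl_coefZ cl_coef1 eqxx mulr1. Qed.

Definition basis_blade A : clifford := fun C => (C == A)%:R.

Lemma basis_bladeE A C : basis_blade A C = (C == A)%:R. Proof. by []. Qed.

Lemma basis_blade0 : basis_blade blade0 = 1.
Proof. by apply/funext => C; rewrite cl_coef1. Qed.

Lemma blade_sum x : x = \sum_A x A *: basis_blade A.
Proof.
apply/funext => C; rewrite cl_coef_sum (bigD1 C) //= cl_coefZ basis_bladeE eqxx mulr1.
rewrite big1 ?addr0 // => A neA.
by rewrite cl_coefZ basis_bladeE eq_sym (negbTE neA) mulr0.
Qed.

Lemma cl_coef_bladeM A x C :
  (basis_blade A * x) C = blade_sign R A (symdiff A C) * x (symdiff A C).
Proof.
rewrite cl_coefM (bigD1 A) //= basis_bladeE eqxx mulr1 big1 ?addr0 // => B BA.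
by rewrite basis_bladeE (negbTE BA) mulr0 mul0r.
Qed.

Lemma cl_coefM_blade x A C :
  (x * basis_blade A) C = blade_sign R (symdiff C A) A * x (symdiff C A).
Proof.
rewrite cl_coefM (bigD1 (symdiff C A)) //= [symdiff (symdiff C A) C]symdiffC symdiffKl.
rewrite basis_bladeE eqxx mulr1.
rewrite big1 ?addr0 // => B BCA; rewrite basis_bladeE [symdiff B C]symdiffC symdiff_eq.
by rewrite (negbTE BCA) mulr0.
Qed.

Lemma basis_bladeM A B :
  basis_blade A * basis_blade B = blade_sign R A B *: basis_blade (symdiff A B).
Proof.
apply/funext => C; rewrite cl_coef_bladeM cl_coefZ !basis_bladeE symdiff_eq.
by case: eqP => [->|]; rewrite ?symdiffKl ?mulr0.
Qed.

End BasisBlades.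

(** * Vectors and the involutions of the Clifford algebra *)

Section Vectors.
Variables (R : realType) (p q : nat).
Implicit Types (u v w : Vec R p q).
Local Notation clifford := (clifford R p q).

Lemma ipC v w : ip v w = ip w v.
Proof. by apply: eq_bigr => i _; ring. Qed.

Lemma ipDl u v w : ip (u + v) w = ip u w + ip v w.
Proof. by rewrite -big_split; apply: eq_bigr => i _ /=; rewrite mxE; ring. Qed.

Lemma ipZl a v w : ip (a *: v) w = a * ip v w.
Proof. by rewrite mulr_sumr; apply: eq_bigr => i _; rewrite mxE; ring. Qed.

Lemma ipDr u v w : ip u (v + w) = ip u v + ip u w.
Proof. by rewrite !(ipC u) ipDl. Qed.

Lemma ipZr a v w : ip v (a *: w) = a * ip v w.
Proof. by rewrite !(ipC v) ipZl. Qed.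

Lemma ipNl v w : ip (- v) w = - ip v w.
Proof. by rewrite -scaleN1r ipZl mulN1r. Qed.

Lemma ipNr v w : ip v (- w) = - ip v w.
Proof. by rewrite !(ipC v) ipNl. Qed.

Lemma ip0l w : ip 0 w = 0.
Proof. by rewrite -(scale0r 0) ipZl mul0r. Qed.

Definition ip_bilinear := (ipDl, ipDr, ipNl, ipNr, ipZl, ipZr).

Definition cvec v : clifford := vec v.

Lemma cvecE v : cvec v = \sum_(i < p + q) v ord0 i *: basis_blade R (blade1 i).
Proof.
apply/funext => C; rewrite cl_coef_sum; apply: eq_bigr => i _.
by rewrite cl_coefZ basis_bladeE mulrC.
Qed.

Fact cvec_is_linear : linear cvec.
Proof.
move=> a v w; rewrite !cvecE scaler_sumr -big_split; apply: eq_bigr => i _ /=.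
by rewrite !mxE scalerDl scalerA.
Qed.

HB.instance Definition _ :=
  GRing.isLinear.Build R (Vec R p q) clifford _ cvec cvec_is_linear.

Lemma cl_coef_cvec1 v i : cvec v (blade1 i) = v ord0 i.
Proof.
rewrite cvecE cl_coef_sum (bigD1 i) //= cl_coefZ basis_bladeE eqxx mulr1.
rewrite big1 ?addr0 // => j ji.
by rewrite cl_coefZ basis_bladeE (inj_eq set1_inj) eq_sym (negbTE ji) mulr0.
Qed.

Lemma cvec_inj : injective cvec.
Proof. by move=> v w vw; apply/rowP => i; rewrite -!cl_coef_cvec1 vw. Qed.

Definition basis_vec (i : 'I_(p + q)) : Vec R p q := delta_mx ord0 i.

Lemma basis_vecE i j : basis_vec i ord0 j = (j == i)%:R.
Proof. by rewrite mxE eqxx. Qed.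

Lemma vec_sum v : v = \sum_i v ord0 i *: basis_vec i.
Proof. exact: row_sum_delta. Qed.

Lemma cvec_basis i : cvec (basis_vec i) = basis_blade R (blade1 i).
Proof.
rewrite cvecE (bigD1 i) //= basis_vecE eqxx scale1r big1 ?addr0 // => j ji.
by rewrite basis_vecE (negbTE ji) scale0r.
Qed.

Lemma ip_basis i v : ip (basis_vec i) v = ip_sign R i * v ord0 i.
Proof.
rewrite /ip (bigD1 i) //= basis_vecE eqxx mulr1 big1 ?addr0 // => j ji.
by rewrite basis_vecE (negbTE ji) mulr0 mul0r.
Qed.

Lemma ip_basis_basis i j : ip (basis_vec i) (basis_vec j) = ip_sign R i * (i == j)%:R.
Proof. by rewrite ip_basis basis_vecE. Qed.

Lemma basis_blade1_anticomm (i j : 'I_(p + q)) :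
  basis_blade R (blade1 i) * basis_blade R (blade1 j) +
  basis_blade R (blade1 j) * basis_blade R (blade1 i) =
  (- 2 * (ip_sign R i * (i == j)%:R))%:A.
Proof.
have sign11 (k l : 'I_(p + q)) : blade_sign R (blade1 k) (blade1 l) =
    (-1) ^+ (l < k)%N * (- ip_sign R k) ^+ (k == l).
  rewrite blade_signE inversion_sign1l square_sign1l inE; congr (_ * _).
  rewrite (bigD1 l) //= inE eqxx big1 ?mulr1 // => b bl.
  by rewrite inE (negbTE bl).
rewrite !basis_bladeM (symdiffC (blade1 j)) -scalerDl !sign11 (eq_sym j).
have [->|ij] := eqVneq i j.
  by rewrite ltnn symdiffss basis_blade0 !expr0 !expr1 !mul1r mulr1; congr (_ *: _); ring.
rewrite !expr0 !mulr1 !mulr0 scale0r.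
by move: ij; rewrite -val_eqE /=; case: ltngtP => //= _ _;
  rewrite expr0 expr1 ?addNr ?addrN scale0r.
Qed.

Lemma cvec_anticomm v w : cvec v * cvec w + cvec w * cvec v = (- 2 * ip v w)%:A.
Proof.
have expand (x y : Vec R p q) : cvec x * cvec y = \sum_i \sum_j
    (x ord0 i * y ord0 j) *: (basis_blade R (blade1 i) * basis_blade R (blade1 j)).
  rewrite !cvecE !mulr_suml; apply: eq_bigr => i _; rewrite mulr_sumr.
  by apply: eq_bigr => j _; rewrite -scalerAl -scalerAr scalerA.
rewrite !expand [X in _ + X]exchange_big -big_split /= /ip mulr_sumr scaler_suml.
apply: eq_bigr => i _; rewrite -big_split /= (bigD1 i) //= (mulrC (w _ _)) -scalerDr.
rewrite basis_blade1_anticomm eqxx big1 ?addr0 => [|j ji].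
  by rewrite scalerA mulr1; congr (_ *: _); ring.
rewrite (mulrC (w _ _)) -scalerDr basis_blade1_anticomm (eq_sym i) (negbTE ji).
by rewrite !mulr0 scale0r scaler0.
Qed.

Lemma cvec_swap v w : cvec w * cvec v = (- 2 * ip v w)%:A - cvec v * cvec w.
Proof. by rewrite -cvec_anticomm [RHS]addrC addKr. Qed.

Lemma cvec_swap_orth v w : ip v w = 0 -> cvec w * cvec v = - (cvec v * cvec w).
Proof. by move=> vw; rewrite cvec_swap vw mulr0 scale0r sub0r. Qed.

Lemma cvec_sqr v : cvec v * cvec v = (- ip v v)%:A.
Proof.
have := cvec_anticomm v v; rewrite -mulr2n -scaler_nat => /(congr1 (fun t => 2^-1 *: t)).
by rewrite !scalerA mulVf ?scale1r ?pnatr_eq0 // => ->; congr (_ *: _); field.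
Qed.

End Vectors.

Section Involutions.
Variables (R : realType) (p q : nat).
Implicit Types (x y : clifford R p q) (v : Vec R p q).
Local Notation clifford := (clifford R p q).

Definition involute x : clifford := fun A => (-1) ^+ #|A| * x A.

Fact involute_is_linear : linear involute.
Proof.
move=> a x y; apply/funext => A.
by rewrite /involute !(cl_coefD, cl_coefZ) /involute; ring.
Qed.

HB.instance Definition _ :=
  GRing.isLinear.Build R clifford clifford _ involute involute_is_linear.

Fact involute_is_monoid_morphism : monoid_morphism involute.
Proof.
split=> [|x y]; apply/funext => A.
  rewrite /involute cl_coef1; case: eqP => [->|]; last by rewrite mulr0.
  by rewrite cards0 expr0 mulr1.
rewrite /involute cl_coefM cl_coefM mulr_sumr; apply: eq_bigr => B _.
by rewrite -{1}[A](symdiffKl B) signr_card_symdiff; ring.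
Qed.

HB.instance Definition _ :=
  GRing.isMonoidMorphism.Build clifford clifford involute involute_is_monoid_morphism.

Lemma involute_cvec v : involute (cvec v) = - cvec v.
Proof.
apply/funext => A; rewrite cl_coefN /involute /cvec /vec mulr_sumr -sumrN.
apply: eq_bigr => i _; case: eqP => [->|]; last by rewrite mul0r mulr0 oppr0.
by rewrite cards1 expr1 mulN1r.
Qed.

Lemma cl_evenP x : cl_even x <-> involute x = x.
Proof.
split=> [ex|ex C oC].
  apply/funext => A; rewrite /involute -signr_odd.
  by case: (boolP (odd #|A|)) => [/ex->|_]; rewrite ?mulr0 ?expr0 ?mul1r.
have := congr1 (fun f => f C) ex; rewrite /involute -signr_odd oC expr1 /=.
by lra.
Qed.

Lemma cl_even1 : cl_even (1 : clifford).
Proof. by apply/cl_evenP; rewrite rmorph1. Qed.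

Lemma cl_evenM x y : cl_even x -> cl_even y -> cl_even (x * y).
Proof. by move=> /cl_evenP ex /cl_evenP ey; apply/cl_evenP; rewrite rmorphM /= ex ey. Qed.

Lemma cl_evenD x y : cl_even x -> cl_even y -> cl_even (x + y).
Proof. by move=> /cl_evenP ex /cl_evenP ey; apply/cl_evenP; rewrite linearD /= ex ey. Qed.

Lemma cl_evenZ a x : cl_even x -> cl_even (a *: x).
Proof. by move=> /cl_evenP ex; apply/cl_evenP; rewrite linearZ /= ex. Qed.

Lemma cl_evenN x : cl_even x -> cl_even (- x).
Proof. by rewrite -scaleN1r; exact: cl_evenZ. Qed.

Definition reverse x : clifford := fun A => reversal_sign R A * x A.

Fact reverse_is_linear : linear reverse.
Proof.
move=> a x y; apply/funext => A.
by rewrite /reverse !(cl_coefD, cl_coefZ) /reverse; ring.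
Qed.

HB.instance Definition _ :=
  GRing.isLinear.Build R clifford clifford _ reverse reverse_is_linear.

Lemma reverseM x y : reverse (x * y) = reverse y * reverse x.
Proof.
apply/funext => C; rewrite cl_coefM /reverse cl_coefM mulr_sumr.
rewrite [RHS](reindex_inj (can_inj (symdiffKl C))); apply: eq_bigr => A _ /=.
have -> : symdiff (symdiff C A) C = A by rewrite symdiffC symdiffKl.
rewrite (symdiffC C); set B := symdiff A C.
rewrite (_ : C = symdiff A B); last by rewrite symdiffKl.
by rewrite [LHS]mulrA [in LHS]mulrA reversal_sign_symdiff; ring.
Qed.

Lemma reverse1 : reverse 1 = 1.
Proof.
apply/funext => A; rewrite /reverse cl_coef1; case: eqP => [->|]; last by rewrite mulr0.
rewrite mulr1 /reversal_sign /inversion_sign big1 // => i _; rewrite big1 // => j _.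
by rewrite inE.
Qed.

Lemma reverse_cvec v : reverse (cvec v) = cvec v.
Proof.
apply/funext => A; rewrite /reverse /cvec /vec mulr_sumr; apply: eq_bigr => i _.
case: eqP => [->|]; last by rewrite mul0r mulr0.
rewrite /reversal_sign inversion_sign1l big1 ?mul1r // => b _.
by rewrite inE; case: eqP => // ->; rewrite ltnn.
Qed.

Lemma twisted_center_scalar x :
  (forall i : 'I_(p + q),
     basis_blade R (blade1 i) * x = involute x * basis_blade R (blade1 i)) ->
  x = (x blade0)%:A.
Proof.
move=> twisted; apply/funext => A; rewrite cl_coefZ cl_coef1.
have [->|/set0Pn[i iA]] := eqVneq; first by rewrite mulr1.
have := congr1 (fun y => y (symdiff (blade1 i) A)) (twisted i).
rewrite cl_coef_bladeM cl_coefM_blade symdiffKl [symdiff (blade1 i) A]symdiffC symdiffKr.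
rewrite (blade_sign1_swap _ iA) /involute mulr0 mulNr mulrA => /eqP.
rewrite eq_sym -addr_eq0 -mulr2n -mulr_natr (mulf_eq0 _ 2) pnatr_eq0 orbF.
rewrite (mulf_eq0 _ (x A)) (mulf_eq0 (blade_sign _ _ _)) signr_eq0 orbF.
by rewrite (negbTE (blade_sign_neq0 R A _)) => /eqP.
Qed.

End Involutions.


(** * Products of unit vectors *)

Section VectorProducts.
Variables (R : realType) (p q : nat).
Implicit Types (u v w : Vec R p q) (s h : seq (Vec R p q)) (S : set (Vec R p q)).
Local Notation clifford := (clifford R p q).

Definition vprod s : clifford := \prod_(v <- s) cvec v.

Lemma vprod_nil : vprod [::] = 1. Proof. by rewrite /vprod big_nil. Qed.

Lemma vprod_cons v s : vprod (v :: s) = cvec v * vprod s.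
Proof. by rewrite /vprod big_cons. Qed.

Lemma vprod1 v : vprod [:: v] = cvec v.
Proof. by rewrite vprod_cons vprod_nil mulr1. Qed.

Lemma vprod2 u v : vprod [:: u; v] = cvec u * cvec v.
Proof. by rewrite vprod_cons vprod1. Qed.

Lemma vprod_cat s h : vprod (s ++ h) = vprod s * vprod h.
Proof. by rewrite /vprod big_cat. Qed.

Lemma cl_prodE (s : seq clifford) : cl_prod s = \prod_(x <- s) x.
Proof. by elim: s => [|x s IH]; rewrite ?big_nil // big_cons -IH. Qed.

Lemma cl_prod_vec s : cl_prod [seq vec v | v <- s] = vprod s.
Proof. by rewrite cl_prodE big_map. Qed.

Lemma involute_vprod s : involute (vprod s) = (-1) ^+ size s *: vprod s.
Proof.
elim: s => [|v s IH]; first by rewrite vprod_nil rmorph1 scale1r.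
rewrite vprod_cons rmorphM /= involute_cvec IH exprS -scalerA scaleN1r.
by rewrite -scalerAr mulNr scalerN.
Qed.

Lemma cl_even_vprod s : ~~ odd (size s) -> cl_even (vprod s).
Proof.
by move=> es; apply/cl_evenP; rewrite involute_vprod -signr_odd (negbTE es) scale1r.
Qed.

Lemma cl_even_cvecM u v : cl_even (cvec u * cvec v).
Proof. by rewrite -vprod2; exact: cl_even_vprod. Qed.

Lemma reverse_vprod s : reverse (vprod s) = vprod (rev s).
Proof.
elim: s => [|v s IH]; first by rewrite vprod_nil reverse1.
by rewrite rev_cons -cats1 vprod_cat vprod_cons vprod1 reverseM reverse_cvec IH.
Qed.

Definition vprod_norm s : R := \prod_(v <- s) - ip v v.

Lemma vprod_norm_nil : vprod_norm [::] = 1. Proof. by rewrite /vprod_norm big_nil. Qed.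

Lemma vprod_norm_cons v s : vprod_norm (v :: s) = - ip v v * vprod_norm s.
Proof. by rewrite /vprod_norm big_cons. Qed.

Lemma vprod_norm_cat s h : vprod_norm (s ++ h) = vprod_norm s * vprod_norm h.
Proof. by rewrite /vprod_norm big_cat. Qed.

Lemma vprod_norm_const (e : R) s : (forall v, v \in s -> ip v v = e) ->
  vprod_norm s = (- e) ^+ size s.
Proof.
move=> norms; rewrite /vprod_norm big_seq (eq_bigr (fun=> - e)) => [|v /norms->//].
by rewrite -big_seq big_const_seq count_predT -Monoid.iteropE.
Qed.

Lemma mul_vprod_reverse s : vprod s * reverse (vprod s) = (vprod_norm s)%:A.
Proof.
elim: s => [|v s IH]; first by rewrite vprod_nil reverse1 vprod_norm_nil mulr1 scale1r.
rewrite vprod_cons reverseM reverse_cvec mulrA -(mulrA (cvec v)) IH -scalerAr mulr1.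
by rewrite -scalerAl cvec_sqr scalerA vprod_norm_cons mulrC.
Qed.

Lemma mul_reverse_vprod s : reverse (vprod s) * vprod s = (vprod_norm s)%:A.
Proof.
have := mul_vprod_reverse (rev s); rewrite !reverse_vprod revK => ->.
by rewrite /vprod_norm (perm_big s) // perm_rev.
Qed.

Definition unit_vec v := ip v v = 1 \/ ip v v = -1.

Lemma unit_vec_sqr v : unit_vec v -> ip v v * ip v v = 1.
Proof. by case=> ->; rewrite ?mulr1 ?mulrNN ?mulr1. Qed.

Lemma unit_vec_basis i : unit_vec (basis_vec R i).
Proof.
by rewrite /unit_vec ip_basis_basis eqxx mulr1 /ip_sign; case: ifP; [left|right].
Qed.

Definition unit_seq S s := forall v, v \in s -> S v /\ unit_vec v.

Lemma unit_seq_cons S v s : unit_seq S (v :: s) <-> [/\ S v, unit_vec v & unit_seq S s].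
Proof.
split=> [uvs|[Sv uv us] w]; last by rewrite inE => /orP[/eqP->|/us].
have [Sv uv] := uvs v (mem_head _ _); split=> // w ws; apply: uvs.
by rewrite inE ws orbT.
Qed.

Lemma unit_seq1 S v : S v -> unit_vec v -> unit_seq S [:: v].
Proof. by move=> Sv uv; apply/unit_seq_cons. Qed.

Lemma unit_seq2 S u v : S u -> unit_vec u -> S v -> unit_vec v -> unit_seq S [:: u; v].
Proof. by move=> Su uu Sv uv; apply/unit_seq_cons; split=> //; exact: unit_seq1. Qed.

Lemma unit_seq_cat S s h : unit_seq S (s ++ h) <-> unit_seq S s /\ unit_seq S h.
Proof.
split=> [ush|[us uh] w]; last by rewrite mem_cat => /orP[/us|/uh].
by split=> w ws; apply: ush; rewrite mem_cat ws ?orbT.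
Qed.

Lemma unit_seq_rev S s : unit_seq S s -> unit_seq S (rev s).
Proof. by move=> us v; rewrite mem_rev; exact: us. Qed.

Lemma unit_seqT S s : unit_seq S s -> unit_seq setT s.
Proof. by move=> us v /us[]. Qed.

Lemma unit_seqT_cat S S' s h : unit_seq S s -> unit_seq S' h -> unit_seq setT (s ++ h).
Proof. by move=> /unit_seqT us /unit_seqT uh; apply/unit_seq_cat. Qed.

Lemma vprod_norm_sqr S s : unit_seq S s -> vprod_norm s * vprod_norm s = 1.
Proof.
elim: s => [|v s IH]; first by rewrite vprod_norm_nil mulr1.
case/unit_seq_cons => _ uv /IH norm_s.
by rewrite vprod_norm_cons mulrACA norm_s mulr1 mulrNN unit_vec_sqr.
Qed.

Lemma odd_vprod_even S s : unit_seq S s -> cl_even (vprod s) -> ~~ odd (size s).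
Proof.
move=> us /cl_evenP; rewrite involute_vprod -signr_odd; case: (odd _) => //=.
rewrite expr1 scaleN1r => /eqP; rewrite eq_sym -addr_eq0 -mulr2n -scaler_nat.
rewrite scaler_eq0 pnatr_eq0 /= => /eqP s0; have := mul_reverse_vprod s.
rewrite s0 mulr0 => /esym/eqP; rewrite scaler_eq0 oner_eq0 orbF => /eqP n0.
by have := vprod_norm_sqr us; rewrite n0 mulr0 => /esym/eqP; rewrite oner_eq0.
Qed.

End VectorProducts.

(** * Reflections *)

Section Reflections.
Variables (R : realType) (p q : nat).
Implicit Types (u v w : Vec R p q) (s h : seq (Vec R p q)).
Local Notation clifford := (clifford R p q).
Local Notation Vec := (Vec R p q).

(* For a unit vector u, multiplying by [ip u u] is the same as dividing by it. *)
Definition reflection u v := v - (2 * ip u v * ip u u) *: u.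
Definition reflections s v := foldr reflection v s.

Fact reflection_is_linear u : linear (reflection u).
Proof.
move=> a v w; rewrite /reflection ipDr ipZr scalerBr scalerA.
by apply/rowP => i; rewrite !mxE; ring.
Qed.

HB.instance Definition _ u :=
  GRing.isLinear.Build R Vec Vec _ (reflection u) (reflection_is_linear u).

Fact reflections_is_linear s : linear (reflections s).
Proof. by move=> a v w; elim: s => //= u s ->; rewrite linearP. Qed.

HB.instance Definition _ s :=
  GRing.isLinear.Build R Vec Vec _ (reflections s) (reflections_is_linear s).

Lemma ip_reflection u v w : unit_vec u -> ip (reflection u v) (reflection u w) = ip v w.
Proof.
move=> uu; rewrite /reflection !ip_bilinear (ipC v u).
by case: uu => ->; ring.
Qed.

Lemma reflection_id u : unit_vec u -> reflection u u = - u.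
Proof.
move=> uu; rewrite /reflection -mulrA unit_vec_sqr // mulr1 scaler_nat mulr2n.
by rewrite opprD addNKr.
Qed.

Lemma reflection_orth u v : ip u v = 0 -> reflection u v = v.
Proof. by rewrite /reflection => ->; rewrite mulr0 mul0r scale0r subr0. Qed.

Lemma cvec_reflection u v : unit_vec u ->
  cvec (reflection u v) * cvec u = - (cvec u * cvec v).
Proof.
move=> uu; rewrite /reflection linearB linearZZ /= mulrBl -scalerAl cvec_sqr scalerA.
rewrite (cvec_swap u v) addrAC -scalerBl (_ : - 2 * ip u v - _ = 0) ?scale0r ?add0r //.
by case: uu => ->; ring.
Qed.

Lemma reflections_cat s h v : reflections (s ++ h) v = reflections s (reflections h v).
Proof. by rewrite /reflections foldr_cat. Qed.

Lemma ip_reflections S s v w : unit_seq S s ->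
  ip (reflections s v) (reflections s w) = ip v w.
Proof. by elim: s => //= u s IH /unit_seq_cons[_ uu /IH <-]; rewrite ip_reflection. Qed.

Lemma reflections_orth s v : (forall u, u \in s -> ip u v = 0) -> reflections s v = v.
Proof.
elim: s => //= u s IH orth; rewrite IH ?reflection_orth ?orth ?mem_head // => w ws.
by rewrite orth // inE ws orbT.
Qed.

Lemma cvec_reflections S s v : unit_seq S s ->
  cvec (reflections s v) * vprod s = (-1) ^+ size s *: (vprod s * cvec v).
Proof.
elim: s => [|u s IH]; first by rewrite vprod_nil mulr1 mul1r scale1r.
case/unit_seq_cons => _ uu /IH swap_s.
rewrite -[reflections (u :: s) v]/(reflection u (reflections s v)) vprod_cons mulrA.
by rewrite cvec_reflection // mulNr -!mulrA swap_s -scalerAr exprS -scalerA scaleN1r.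
Qed.

Lemma vprod_trivial_action S s : unit_seq S s ->
  (forall i, reflections s (basis_vec R i) = basis_vec R i) ->
  vprod s = 1 \/ vprod s = -1.
Proof.
move=> us fix_basis; pose c := vprod s blade0.
have vprod_c : vprod s = c%:A.
  apply: twisted_center_scalar => i; rewrite involute_vprod -scalerAl -!cvec_basis.
  by rewrite -(cvec_reflections _ us) fix_basis.
have c_sqr : c * c = vprod_norm s.
  have := mul_vprod_reverse s; rewrite vprod_c linearZZ /= reverse1 -scalerAl mul1r scalerA.
  by move=> /(congr1 (fun x => x blade0)); rewrite !cl_coef_scalar.
have : (c * c - 1) * (c * c + 1) = 0.
  by rewrite -subr_sqr !expr2 c_sqr (vprod_norm_sqr us) mulr1 subrr.
move/eqP; rewrite mulf_eq0 [c * c + 1 == 0]gt_eqF ?orbF; last first.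
  by rewrite ltr_wpDl // -expr2 sqr_ge0.
rewrite -expr2 subr_eq0 sqrf_eq1 vprod_c.
by case/orP => /eqP ->; rewrite ?scale1r ?scaleN1r; [left|right].
Qed.

Lemma vprod_inverse_action h s : unit_seq setT (h ++ s) ->
  (forall i, reflections (h ++ s) (basis_vec R i) = basis_vec R i) ->
  vprod s = vprod (rev h) \/ vprod s = - vprod (rev h).
Proof.
move=> uhs fix_basis; have [uh _] := (unit_seq_cat setT h s).1 uhs.
have solve (c : R) :
    vprod h * vprod s = c%:A -> vprod s = (vprod_norm h * c) *: vprod (rev h).
  move/(congr1 (fun x => vprod_norm h *: (reverse (vprod h) * x))).
  rewrite mulrA mul_reverse_vprod -scalerAl mul1r scalerA (vprod_norm_sqr uh) scale1r => ->.
  by rewrite -scalerAr mulr1 scalerA reverse_vprod.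
have norm_pm : vprod_norm h = 1 \/ vprod_norm h = -1.
  have /eqP := vprod_norm_sqr uh; rewrite -expr2 sqrf_eq1.
  by case/orP => /eqP ->; [left|right].
have := vprod_trivial_action uhs fix_basis; rewrite vprod_cat => -[hs|hs].
  have -> := solve 1; rewrite ?scale1r // mulr1.
  by case: norm_pm => ->; rewrite ?scale1r ?scaleN1r; [left|right].
have -> := solve (-1); rewrite ?scaleN1r // mulrN1.
by case: norm_pm => ->; rewrite ?opprK ?scale1r ?scaleN1r; [right|left].
Qed.

End Reflections.

(** * The Cartan-Dieudonne theorem for coordinate subspaces *)

Section CartanDieudonne.
Variables (R : realType) (p q : nat).
Implicit Types (u v w : Vec R p q) (s h : seq (Vec R p q)) (J : pred 'I_(p + q)).
Local Notation Vec := (Vec R p q).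

Definition vec_subspace (S : set Vec) :=
  S 0 /\ forall a v w, S v -> S w -> S (a *: v + w).

Lemma vec_subspaceT : vec_subspace setT. Proof. by []. Qed.

Section Subspace.
Variable S : set Vec.
Hypothesis subS : vec_subspace S.

Lemma vec_subspaceZ a v : S v -> S (a *: v).
Proof. by case: subS => S0 SP Sv; rewrite -[a *: v]addr0; exact: SP. Qed.

Lemma vec_subspaceD v w : S v -> S w -> S (v + w).
Proof. by case: subS => S0 SP Sv Sw; rewrite -[v]scale1r; exact: SP. Qed.

Lemma vec_subspaceN v : S v -> S (- v).
Proof. by rewrite -scaleN1r; exact: vec_subspaceZ. Qed.

Lemma vec_subspace_sum (I : Type) (r : seq I) (P : pred I) (F : I -> Vec) :
  (forall i, P i -> S (F i)) -> S (\sum_(i <- r | P i) F i).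
Proof. by move=> SF; elim/big_ind: _ => //; [case: subS|exact: vec_subspaceD]. Qed.

Lemma reflection_subspace u v : S u -> S v -> S (reflection u v).
Proof. by case: subS => S0 SP Su Sv; rewrite /reflection addrC -scaleNr; exact: SP. Qed.

Lemma reflections_subspace s v : unit_seq S s -> S v -> S (reflections s v).
Proof.
elim: s => //= u s IH /unit_seq_cons[Su _ us] Sv.
by apply: reflection_subspace => //; apply: IH.
Qed.

End Subspace.

Definition coord_space J : set Vec := [set v | forall i, ~~ J i -> v ord0 i = 0].

Lemma coord_space_subspace J : vec_subspace (coord_space J).
Proof.
split=> [i _|a v w Jv Jw i iJ]; first by rewrite mxE.
by rewrite !mxE Jv // Jw // mulr0 addr0.
Qed.

Lemma coord_space_basis J i : J i -> coord_space J (basis_vec R i).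
Proof.
move=> Ji j Jj; rewrite basis_vecE [j == i](_ : _ = false) //.
by apply: contraNF Jj => /eqP->.
Qed.

Lemma ip_coord_spaceC J v w : coord_space J v -> coord_space (predC J) w -> ip v w = 0.
Proof.
move=> Jv Jw; rewrite /ip big1 // => i _; case: (boolP (J i)) => Ji.
  by rewrite Jw ?mulr0 //= Ji.
by rewrite Jv // mulr0 mul0r.
Qed.

Lemma coord_space_orth J v :
  (forall i, ~~ J i -> ip (basis_vec R i) v = 0) -> coord_space J v.
Proof.
move=> orth i /orth/eqP; rewrite ip_basis mulf_eq0 => /orP[/eqP sign0|/eqP//].
by have := ip_sign_sqr R i; rewrite sign0 mul0r => /esym/eqP; rewrite oner_eq0.
Qed.

Lemma coord_space_linear_image J (T : {linear Vec -> Vec}) S : vec_subspace S ->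
  (forall i, J i -> S (T (basis_vec R i))) -> forall v, coord_space J v -> S (T v).
Proof.
move=> subS TJ v Jv; rewrite [v]vec_sum linear_sum; apply: vec_subspace_sum => // i _.
rewrite linearZZ; have [Ji|/Jv->] := boolP (J i); first exact/(vec_subspaceZ subS)/TJ.
by rewrite scale0r; case: subS.
Qed.

Lemma reflections_fixl J s v : unit_seq (coord_space J) s -> coord_space (predC J) v ->
  reflections s v = v.
Proof.
by move=> us Jv; apply: reflections_orth => u /us[Ju _]; exact: ip_coord_spaceC Jv.
Qed.

Lemma reflections_fixr J s v : unit_seq (coord_space (predC J)) s -> coord_space J v ->
  reflections s v = v.
Proof.
move=> us Jv; apply: reflections_orth => u /us[Ju _].
by rewrite ipC; exact: ip_coord_spaceC Ju.
Qed.

Lemma unit_vec_normalise v : ip v v != 0 -> exists a, unit_vec (a *: v) /\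
  forall x, reflection (a *: v) x = x - (2 * ip v x / ip v v) *: v.
Proof.
move=> v0; pose a := (Num.sqrt `|ip v v|)^-1; exists a.
have a_sqr : a * a = `|ip v v|^-1 by rewrite -invfM -expr2 sqr_sqrtr.
split=> [|x].
  rewrite /unit_vec ipZl ipZr mulrA a_sqr; have [v_gt0|v_lt0|] := ltrgt0P (ip v v).
  - by left; rewrite mulVf.
  - by right; rewrite invrN mulNr mulVf.
  - by move/eqP: v0.
rewrite /reflection !ipZl ipZr scalerA; congr (_ - _ *: _).
transitivity (2 * ip v x * ip v v * (a * a) * (a * a)); first by ring.
rewrite a_sqr; have [v_gt0|v_lt0|] := ltrgt0P (ip v v); try by field.
by move/eqP: v0.
Qed.

Lemma reflection_sub v w : ip v v = ip w w -> ip (w - v) (w - v) != 0 ->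
  exists2 u, unit_vec u /\ (exists a b, u = a *: v + b *: w) & reflection u w = v.
Proof.
move=> vw nz; have [a [ua ra]] := unit_vec_normalise nz; exists (a *: (w - v)).
  by split=> //; exists (- a), a; rewrite scalerBr addrC scaleNr.
have double : ip (w - v) (w - v) = 2 * ip (w - v) w.
  by rewrite !ip_bilinear (ipC w v) vw; ring.
by rewrite ra (_ : 2 * _ / _ = 1) ?scale1r ?subKr // -double divff.
Qed.

(* One of w - v and w + v is not isotropic, and their hyperplanes reflect w to v and -v. *)
Lemma reflections_transitive v w : unit_vec v -> ip v v = ip w w ->
  exists h, [/\ (size h <= 2)%N, reflections h w = v &
    forall u, u \in h -> unit_vec u /\ exists a b, u = a *: v + b *: w].
Proof.
move=> uv vw; have [n0|n0] := eqVneq (ip (w - v) (w - v)) 0; last first.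
  have [u uP ru] := reflection_sub vw n0.
  by exists [:: u]; split=> // x; rewrite inE => /eqP->.
have n1 : ip (w - - v) (w - - v) != 0.
  have parallelogram : ip (w - - v) (w - - v) + ip (w - v) (w - v) = 4 * ip v v.
    by rewrite !ip_bilinear (ipC w v) -vw; ring.
  move: parallelogram; rewrite n0 addr0 => ->; rewrite mulf_neq0 ?pnatr_eq0 //.
  by case: uv => ->; rewrite ?oppr_eq0 oner_eq0.
have [|u [uu [a [b uE]]] ru] := reflection_sub _ n1; first by rewrite ipNl ipNr opprK.
exists [:: v; u]; split=> //=; first by rewrite ru linearN /= reflection_id // opprK.
move=> x; rewrite !inE => /orP[] /eqP->; split=> //.
  by exists 1, 0; rewrite scale1r scale0r addr0.
by exists (- a), b; rewrite uE scalerN scaleNr.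
Qed.

(* Straighten the basis vectors one after the other; the reflections used for a basis
   vector are orthogonal to the ones already fixed. *)
Lemma cartan_dieudonne J (T : Vec -> Vec) :
  (forall v w, ip (T v) (T w) = ip v w) ->
  (forall i, J i -> coord_space J (T (basis_vec R i))) ->
  exists h, [/\ unit_seq (coord_space J) h, (size h <= 2 * (p + q))%N &
                forall i, J i -> reflections h (T (basis_vec R i)) = basis_vec R i].
Proof.
move=> isoT TJ.
suff [h [uh sh rh]] : exists h, [/\ unit_seq (coord_space J) h,
    (size h <= 2 * size (enum J))%N &
    forall i, i \in enum J -> reflections h (T (basis_vec R i)) = basis_vec R i].
  exists h; split=> // [|i Ji]; last by apply: rh; rewrite mem_enum.
  rewrite (leq_trans sh) // leq_mul2l /= -cardE.
  by rewrite (leq_trans (max_card _)) // card_ord.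
have : all J (enum J) by apply/allP => i; rewrite mem_enum.
have := enum_uniq J; elim: (enum J) => [_ _|i l IH /= /andP[il ul] /andP[Ji lJ]].
  by exists [::].
have [h [uh sh rh]] := IH ul lJ; pose w := reflections h (T (basis_vec R i)).
have subJ := coord_space_subspace J.
have Jw : coord_space J w := reflections_subspace subJ uh (TJ _ Ji).
have ww : ip (basis_vec R i) (basis_vec R i) = ip w w.
  by rewrite (ip_reflections _ _ uh) isoT.
have [k [sk rk uk]] := reflections_transitive (unit_vec_basis R i) ww.
exists (k ++ h); split.
- apply/unit_seq_cat; split=> // u /uk[uu [a [b uE]]]; split=> //; rewrite uE.
  apply: (vec_subspaceD subJ); apply: (vec_subspaceZ subJ) => //.
  exact: coord_space_basis.
- by rewrite size_cat /= mulnS leq_add.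
move=> j; rewrite inE => /orP[/eqP->|jl]; first by rewrite reflections_cat -/w rk.
rewrite reflections_cat rh //; apply: reflections_orth => u /uk[_ [a [b ->]]].
have ij : i != j by apply: contraNneq il => ->.
rewrite ipDl !ipZl ip_basis_basis (negbTE ij) !mulr0 add0r.
rewrite -[basis_vec R j]rh // (ip_reflections _ _ uh) isoT ip_basis_basis (negbTE ij).
by rewrite !mulr0.
Qed.

End CartanDieudonne.

(** * The groups Pin and Spin *)

Section PinGroup.
Variables (R : realType) (p q : nat).
Implicit Types (u v : Vec R p q) (s h : seq (Vec R p q)) (S : set (Vec R p q)).
Implicit Types (x y : clifford R p q).
Local Notation clifford := (clifford R p q).

Lemma PinInP S x : PinIn S x <-> exists2 s, unit_seq S s & x = vprod s.
Proof. by split=> [[s [us ->]]|[s us ->]]; exists s; rewrite ?cl_prod_vec. Qed.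

Lemma PinIn_Pin S : PinIn S `<=` Pin R p q.
Proof. by move=> x /PinInP[s /unit_seqT us ->]; apply/PinInP; exists s. Qed.

Lemma PinIn_vprod S s : unit_seq S s -> PinIn S (vprod s).
Proof. by move=> us; apply/PinInP; exists s. Qed.

Lemma PinIn_cvec S v : S v -> unit_vec v -> PinIn S (cvec v).
Proof. by move=> Sv uv; rewrite -vprod1; exact/PinIn_vprod/unit_seq1. Qed.

Lemma PinIn1 S : PinIn S (1 : clifford).
Proof. by rewrite -vprod_nil; exact: PinIn_vprod. Qed.

Lemma PinInM S x y : PinIn S x -> PinIn S y -> PinIn S (x * y).
Proof.
move=> /PinInP[s us ->] /PinInP[h uh ->]; rewrite -vprod_cat.
exact/PinIn_vprod/unit_seq_cat.
Qed.

Lemma PinInN S u x : vec_subspace S -> S u -> unit_vec u -> PinIn S x -> PinIn S (- x).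
Proof.
move=> subS Su uu Px; have -> : - x = cvec u * cvec (ip u u *: u) * x.
  by rewrite linearZZ /= -scalerAr cvec_sqr scalerA mulrN unit_vec_sqr // scaleN1r mulN1r.
apply: PinInM => //; apply: PinInM; apply: PinIn_cvec => //.
  exact: vec_subspaceZ.
by case: uu => uu; rewrite /unit_vec !ipZl !ipZr uu; [left|right]; ring.
Qed.

Definition spinor_norm (x : Cl R p q) : R := ((reverse x : clifford) * x) blade0.

Lemma spinor_norm_vprod s : spinor_norm (vprod s) = vprod_norm s.
Proof. by rewrite /spinor_norm mul_reverse_vprod cl_coef_scalar. Qed.

Lemma spinor_norm1 : spinor_norm (1 : clifford) = 1.
Proof. by rewrite -vprod_nil spinor_norm_vprod vprod_norm_nil. Qed.

Lemma spinor_norm_cvec v : spinor_norm (cvec v) = - ip v v.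
Proof. by rewrite -vprod1 spinor_norm_vprod vprod_norm_cons vprod_norm_nil mulr1. Qed.

Lemma mul_reverse_Pin x : Pin R p q x -> reverse x * x = (spinor_norm x)%:A.
Proof. by case/PinInP => s _ ->; rewrite spinor_norm_vprod mul_reverse_vprod. Qed.

Lemma mul_Pin_reverse x : Pin R p q x -> x * reverse x = (spinor_norm x)%:A.
Proof. by case/PinInP => s _ ->; rewrite spinor_norm_vprod mul_vprod_reverse. Qed.

Lemma spinor_norm_sqr x : Pin R p q x -> spinor_norm x * spinor_norm x = 1.
Proof. by case/PinInP => s us ->; rewrite spinor_norm_vprod (vprod_norm_sqr us). Qed.

Lemma spinor_norm_pm1 x : Pin R p q x -> spinor_norm x = 1 \/ spinor_norm x = -1.
Proof.
move=> /spinor_norm_sqr/eqP; rewrite -expr2 sqrf_eq1.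
by case/orP => /eqP ->; [left|right].
Qed.

Lemma spinor_normM x y : Pin R p q x ->
  spinor_norm (x * y) = spinor_norm x * spinor_norm y.
Proof.
move=> Px; rewrite /spinor_norm reverseM mulrA -(mulrA _ _ x) mul_reverse_Pin //.
by rewrite -scalerAr mulr1 -scalerAl cl_coefZ cl_coef_scalar.
Qed.

Lemma cl_inv_uniq x y : x * y = 1 -> y * x = 1 -> cl_inv x = y.
Proof.
move=> xy yx; pose z : clifford := cl_inv x.
have [xz _] : x * z = 1 /\ z * x = 1.
  apply: (@xgetPex _ (cl_one R p q)
    (fun y => cl_mul x y = cl_one R p q /\ cl_mul y x = cl_one R p q)).
  by exists y.
by rewrite -[cl_inv x]/z -[z]mul1r -yx -mulrA xz mulr1.
Qed.

Lemma cl_inv_Pin x : Pin R p q x -> cl_inv x = spinor_norm x *: reverse x.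
Proof.
move=> Px; apply: cl_inv_uniq.
  by rewrite -scalerAr mul_Pin_reverse // scalerA spinor_norm_sqr // scale1r.
by rewrite -scalerAl mul_reverse_Pin // scalerA spinor_norm_sqr // scale1r.
Qed.

Lemma mulrV_Pin x : Pin R p q x -> x * (cl_inv x : clifford) = 1.
Proof.
move=> Px; rewrite cl_inv_Pin // -scalerAr mul_Pin_reverse // scalerA.
by rewrite spinor_norm_sqr // scale1r.
Qed.

Lemma mulVr_Pin x : Pin R p q x -> (cl_inv x : clifford) * x = 1.
Proof.
move=> Px; rewrite cl_inv_Pin // -scalerAl mul_reverse_Pin // scalerA.
by rewrite spinor_norm_sqr // scale1r.
Qed.

Lemma cl_invM_Pin x y : Pin R p q x -> Pin R p q y ->
  cl_inv (x * y) = (cl_inv y : clifford) * cl_inv x.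
Proof.
move=> Px Py; apply: cl_inv_uniq.
  by rewrite mulrA -(mulrA x) mulrV_Pin // mulr1 mulrV_Pin.
by rewrite mulrA -(mulrA _ _ x) mulVr_Pin // mulr1 mulVr_Pin.
Qed.

Lemma PinInV S x : vec_subspace S -> PinIn S x -> PinIn S (cl_inv x).
Proof.
move=> subS Px; rewrite cl_inv_Pin; last exact: PinIn_Pin Px.
case/PinInP: Px => s us ->; rewrite spinor_norm_vprod reverse_vprod.
case: s us => [u0|v s us]; first by rewrite vprod_norm_nil scale1r; exact: PinIn_vprod u0.
have /PinIn_vprod Ps := unit_seq_rev us; case/unit_seq_cons: us => Sv uv us.
have : Pin R p q (vprod (v :: s)).
  by apply/PinIn_vprod/unit_seq_cons; split=> //; exact: unit_seqT us.
move/spinor_norm_pm1; rewrite spinor_norm_vprod => -[] ->; first by rewrite scale1r.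
by rewrite scaleN1r; exact: PinInN Sv uv Ps.
Qed.

Lemma spinor_normV x : Pin R p q x -> spinor_norm (cl_inv x) = spinor_norm x.
Proof.
move=> Px; have := spinor_normM (cl_inv x) Px; rewrite mulrV_Pin // spinor_norm1.
by move/(congr1 ( *%R (spinor_norm x))); rewrite mulrA spinor_norm_sqr // mulr1 mul1r.
Qed.

Lemma SpinInP S x : SpinIn S x <->
  exists s, [/\ unit_seq S s, ~~ odd (size s) & x = vprod s].
Proof.
split=> [[/PinInP[s us xE] ex]|[s [us es ->]]].
  by exists s; split=> //; apply: (odd_vprod_even us); rewrite -xE.
by split; [exact: PinIn_vprod|exact: cl_even_vprod].
Qed.

Lemma SpinIn1 S : SpinIn S (1 : clifford).
Proof. by split; [exact: PinIn1|exact: cl_even1]. Qed.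

Lemma SpinInM S x y : SpinIn S x -> SpinIn S y -> SpinIn S (x * y).
Proof. by move=> [px ex] [py ey]; split; [exact: PinInM|exact: cl_evenM]. Qed.

Lemma SpinInN S u x : vec_subspace S -> S u -> unit_vec u -> SpinIn S x -> SpinIn S (- x).
Proof. by move=> subS Su uu [px ex]; split; [exact: PinInN Su uu px|exact: cl_evenN]. Qed.

Lemma SpinInV S x : vec_subspace S -> SpinIn S x -> SpinIn S (cl_inv x).
Proof.
move=> subS [Px ex]; split; first exact: PinInV.
apply/cl_evenP; have Px' := PinIn_Pin Px.
have /(congr1 (fun y => (cl_inv x : clifford) * y)) : x * involute (cl_inv x) = 1.
  by have /cl_evenP {1}<- := ex; rewrite -rmorphM mulrV_Pin // rmorph1.
by rewrite mulrA mulVr_Pin // mul1r mulr1.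
Qed.

Lemma SpinIn_cvecM S u v : S u -> unit_vec u -> S v -> unit_vec v ->
  SpinIn S (cvec u * cvec v).
Proof. by split; [apply: PinInM; exact: PinIn_cvec|exact: cl_even_cvecM]. Qed.

End PinGroup.

(** * The action of Spin on vectors *)

Section SpinAction.
Variables (R : realType) (p q : nat).
Implicit Types (v w : Vec R p q) (s h : seq (Vec R p q)) (J : pred 'I_(p + q)).
Implicit Types (x y : clifford R p q).
Local Notation clifford := (clifford R p q).
Local Notation Vec := (Vec R p q).

Definition spin_act (x : Cl R p q) v : Vec :=
  \row_i (spinor_norm x * ((x : clifford) * cvec v * reverse x) (blade1 i)).

Fact spin_act_is_linear x : linear (spin_act x).
Proof.
move=> a v w; apply/rowP => i; rewrite !mxE linearP /= mulrDr mulrDl -scalerAr -scalerAl.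
by rewrite cl_coefD cl_coefZ; ring.
Qed.

HB.instance Definition _ x :=
  GRing.isLinear.Build R Vec Vec _ (spin_act x) (spin_act_is_linear x).

Lemma vprod_conj S s v : unit_seq S s -> ~~ odd (size s) ->
  vprod s * cvec v * reverse (vprod s) = vprod_norm s *: cvec (reflections s v).
Proof.
move=> us es; have := cvec_reflections v us; rewrite -signr_odd (negbTE es) scale1r => <-.
by rewrite -mulrA mul_vprod_reverse -scalerAr mulr1.
Qed.

Lemma spin_act_vprod S s v : unit_seq S s -> ~~ odd (size s) ->
  spin_act (vprod s) v = reflections s v.
Proof.
move=> us es; apply/rowP => i; rewrite mxE (vprod_conj _ us) // cl_coefZ cl_coef_cvec1.
by rewrite spinor_norm_vprod mulrA (vprod_norm_sqr us) mul1r.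
Qed.

Lemma spin_act1 v : spin_act (1 : clifford) v = v.
Proof. by rewrite -vprod_nil (@spin_act_vprod setT). Qed.

Lemma spin_actM x y v : Spin R p q x -> Spin R p q y ->
  spin_act (x * y) v = spin_act x (spin_act y v).
Proof.
move=> /SpinInP[s [us es ->]] /SpinInP[h [uh eh ->]].
rewrite -vprod_cat (spin_act_vprod _ us) // (spin_act_vprod _ uh) //.
rewrite (spin_act_vprod _ (unit_seqT_cat us uh)) ?reflections_cat //.
by rewrite size_cat oddD (negbTE es).
Qed.

Lemma ip_spin_act x v w : Spin R p q x -> ip (spin_act x v) (spin_act x w) = ip v w.
Proof.
case/SpinInP => s [us es ->].
by rewrite !(spin_act_vprod _ us) // (ip_reflections _ _ us).
Qed.

Lemma SpinV x : Spin R p q x -> Spin R p q (cl_inv x).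
Proof. by move=> Sx; apply: SpinInV => //; exact: vec_subspaceT. Qed.

Lemma spin_actK x : Spin R p q x -> cancel (spin_act x) (spin_act (cl_inv x)).
Proof.
move=> Sx v; rewrite -spin_actM //; last exact: SpinV.
by rewrite mulVr_Pin ?spin_act1 //; case: Sx.
Qed.

Lemma spin_actVK x : Spin R p q x -> cancel (spin_act (cl_inv x)) (spin_act x).
Proof.
move=> Sx v; rewrite -spin_actM //; last exact: SpinV.
by rewrite mulrV_Pin ?spin_act1 //; case: Sx.
Qed.

Lemma Ad_vec x v : Spin R p q x -> Ad x (vec v) = vec (spin_act x v).
Proof.
move=> Sx; have [Px _] := Sx.
rewrite /Ad (cl_inv_Pin Px) -[cl_mul _ (vec v)]/((x : clifford) * cvec v).
case/SpinInP: Sx => s [us es ->]; rewrite (spin_act_vprod _ us) // cl_mulE -scalerAr.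
rewrite (vprod_conj _ us) // spinor_norm_vprod scalerA (vprod_norm_sqr us).
exact: scale1r.
Qed.

Lemma Ad_preservesP x S : Spin R p q x ->
  Ad_preserves x S <-> forall v, S v -> S (spin_act x v).
Proof.
move=> Sx; split=> xS v Sv.
  by have [w [Sw]] := xS v Sv; rewrite Ad_vec // => /cvec_inj ->.
by exists (spin_act x v); split; [exact: xS|rewrite Ad_vec].
Qed.

Lemma Pin_split J s : unit_seq setT s ->
  (forall v, coord_space J v -> coord_space J (reflections s v)) ->
  (forall v, coord_space (predC J) v -> coord_space (predC J) (reflections s v)) ->
  exists a c : clifford, [/\ PinIn (coord_space J) a, PinIn (coord_space (predC J)) c &
    vprod s = a * c \/ vprod s = - (a * c)].
Proof.
move=> us sJ sC.
have iso v w : ip (reflections s v) (reflections s w) = ip v w.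
  by rewrite (ip_reflections _ _ us).
have [|h [uh _ rh]] := @cartan_dieudonne R p q J (reflections s) iso.
  by move=> i Ji; apply: sJ; exact: coord_space_basis.
have [|k [uk _ rk]] := @cartan_dieudonne R p q (predC J) (reflections s) iso.
  by move=> i Ji; apply: sC; exact: coord_space_basis.
exists (vprod (rev h)), (vprod (rev k)).
split; [exact/PinIn_vprod/unit_seq_rev..|].
rewrite -vprod_cat -rev_cat; apply: vprod_inverse_action => [|i].
  exact/unit_seqT_cat/us/(unit_seqT_cat uk uh).
rewrite !reflections_cat; case: (boolP (J i)) => Ji.
  by rewrite rh // (reflections_fixr uk) //; exact: coord_space_basis.
by rewrite (reflections_fixl uh) ?rk //; exact/sC/coord_space_basis.
Qed.

Lemma Spin_split J x (i : 'I_(p + q)) : J i -> Spin R p q x ->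
  (forall v, coord_space J v -> coord_space J (spin_act x v)) ->
  (forall v, coord_space (predC J) v -> coord_space (predC J) (spin_act x v)) ->
  exists a c : clifford,
    [/\ PinIn (coord_space J) a, PinIn (coord_space (predC J)) c & x = a * c].
Proof.
move=> Ji /SpinInP[s [us es ->]] sJ sC.
have [||a [c [Pa Pc]]] := @Pin_split J s us.
- by move=> v /sJ; rewrite (spin_act_vprod _ us).
- by move=> v /sC; rewrite (spin_act_vprod _ us).
case=> ->; first by exists a, c.
exists (- a), c; rewrite mulNr; split=> //.
apply: PinInN (coord_space_basis R Ji) _ Pa; first exact: coord_space_subspace.
exact: unit_vec_basis.
Qed.

(* The two extra factors are v and a multiple of v, whose product is -1. *)
Lemma PinIn_coord_space_bounded J x : PinIn (coord_space J) x ->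
  exists h, [/\ unit_seq (coord_space J) h, (size h <= 2 * (p + q) + 2)%N & x = vprod h].
Proof.
case/PinInP => -[_ ->|v s us ->]; first by exists [::].
have [||h [uh sh rh]] := @cartan_dieudonne R p q J (reflections (v :: s)).
- by move=> w w'; rewrite (ip_reflections _ _ us).
- move=> i Ji; apply: reflections_subspace (coord_space_basis R Ji) => //.
  exact: coord_space_subspace.
have [|i|->|->] := @vprod_inverse_action R p q h (v :: s).
- exact: unit_seqT_cat uh us.
- rewrite reflections_cat; have [Ji|Ji] := boolP (J i); first exact: rh.
  by rewrite (reflections_fixl us) ?(reflections_fixl uh) //; exact: coord_space_basis.
- exists (rev h); rewrite size_rev (leq_trans sh) ?leq_addr //; split=> //.
  exact: unit_seq_rev.
have [Jv uv _] := (unit_seq_cons (coord_space J) v s).1 us.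
exists (v :: ip v v *: v :: rev h); split.
- apply/unit_seq_cons; split=> //; apply/unit_seq_cons; split; last exact: unit_seq_rev.
    exact: (vec_subspaceZ (coord_space_subspace R J)).
  by rewrite /unit_vec ipZl ipZr mulrA unit_vec_sqr // mul1r.
- by rewrite /= size_rev addn2 !ltnS.
rewrite !vprod_cons linearZZ /= mulrA -scalerAr cvec_sqr scalerA mulrN unit_vec_sqr //.
by rewrite scaleN1r mulN1r.
Qed.

End SpinAction.

(** * Identity components *)

Section Continuity.

Lemma ptws_cvg (I : Type) (U : topologicalType) (T : Type) (F : set_system T)
    (FF : Filter F) (f : T -> {ptws I -> U}) (l : {ptws I -> U}) :
  (forall i, f t i @[t --> F] --> l i) -> f t @[t --> F] --> l.
Proof.
move=> fl; apply/cvg_sup => i V /= [_ [[B oB <-] /= Bl sB]].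
have := fl i B (open_nbhs_nbhs (conj oB Bl)).
by rewrite /nbhs /=; apply: filterS => t /= Bt; exact: sB.
Qed.

Lemma ptws_eval_cvg (I : eqType) (U : topologicalType) (T : Type) (F : set_system T)
    (FF : Filter F) (f : T -> {ptws I -> U}) (l : {ptws I -> U}) i :
  f t @[t --> F] --> l -> f t i @[t --> F] --> l i.
Proof.
move=> fl; apply: (@cvg_comp _ _ _ f (fun x : {ptws I -> U} => x i) _ _ _ fl).
exact: (@proj_continuous _ (fun=> U) i l).
Qed.

Lemma ptws_eval_continuous (I : eqType) (U : topologicalType) i :
  continuous (fun f : {ptws I -> U} => f i).
Proof. exact: (@proj_continuous _ (fun=> U) i). Qed.

Variables (R : realType) (p q : nat).
Local Notation Cl := (Cl R p q).

Lemma sum_cvg (T I : Type) (F : set_system T) (FF : Filter F) (r : seq I) (P : pred I)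
    (f : I -> T -> R) (l : I -> R) :
  (forall i, P i -> f i t @[t --> F] --> l i) ->
  \sum_(i <- r | P i) f i t @[t --> F] --> \sum_(i <- r | P i) l i.
Proof. by apply: cvg_big; exact: add_continuous. Qed.

Lemma cl_mul_cvg (T : Type) (F : set_system T) (FF : Filter F) (f g : T -> Cl) (a b : Cl) :
  f t @[t --> F] --> a -> g t @[t --> F] --> b ->
  cl_mul (f t) (g t) @[t --> F] --> cl_mul a b.
Proof.
move=> fa gb; apply: ptws_cvg => C; rewrite cl_mul_coef.
under eq_cvg do rewrite cl_mul_coef.
apply: sum_cvg => A _; apply: cvgM; last exact: ptws_eval_cvg.
by apply: cvgM; [exact: cvg_cst|exact: ptws_eval_cvg].
Qed.

Lemma cl_scale_cvg (T : Type) (F : set_system T) (FF : Filter F) (c : T -> R)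
    (f : T -> Cl) (k : R) (a : Cl) :
  c t @[t --> F] --> k -> f t @[t --> F] --> a ->
  cl_scale (c t) (f t) @[t --> F] --> cl_scale k a.
Proof. by move=> ck fa; apply: ptws_cvg => A; apply: cvgM => //; exact: ptws_eval_cvg. Qed.

Lemma vec_cvg (T : Type) (F : set_system T) (FF : Filter F) (f : T -> Vec R p q)
    (v : Vec R p q) :
  (forall i, f t ord0 i @[t --> F] --> v ord0 i) -> vec (f t) @[t --> F] --> vec v.
Proof.
move=> fv; apply: ptws_cvg => A; apply: sum_cvg => i _.
by apply: cvgM => //; exact: cvg_cst.
Qed.

Lemma reverse_continuous : continuous (fun x : Cl => reverse x : Cl).
Proof.
move=> x; apply: (ptws_cvg (nbhs_filter x)) => A.
by apply: cvgM; [exact: cvg_cst|exact: ptws_eval_continuous].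
Qed.

Lemma cl_mul_continuous (T : topologicalType) (f g : T -> Cl) :
  continuous f -> continuous g -> continuous (fun t => cl_mul (f t) (g t)).
Proof. by move=> cf cg t; exact: (cl_mul_cvg (nbhs_filter t) (cf t) (cg t)). Qed.

Lemma cl_mull_continuous (a : Cl) : continuous (cl_mul a).
Proof.
apply: (cl_mul_continuous (f := fun=> a) (g := id)) => x; last exact: cvg_id.
exact: cst_continuous.
Qed.

Lemma spinor_norm_continuous : continuous (@spinor_norm R p q).
Proof.
have mul_continuous : continuous (fun x : Cl => cl_mul (reverse x : Cl) x).
  apply: (cl_mul_continuous (g := id)) => [|x]; last exact: cvg_id.
  exact: reverse_continuous.
by move=> x; exact: (ptws_eval_cvg (nbhs_filter x) (mul_continuous x)).
Qed.

End Continuity.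

Section Spin0Group.
Variables (R : realType) (p q : nat) (S : set (Vec R p q)).
Hypothesis subS : vec_subspace S.
Implicit Types (x y : clifford R p q).
Local Notation clifford := (clifford R p q).

Lemma Spin0In_SpinIn : Spin0In S `<=` SpinIn S.
Proof. exact: connected_component_sub. Qed.

Lemma Spin0In1 : Spin0In S (1 : clifford).
Proof. by apply: connected_component_refl; exact: SpinIn1. Qed.

Lemma connected_mull_Spin0In x : connected [set cl_mul x z | z in Spin0In S].
Proof.
apply: connected_continuous_connected; first exact: component_connected.
exact/continuous_subspaceT/cl_mull_continuous.
Qed.

Lemma Spin0InM x y : Spin0In S x -> Spin0In S y -> Spin0In S (x * y).
Proof.
move=> x0 y0; apply: (connected_component_trans x0).
suff : [set cl_mul x z | z in Spin0In S] `<=` connected_component (SpinIn S) x.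
  by apply; exists y.
apply: connected_component_max; last exact: connected_mull_Spin0In.
  by exists (1 : clifford); [exact: Spin0In1|rewrite cl_mulE mulr1].
by move=> _ [z z0 <-]; apply: SpinInM; exact: Spin0In_SpinIn.
Qed.

Lemma Spin0InV x : Spin0In S x -> Spin0In S (cl_inv x).
Proof.
move=> x0; have Sx := Spin0In_SpinIn x0.
suff : [set cl_mul (cl_inv x) z | z in Spin0In S] `<=` Spin0In S.
  by apply; exists (1 : clifford); [exact: Spin0In1|rewrite cl_mulE mulr1].
apply: connected_component_max; last exact: connected_mull_Spin0In.
  by exists x => //; rewrite cl_mulE mulVr_Pin //; case: Sx => /PinIn_Pin.
by move=> _ [z /Spin0In_SpinIn Sz <-]; apply: SpinInM => //; exact: SpinInV.
Qed.

Lemma spinor_norm_Spin0In x : Spin0In S x -> spinor_norm x = 1.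
Proof.
move=> x0; have norm_pm y : Spin0In S y -> spinor_norm y = 1 \/ spinor_norm y = -1.
  by move=> /Spin0In_SpinIn[/PinIn_Pin Py _]; exact: spinor_norm_pm1.
have [//|nx] := norm_pm _ x0.
have : is_interval (@spinor_norm R p q @` Spin0In S).
  apply/connected_intervalP; apply: connected_continuous_connected.
    exact: component_connected.
  exact/continuous_subspaceT/spinor_norm_continuous.
move=> itv; have [|||z z0 nz] := itv (-1) 1 _ _ 0.
- by exists x.
- by exists (1 : clifford); [exact: Spin0In1|exact: spinor_norm1].
- by rewrite lerN10 ler01.
by have := norm_pm _ z0; rewrite nz => -[]; lra.
Qed.

(* The sign cannot be dropped: -1 is not in the identity component for R^{1,1}. *)
Definition pmSpin0In : set (Cl R p q) :=
  [set x | Spin0In S x \/ Spin0In S (- (x : clifford))].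

Lemma pmSpin0InM x y : pmSpin0In x -> pmSpin0In y -> pmSpin0In (x * y).
Proof.
by move=> [x0|x0] [y0|y0]; have := Spin0InM x0 y0; rewrite ?mulNr ?mulrN ?opprK;
  [left|right..|left].
Qed.

End Spin0Group.

Section UnitSegment.
Variables (R : realType) (p q : nat) (S : set (Vec R p q)) (e : R) (u v : Vec R p q).
Hypotheses (subS : vec_subspace S) (Su : S u) (Sv : S v).
Hypotheses (e_unit : e = 1 \/ e = -1) (uu : ip u u = e) (vv : ip v v = e).
Hypothesis uv_ge0 : 0 <= e * ip u v.
Implicit Types t : R.
Local Notation clifford := (clifford R p q).

Let segment t := (1 - t) *: u + t *: v.
Let segment_norm t := e * ip (segment t) (segment t).

Definition unit_segment t := (Num.sqrt (segment_norm t))^-1 *: segment t.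

Let segment_normE t :
  segment_norm t = (1 - t) ^+ 2 + t ^+ 2 + 2 * t * (1 - t) * (e * ip u v).
Proof.
rewrite /segment_norm /segment !ip_bilinear uu vv (ipC v u).
by case: e_unit => ->; ring.
Qed.

Let segment_norm_gt0 t : t \in `[0, 1] -> 0 < segment_norm t.
Proof.
rewrite in_itv /= segment_normE => /andP[t0 t1].
have : 0 <= 2 * t * (1 - t) * (e * ip u v).
  by rewrite mulr_ge0 // mulr_ge0 ?mulr_ge0 // subr_ge0.
nra.
Qed.

Lemma unit_segment_norm t : t \in `[0, 1] -> ip (unit_segment t) (unit_segment t) = e.
Proof.
move=> /segment_norm_gt0 d_gt0; rewrite ipZl ipZr mulrA -invfM -expr2 sqr_sqrtr ?ltW //.
have -> : ip (segment t) (segment t) = e * segment_norm t.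
  by rewrite /segment_norm mulrA; case: e_unit => ->; rewrite ?mulrNN !mulr1 mul1r.
by rewrite mulrCA mulVf ?gt_eqF // mulr1.
Qed.

Lemma unit_segment_in t : S (unit_segment t).
Proof. by apply: vec_subspaceZ => //; apply: vec_subspaceD => //; exact: vec_subspaceZ. Qed.

Lemma unit_segment0 : unit_segment 0 = u.
Proof.
rewrite /unit_segment segment_normE subr0 expr1n expr0n /= mulr0 !mul0r !addr0.
by rewrite sqrtr1 invr1 scale1r /segment subr0 scale1r scale0r addr0.
Qed.

Lemma unit_segment1 : unit_segment 1 = v.
Proof.
rewrite /unit_segment segment_normE subrr expr1n expr0n /= mulr0 !mul0r addr0 add0r.
by rewrite sqrtr1 invr1 scale1r /segment subrr scale1r scale0r add0r.
Qed.

Lemma unit_segment_cvg t : t \in `[0, 1] ->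
  vec (unit_segment s) @[s --> t] --> vec (unit_segment t).
Proof.
move=> t01; apply: vec_cvg => i; rewrite /unit_segment mxE.
under eq_cvg do rewrite mxE.
have segment_cvg j : segment s ord0 j @[s --> t] --> segment t ord0 j.
  rewrite /segment; under eq_cvg do rewrite !mxE; rewrite !mxE.
  apply: cvgD; apply: cvgM; try exact: cvg_cst; last exact: cvg_id.
  by apply: cvgB; [exact: cvg_cst|exact: cvg_id].
apply: cvgM => //; apply: cvgV; first by rewrite gt_eqF // sqrtr_gt0 segment_norm_gt0.
apply: (@cvg_comp _ _ _ segment_norm (@Num.sqrt R)); last exact: sqrt_continuous.
apply: cvgM; first exact: cvg_cst.
apply: sum_cvg => j _; apply: cvgM => //.
by apply: cvgM => //; exact: cvg_cst.
Qed.

(* The normalised straight segment from u to v stays away from the null cone. *)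
Lemma Spin0In_segment : Spin0In S (- e *: (cvec u * cvec v)).
Proof.
have unit_e (w : Vec R p q) : ip w w = e -> unit_vec w by rewrite /unit_vec => ->.
pose path t : Cl R p q := cl_scale (- e) (cl_mul (vec u) (vec (unit_segment t))).
have path_e t : path t = - e *: (cvec u * cvec (unit_segment t)) by [].
have path_continuous : {within `[0 : R, 1], continuous path}.
  apply: continuous_in_subspaceT => t; rewrite inE /= => t01.
  apply: cl_scale_cvg; first exact: cvg_cst.
  by apply: cl_mul_cvg; [exact: cvg_cst|exact: unit_segment_cvg].
apply: (@connected_component_max _ _ (path @` `[0, 1])).
- exists 0; first by rewrite /= in_itv /= lexx ler01.
  rewrite path_e unit_segment0 cvec_sqr uu scalerA.
  by case: e_unit => ->; rewrite ?mulrNN ?mulr1 scale1r.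
- move=> _ [t t01 <-]; rewrite path_e.
  have := SpinIn_cvecM Su (unit_e _ uu) (unit_segment_in t)
    (unit_e _ (unit_segment_norm t01)).
  case: e_unit => ->; rewrite ?opprK ?scale1r // scaleN1r.
  exact: SpinInN Su (unit_e _ uu).
- by apply: connected_continuous_connected path_continuous; exact: segment_connected.
- by exists 1; rewrite ?path_e ?unit_segment1 //= in_itv /= lexx ler01.
Qed.

End UnitSegment.

Section Spin0Products.
Variables (R : realType) (p q : nat) (S : set (Vec R p q)).
Hypothesis subS : vec_subspace S.
Implicit Types (u v w : Vec R p q) (s : seq (Vec R p q)) (x : clifford R p q).
Local Notation clifford := (clifford R p q).

Lemma pmSpin0In_cvecM u v : S u -> S v -> unit_vec u -> ip v v = ip u u ->
  pmSpin0In S (cvec u * cvec v).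
Proof.
move=> Su Sv uu vv; have [uv|uv] := leP 0 (ip u u * ip u v).
  have := Spin0In_segment subS Su Sv uu erefl vv uv.
  by case: uu => ->; rewrite ?opprK ?scale1r ?scaleN1r; [right|left].
have := Spin0In_segment subS Su (vec_subspaceN subS Sv) uu erefl.
rewrite !ipNr ipNl opprK mulrN oppr_ge0 linearN mulrN scalerN => /(_ vv (ltW uv)).
by case: uu => ->; rewrite ?opprK ?scale1r ?scaleN1r ?opprK; [left|right].
Qed.

Lemma pmSpin0In_vprod (e : R) s : e = 1 \/ e = -1 ->
  (forall v, v \in s -> S v /\ ip v v = e) -> ~~ odd (size s) -> pmSpin0In S (vprod s).
Proof.
move=> e_unit; have [n] := ubnP (size s); elim: n s => // n IH [|u [|v s]] //= sn Ss.
  by rewrite vprod_nil; left; exact: Spin0In1.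
rewrite negbK => es; have [Su uu] := Ss u (mem_head _ _).
have [Sv vv] : S v /\ ip v v = e by apply: Ss; rewrite !inE eqxx orbT.
rewrite !vprod_cons mulrA; apply: pmSpin0InM.
  by apply: pmSpin0In_cvecM => //; [rewrite /unit_vec uu|rewrite uu vv].
apply: IH => // [|w ws]; first by move: sn; rewrite !ltnS => /ltnW.
by apply: Ss; rewrite !inE ws !orbT.
Qed.

Lemma cvec_vprod_swap s v : unit_vec v ->
  cvec v * vprod s = vprod [seq - reflection v w | w <- s] * cvec v.
Proof.
move=> uv; elim: s => [|w s IH] /=; first by rewrite vprod_nil mulr1 mul1r.
rewrite !vprod_cons -mulrA -IH !mulrA linearN /= mulNr cvec_reflection //.
by rewrite opprK.
Qed.

Lemma vprod_sort s : unit_seq S s -> exists sp sn,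
  [/\ forall v, v \in sp -> S v /\ ip v v = 1, forall v, v \in sn -> S v /\ ip v v = -1,
      (size sp + size sn = size s)%N & vprod s = vprod sp * vprod sn].
Proof.
elim: s => [_|v s IH /unit_seq_cons[Sv uv /IH[sp [sn [Psp Psn sz prodE]]]]].
  by exists [::], [::]; rewrite vprod_nil mulr1.
case: (uv) => vv.
  exists (v :: sp), sn; rewrite /= addSn sz !vprod_cons prodE mulrA; split=> // w.
  by rewrite inE => /orP[/eqP->//|/Psp].
exists [seq - reflection v w | w <- sp], (v :: sn); split.
- move=> _ /mapP[w /Psp[Sw ww] ->]; split.
    by apply: vec_subspaceN => //; exact: reflection_subspace.
  by rewrite ipNl ipNr opprK ip_reflection.
- by move=> w; rewrite inE => /orP[/eqP->//|/Psn].
- by rewrite size_map /= addnS sz.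
- by rewrite !vprod_cons prodE !mulrA cvec_vprod_swap.
Qed.

Lemma SpinIn_norm1_pmSpin0In x : SpinIn S x -> spinor_norm x = 1 -> pmSpin0In S x.
Proof.
move=> /SpinInP[s [us es ->]]; have [sp [sn [Psp Psn sz ->]]] := vprod_sort us.
rewrite -vprod_cat spinor_norm_vprod vprod_norm_cat.
rewrite (vprod_norm_const (e := 1)) => [|v /Psp[]//].
rewrite (vprod_norm_const (e := -1)) => [|v /Psn[]//].
rewrite opprK expr1n mulr1 vprod_cat -signr_odd => norm1.
have ep : ~~ odd (size sp).
  by move: norm1; case: (odd _) => //; rewrite expr1; lra.
have en : ~~ odd (size sn) by move: es; rewrite -sz oddD (negbTE ep).
apply: pmSpin0InM.
  by apply: (@pmSpin0In_vprod 1) => //; left.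
by apply: (@pmSpin0In_vprod (-1)) => //; right.
Qed.

Lemma Spin0InP x : Spin0In S (-1 : clifford) ->
  Spin0In S x <-> SpinIn S x /\ spinor_norm x = 1.
Proof.
move=> N1; split=> [x0|[Sx nx]].
  by split; [exact: Spin0In_SpinIn|exact: spinor_norm_Spin0In x0].
have [//|/(Spin0InM N1)] := SpinIn_norm1_pmSpin0In Sx nx.
by rewrite mulN1r opprK.
Qed.

Lemma Spin0In_N1 u v : S u -> S v -> unit_vec u -> ip v v = ip u u -> ip u v = 0 ->
  Spin0In S (-1 : clifford).
Proof.
move=> Su Sv uu vv uv.
have w0 : Spin0In S (- ip u u *: (cvec u * cvec v)).
  by apply: Spin0In_segment => //; rewrite uv mulr0.
have := Spin0InM w0 w0; rewrite -scalerAl -scalerAr scalerA mulrNN unit_vec_sqr // scale1r.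
rewrite mulrA -(mulrA (cvec u)) (cvec_swap_orth uv) mulrN mulNr mulrA.
rewrite -(mulrA (cvec u * _)) !cvec_sqr vv -scalerAl mul1r scalerA mulrNN.
by rewrite unit_vec_sqr // scale1r.
Qed.

End Spin0Products.

(** * The universal property of the Clifford algebra *)

Section CliffordLift.
Variables (R : realType) (p q : nat) (A : algType R) (c : 'I_(p + q) -> A).
Implicit Types (i : 'I_(p + q)) (B : blade p q).

Definition lift_blade B : A := \prod_(k <- enum B) c k.
Definition clifford_lift (x : clifford R p q) : A := \sum_B x B *: lift_blade B.

Fact clifford_lift_is_linear : linear clifford_lift.
Proof.
move=> a x y; rewrite /clifford_lift scaler_sumr -big_split; apply: eq_bigr => B _ /=.
by rewrite cl_coefD cl_coefZ scalerDl scalerA.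
Qed.

HB.instance Definition _ :=
  GRing.isLinear.Build R (clifford R p q) A _ clifford_lift clifford_lift_is_linear.

Lemma clifford_lift_blade B : clifford_lift (basis_blade R B) = lift_blade B.
Proof.
rewrite /clifford_lift (bigD1 B) //= basis_bladeE eqxx scale1r big1 ?addr0 // => C CB.
by rewrite basis_bladeE (negbTE CB) scale0r.
Qed.

Lemma clifford_lift1 : clifford_lift 1 = 1.
Proof. by rewrite -basis_blade0 clifford_lift_blade /lift_blade enum_set0 big_nil. Qed.

Hypothesis c_anticomm : forall i j, i != j -> c i * c j = - (c j * c i).
Hypothesis c_sqr : forall i, c i * c i = (- ip_sign R i)%:A.

(* One sign for each smaller factor that c i passes, and the square of c i if it occurs. *)
Lemma mul_prod_sorted i B (s : seq 'I_(p + q)) :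
  sorted (fun a b : 'I_(p + q) => (a < b)%N) s -> i \in s ->
  c i * \prod_(k <- s | k \in B) c k =
  (\prod_(k <- s) (-1) ^+ ((k \in B) && (k < i)%N) * (- ip_sign R i) ^+ (i \in B)) *:
    \prod_(k <- s | k \in symdiff (blade1 i) B) c k.
Proof.
elim: s => //= j s IH ps; rewrite inE.
have lt_trans : transitive (fun a b : 'I_(p + q) => (a < b)%N).
  by move=> ? ? ?; apply: ltn_trans.
have sorted_s := path_sorted ps.
have js : all (fun b : 'I_(p + q) => (j < b)%N) s.
  by rewrite (path_sortedE lt_trans) in ps; case/andP: ps.
rewrite !big_cons in_symdiff inE; have [ij|ij] /= := eqVneq i j.
  subst j; rewrite ?eqxx ltnn andbF expr0 mul1r => _.
  have -> : \prod_(k <- s) (-1) ^+ ((k \in B) && (k < i)%N) = 1 :> R.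
    rewrite big_seq big1 // => k /(allP js) ik.
    by rewrite ltnNge (ltnW ik) andbF.
  have -> : \prod_(k <- s | k \in symdiff (blade1 i) B) c k = \prod_(k <- s | k \in B) c k.
    rewrite !(big_seq_cond (fun k => k \in _)); apply: eq_bigl => k.
    have [ks|//] := boolP (k \in s); rewrite in_symdiff inE.
    by have := allP js _ ks; rewrite ltn_neqAle eq_sym val_eqE => /andP[/negbTE-> _].
  rewrite mul1r; case: (i \in B) => /=; last by rewrite expr0 scale1r.
  by rewrite mulrA c_sqr -scalerAl mul1r expr1.
move=> iS; have ji := allP js _ iS.
case: (j \in B) => /=; last by rewrite expr0 mul1r IH.
rewrite mulrA c_anticomm // mulNr -[c j * c i * _]mulrA IH // ji expr1 mulN1r mulNr.
by rewrite scaleNr -scalerAr.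
Qed.

Lemma mul_lift_blade i B :
  c i * lift_blade B = blade_sign R (blade1 i) B *: lift_blade (symdiff (blade1 i) B).
Proof.
have lift_bladeE C : lift_blade C = \prod_(k <- enum 'I_(p + q) | k \in C) c k.
  by rewrite -big_filter; congr bigop; rewrite enumT; exact: eq_filter.
rewrite !lift_bladeE mul_prod_sorted ?mem_enum //; last first.
  by rewrite -[sorted _ _](@sorted_map _ _ val ltn) val_enum_ord iota_ltn_sorted.
by rewrite big_enum blade_signE inversion_sign1l square_sign1l.
Qed.

Lemma clifford_lift_cvecM v x :
  clifford_lift (cvec v * x) = (\sum_i v ord0 i *: c i) * clifford_lift x.
Proof.
rewrite cvecE mulr_suml linear_sum mulr_suml; apply: eq_bigr => i _.
rewrite -!scalerAl linearZZ; congr (_ *: _).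
rewrite {1}[x]blade_sum mulr_sumr linear_sum /= [in RHS]/clifford_lift mulr_sumr.
apply: eq_bigr => B _; rewrite -!scalerAr linearZZ basis_bladeM linearZZ.
by rewrite /= clifford_lift_blade mul_lift_blade.
Qed.

Lemma clifford_lift_vprodM s x :
  clifford_lift (vprod s * x) = clifford_lift (vprod s) * clifford_lift x.
Proof.
elim: s => [|v s IH]; first by rewrite vprod_nil clifford_lift1 !mul1r.
by rewrite vprod_cons -mulrA !clifford_lift_cvecM IH mulrA.
Qed.

Lemma clifford_lift_vprod s :
  clifford_lift (vprod s) = \prod_(v <- s) \sum_i v ord0 i *: c i.
Proof.
elim: s => [|v s IH]; first by rewrite vprod_nil clifford_lift1 big_nil.
by rewrite vprod_cons clifford_lift_cvecM IH big_cons.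
Qed.

End CliffordLift.

Section EvenSubalgebra.
Variables (R : realType) (p q : nat).
Implicit Types (A : blade p q) (x y : clifford R p q).

Lemma basis_vec_anticomm (i j : 'I_(p + q)) : i != j ->
  cvec (basis_vec R i) * cvec (basis_vec R j) =
  - (cvec (basis_vec R j) * cvec (basis_vec R i)).
Proof.
by move=> ij; rewrite cvec_swap_orth // ip_basis_basis eq_sym (negbTE ij) mulr0.
Qed.

Lemma basis_vec_sqr (i : 'I_(p + q)) :
  cvec (basis_vec R i) * cvec (basis_vec R i) = (- ip_sign R i)%:A.
Proof. by rewrite cvec_sqr ip_basis_basis eqxx mulr1. Qed.

Lemma basis_blade_vprod A : basis_blade R A = vprod [seq basis_vec R i | i <- enum A].
Proof.
rewrite /vprod big_map -/(lift_blade (fun i => cvec (basis_vec R i)) A).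
have [n] := ubnP #|A|; elim: n A => // n IH A An.
have [->|/set0Pn[i iA]] := eqVneq A blade0.
  by rewrite basis_blade0 /lift_blade enum_set0 big_nil.
rewrite (card_symdiff1 iA) ltnS in An.
apply: (scalerI (blade_sign_neq0 R (blade1 i) (symdiff (blade1 i) A))).
have := mul_lift_blade basis_vec_anticomm basis_vec_sqr i (symdiff (blade1 i) A).
by rewrite -IH // cvec_basis basis_bladeM symdiffKl.
Qed.

Lemma cl_even_ind (S : set (Cl R p q)) x : S (1 : clifford R p q) ->
  (forall y z, S y -> S z -> S (cl_add y z)) ->
  (forall a y, S y -> S (cl_scale a y)) ->
  (forall y z, S y -> S z -> S (cl_mul y z)) ->
  (forall i j, S (cvec (basis_vec R i) * cvec (basis_vec R j))) ->
  cl_even x -> S x.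
Proof.
move=> S1 SD SZ SM Sij ex.
have S_vprod (s : seq 'I_(p + q)) :
    ~~ odd (size s) -> S (vprod [seq basis_vec R i | i <- s]).
  have [n] := ubnP (size s); elim: n s => // n IH [|i [|j s]] //=.
    by rewrite vprod_nil.
  rewrite !ltnS negbK => /ltnW sn es; rewrite !vprod_cons mulrA.
  by apply: SM => //; exact: IH.
have S0 : S (0 : clifford R p q) by rewrite -(scale0r (1 : clifford R p q)); exact: SZ.
rewrite [x]blade_sum; elim/big_ind: _ => [//|y z|A _]; first exact: SD.
have [oA|eA] := boolP (odd #|A|).
  by rewrite ex // scale0r.
by apply: SZ; rewrite basis_blade_vprod; apply: S_vprod; rewrite -cardE.
Qed.

End EvenSubalgebra.

(** * Equivariance *)

Section Equivariance.
Variables (R : realType) (p q m : nat).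
Variables (rho : Cl R p q -> 'M[R]_m) (Pi : 'cV[R]_m -> 'cV[R]_m -> Vec R p q).
Hypotheses (rhoP : is_Cl0_module rho) (PiP : is_wedge2_map Pi).
Hypothesis Pi_equivariant : equivariant rho Pi.
Implicit Types (u v w z f : Vec R p q) (l : seq (Vec R p q)) (s t : 'cV[R]_m).
Implicit Types (x y : clifford R p q).
Local Notation clifford := (clifford R p q).

Lemma rho1 : rho (1 : clifford) = 1%:M. Proof. by case: rhoP. Qed.

Lemma rhoD x y : cl_even x -> cl_even y -> rho (x + y) = rho x + rho y.
Proof. by case: rhoP => _ + _ _; apply. Qed.

Lemma rhoZ a x : cl_even x -> rho (a *: x) = a *: rho x.
Proof. by case: rhoP => _ _ + _; apply. Qed.

Lemma rhoM x y : cl_even x -> cl_even y -> rho (x * y) = rho x *m rho y.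
Proof. by case: rhoP => _ _ _; apply. Qed.

Lemma rho_scalar a : rho (a%:A : clifford) = a%:M.
Proof. by rewrite rhoZ ?rho1 ?scalemx1 //; exact: cl_even1. Qed.

Lemma PiDl s s' t : Pi (s + s') t = Pi s t + Pi s' t.
Proof. by case: PiP => _ PiP'; rewrite -[s]scale1r PiP' !scale1r. Qed.

Lemma Pi0l t : Pi 0 t = 0.
Proof. by apply: (@addrI _ (Pi 0 t)); rewrite -PiDl !addr0. Qed.

Lemma PiZl a s t : Pi (a *: s) t = a *: Pi s t.
Proof. by case: PiP => _ PiP'; rewrite -[a *: s]addr0 PiP' Pi0l addr0. Qed.

Lemma PiDr s t t' : Pi s (t + t') = Pi s t + Pi s t'.
Proof. by case: PiP => skew _; rewrite skew PiDl opprD -!(skew s). Qed.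

Lemma PiZr a s t : Pi s (a *: t) = a *: Pi s t.
Proof. by case: PiP => skew _; rewrite skew PiZl -scalerN -skew. Qed.

(* The derivation through which the even element uv acts: as an element of
   R + spin(V), uv is - <u,v> - 2 (u /\ v). *)
Definition bivector_act u v z : Vec R p q := - 2 *: wedge_act u v z - (2 * ip u v) *: z.

Lemma bivector_actD u v z w :
  bivector_act u v (z + w) = bivector_act u v z + bivector_act u v w.
Proof.
by rewrite /bivector_act /wedge_act !ipDr; apply/rowP => i; rewrite !mxE; ring.
Qed.

Lemma bivector_actB u v z w :
  bivector_act u v (z - w) = bivector_act u v z - bivector_act u v w.
Proof.
by rewrite /bivector_act /wedge_act !ip_bilinear; apply/rowP => i; rewrite !mxE; ring.
Qed.

Lemma wedge_spinE u v :
  wedge_spin u v = (- 2^-1) *: (cvec u * cvec v + (ip u v)%:A) :> clifford.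
Proof.
rewrite /wedge_spin -[cl_mul (vec v) (vec u)]/(cvec v * cvec u) (cvec_swap u v).
rewrite !cl_scaleE -[cl_mul _ _]/(cvec u * cvec v) cl_addE.
rewrite scaleN1r opprB addrA -mulr2n -[cvec u * cvec v *+ 2]scaler_nat -scaleNr.
by rewrite !scalerDr !scalerA; congr (_ *: _ + _ *: _); field.
Qed.

Lemma Pi_leibniz u v s t :
  Pi (rho (cvec u * cvec v) *m s) t + Pi s (rho (cvec u * cvec v) *m t) =
  bivector_act u v (Pi s t).
Proof.
have even_uv := cl_even_cvecM u v; have even_a := cl_evenZ (ip u v) (@cl_even1 R p q).
have := Pi_equivariant u v s t.
rewrite wedge_spinE rhoZ ?rhoD ?rho_scalar //; last exact: cl_evenD.
rewrite -!scalemxAl !mulmxDl !mul_scalar_mx !PiZl !PiZr !PiDl !PiDr !PiZl !PiZr.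
by rewrite /bivector_act => <-; apply/rowP => i; rewrite !mxE; field.
Qed.

Lemma cvecM_sqr u v : cvec u * cvec v * (cvec u * cvec v) =
  - (2 * ip u v) *: (cvec u * cvec v) + (- (ip u u * ip v v))%:A :> clifford.
Proof.
rewrite mulrA -(mulrA (cvec u)) (cvec_swap u v) mulrBr mulrBl -scalerAr mulr1 -scalerAl.
rewrite mulNr mulrA -(mulrA _ (cvec v)) !cvec_sqr -scalerAl mul1r scalerA mulrNN.
by rewrite -(scaleNr _ 1).
Qed.

Lemma rho_cvecM_sqr u v s (A := rho (cvec u * cvec v)) :
  A *m (A *m s) = - (2 * ip u v) *: (A *m s) + (- (ip u u * ip v v)) *: s.
Proof.
have even_uv := cl_even_cvecM u v.
rewrite mulmxA -rhoM // cvecM_sqr rhoD; [|exact: cl_evenZ|exact/cl_evenZ/cl_even1].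
by rewrite rhoZ // rho_scalar mulmxDl -scalemxAl mul_scalar_mx.
Qed.

(* Apply the Leibniz rule to (A s, t) and to (s, A t), and use the quadratic equation
   satisfied by A. *)
Lemma Pi_bivector u v s t (A := rho (cvec u * cvec v)) (D := bivector_act u v) :
  Pi (A *m s) (A *m t) =
  2^-1 *: D (D (Pi s t)) + ip u v *: D (Pi s t) + (ip u u * ip v v) *: Pi s t.
Proof.
have ruleAs := Pi_leibniz u v (A *m s) t; have ruleAt := Pi_leibniz u v s (A *m t).
rewrite -/A rho_cvecM_sqr PiDl !PiZl in ruleAs.
rewrite -/A rho_cvecM_sqr PiDr !PiZr in ruleAt.
have ruleA := Pi_leibniz u v s t; rewrite -/A -/D in ruleA ruleAs ruleAt.
rewrite -ruleA [D (_ + _)]bivector_actD -/D -ruleAs -ruleAt.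
by apply/rowP => i; rewrite !mxE; field.
Qed.

Lemma Pi_unit_pair u v s t (A := rho (cvec u * cvec v)) : unit_vec u -> unit_vec v ->
  Pi (A *m s) (A *m t) = (ip u u * ip v v) *: reflection u (reflection v (Pi s t)).
Proof.
move=> uu uv; rewrite Pi_bivector /bivector_act /wedge_act /reflection.
rewrite !ip_bilinear (ipC v u); apply/rowP => i; rewrite !mxE.
by case: uu => ->; case: uv => ->; field.
Qed.

Lemma Pi_Spin x s t : Spin R p q x ->
  Pi (rho x *m s) (rho x *m t) = spinor_norm x *: spin_act x (Pi s t).
Proof.
case/SpinInP => l [ul el ->]; rewrite (spin_act_vprod _ ul) // spinor_norm_vprod.
have [n] := ubnP (size l); elim: n l ul el => // n IH [|u [|v l]] //=.
  by move=> _ _ _; rewrite vprod_nil rho1 !mul1mx vprod_norm_nil scale1r.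
move=> /unit_seq_cons[_ uu /unit_seq_cons[_ uv ul]]; rewrite negbK !ltnS => el /ltnW ln.
rewrite !vprod_cons mulrA rhoM; [|exact: cl_even_cvecM|exact: cl_even_vprod].
rewrite -!mulmxA (Pi_unit_pair _ _ uu uv) (IH _ ul el ln) !vprod_norm_cons mulrA mulrNN.
have reflectionZ a w z : reflection w (a *: z) = a *: reflection w z by exact: linearZZ.
by rewrite !reflectionZ scalerA.
Qed.

Lemma Pi_contract_orth f v s t : ip f f = 1 -> ip f v = 0 ->
  ip f (Pi (rho (cvec f * cvec v) *m s) t) = - ip v (Pi s t).
Proof.
move=> f1 fv; set A := rho _.
pose X := Pi (A *m s) t; pose Y := Pi s (A *m t).
have XY : X + Y = bivector_act f v (Pi s t) by exact: Pi_leibniz.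
have fXY : ip f (X + Y) = - 2 * ip v (Pi s t).
  by rewrite XY /bivector_act /wedge_act !ip_bilinear f1 fv; ring.
have same : bivector_act f v (X - Y) = 0.
  rewrite bivector_actB -!Pi_leibniz -/A !rho_cvecM_sqr fv.
  rewrite !mulr0 !oppr0 !scale0r !add0r !PiZl !PiZr.
  by apply/rowP => i; rewrite !mxE; ring.
have vXY : ip v (X - Y) = 0.
  have := congr1 (ip f) same; rewrite /bivector_act /wedge_act !ip_bilinear f1 fv.
  by rewrite (ipC f 0) ip0l; lra.
have : (2 * ip f (X - Y)) *: v = 0.
  by rewrite -same /bivector_act /wedge_act vXY fv mulr0 !scale0r sub0r subr0 scalerN
    scaleNr opprK scalerA.
move/eqP; rewrite scaler_eq0 mulf_eq0 pnatr_eq0 /= => /orP[/eqP fX_fY|/eqP v0].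
  by move: fX_fY fXY; rewrite !ip_bilinear /X; lra.
rewrite /A v0 linear0 /= mulr0 -(scale0r (1 : clifford)) rho_scalar mul_scalar_mx scale0r.
by rewrite Pi0l ipC !ip0l oppr0.
Qed.

Lemma Pi_contract f v s t : ip f f = 1 ->
  ip f (Pi (rho (cvec f * cvec v) *m s) t) = - ip v (Pi s t).
Proof.
move=> f1; pose w := v - ip f v *: f.
have vE : v = ip f v *: f + w by rewrite addrC subrK.
have fw : ip f w = 0 by rewrite /w !ip_bilinear f1 mulr1 subrr.
rewrite {1}vE linearP /= mulrDr -scalerAr cvec_sqr f1 scalerA mulrN1.
rewrite rhoD; [|exact/cl_evenZ/cl_even1|exact: cl_even_cvecM].
rewrite rho_scalar mulmxDl mul_scalar_mx PiDl PiZl ipDr ipZr Pi_contract_orth //.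
have -> : ip v (Pi s t) = ip f v * ip f (Pi s t) + ip w (Pi s t) by rewrite -ipZl -ipDl -vE.
by ring.
Qed.

End Equivariance.

(** * Products over a splitting of the basis *)

Section CoordinateSplitting.
Variables (R : realType) (p q : nat) (J : pred 'I_(p + q)).
Implicit Types (u v : Vec R p q) (s h : seq (Vec R p q)) (a c x : clifford R p q).
Local Notation clifford := (clifford R p q).
Local Notation VJ := (@coord_space R p q J).
Local Notation VJc := (@coord_space R p q (predC J)).

Lemma vprod_swap s h : unit_seq VJ s -> unit_seq VJc h ->
  vprod h * vprod s = (-1) ^+ (size s * size h) *: (vprod s * vprod h).
Proof.
move=> us uh; elim: s us => [_|u s IH /unit_seq_cons[Ju _ us]].
  by rewrite vprod_nil mulr1 mul1r scale1r.
have := cvec_reflections u uh; rewrite (reflections_fixr uh Ju).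
move/(congr1 (fun x => (-1) ^+ size h *: x)); rewrite scalerA -expr2 sqrr_sign scale1r.
move=> swap_u; rewrite vprod_cons mulrA -swap_u -!scalerAl -!mulrA IH // -scalerAr scalerA.
by rewrite mulSn exprD.
Qed.

Lemma PinIn_swap a c : PinIn VJ a -> PinIn VJc c -> c * a = a * c \/ c * a = - (a * c).
Proof.
move=> /PinInP[s us ->] /PinInP[h uh ->]; rewrite (vprod_swap us uh) -signr_odd.
by case: (odd _); rewrite ?scaleN1r ?scale1r; [right|left].
Qed.

Lemma SpinIn_comm a c : SpinIn VJ a -> PinIn VJc c -> c * a = a * c.
Proof.
move=> /SpinInP[s [us es ->]] /PinInP[h uh ->]; rewrite (vprod_swap us uh) -signr_odd.
by rewrite oddM (negbTE es) scale1r.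
Qed.

Lemma spin_act_split a c : PinIn VJ a -> PinIn VJc c -> cl_even (a * c) ->
  (forall v, VJ v -> VJ (spin_act (a * c) v)) /\
  (forall v, VJc v -> VJc (spin_act (a * c) v)).
Proof.
move=> /PinInP[s us ->] /PinInP[h uh ->]; rewrite -vprod_cat => ev.
have ush := unit_seqT_cat us uh; have esh := odd_vprod_even ush ev.
split=> v Jv; rewrite (spin_act_vprod _ ush) // reflections_cat.
  rewrite (reflections_fixr uh Jv).
  exact: (reflections_subspace (coord_space_subspace R J)).
have Jhv := reflections_subspace (coord_space_subspace R _) uh Jv.
by rewrite (reflections_fixl us Jhv).
Qed.

Variable e : R.
Hypothesis sign_J : forall i, J i -> ip_sign R i = e.

Lemma ip_definite v : VJ v -> ip v v = e * \sum_i v ord0 i ^+ 2.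
Proof.
move=> Jv; rewrite mulr_sumr; apply: eq_bigr => i _.
by have [/sign_J->|/Jv->] := boolP (J i); rewrite ?expr2; ring.
Qed.

Lemma ip_definite_ge0 v : VJ v -> 0 <= e * ip v v.
Proof.
move=> Jv; rewrite ip_definite // mulrA mulr_ge0 ?sumr_ge0 // => [|i _].
  by rewrite -expr2 sqr_ge0.
exact: sqr_ge0.
Qed.

Hypothesis e_unit : e = 1 \/ e = -1.

Lemma ip_definite_unit v : VJ v -> unit_vec v -> ip v v = e.
Proof.
move=> /ip_definite_ge0 ev_ge0 [] v1; move: ev_ge0; rewrite v1; case: e_unit => ->; lra.
Qed.

Lemma vprod_norm_definite s : unit_seq VJ s -> vprod_norm s = (- e) ^+ size s.
Proof. by move=> us; apply: vprod_norm_const => v /us[Jv uv]; exact: ip_definite_unit. Qed.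

End CoordinateSplitting.

(** * The volume element of E *)

Section OrthogonalSequences.
Variables (R : realType) (p q : nat).
Implicit Types (u v w : Vec R p q) (s : seq (Vec R p q)).

Definition orthogonal_seq s := pairwise (fun u v => ip u v == 0) s.

Lemma vprod_rev_orthogonal s : orthogonal_seq s ->
  vprod (rev s) = (-1) ^+ 'C(size s, 2) *: vprod s.
Proof.
elim: s => [|u s IH] /=; first by rewrite scale1r.
case/andP => us /IH rev_s; rewrite rev_cons -cats1 vprod_cat rev_s vprod1.
rewrite -scalerAl binS bin1 exprD -scalerA vprod_cons; congr (_ *: _).
elim: s us {IH rev_s} => [|v s IH] /=; first by rewrite vprod_nil mulr1 mul1r scale1r.
case/andP => /eqP uv /IH swap_s; rewrite vprod_cons -mulrA swap_s -scalerAr !mulrA.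
by rewrite (cvec_swap_orth uv) mulNr exprS mulN1r scaleNr scalerN.
Qed.

Lemma reflections_orthogonal_mem s u : orthogonal_seq s -> u \in s -> unit_vec u ->
  reflections s u = - u.
Proof.
elim: s => //= w s IH /andP[/allP ws os]; rewrite inE => us uu.
have [uw|uw] := eqVneq u w.
  rewrite -uw reflections_orth ?reflection_id // => v /ws.
  by rewrite -uw ipC => /eqP.
rewrite (negbTE uw) /= in us.
rewrite IH // linearN /= reflection_orth //; exact/eqP/ws.
Qed.

End OrthogonalSequences.

Section BasisSequences.
Variables (R : realType) (p q : nat).
Implicit Types (i j k l : nat).

Definition below (k : nat) : pred 'I_(p + q) := fun i : 'I_(p + q) => (i < k)%N.

Lemma EE_coord_space k : EE R p q k = coord_space (below k).
Proof.
by apply/seteqP; split=> v /= Ev i ik; apply: Ev; move: ik; rewrite /below -leqNgt.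
Qed.

Lemma EE'_coord_space k : EE' R p q k = coord_space (predC (below k)).
Proof.
by apply/seteqP; split=> v /= Ev i ik; apply: Ev; move: ik; rewrite /below /= ?negbK.
Qed.

Lemma basis_natE (i : 'I_(p + q)) : basis_nat R p q i = basis_vec R i.
Proof. by apply/rowP => j; rewrite mxE basis_vecE -val_eqE. Qed.

Lemma basis_nat_below k i : (i < k)%N -> coord_space (below k) (basis_nat R p q i).
Proof.
move=> ik j; rewrite /below -leqNgt mxE => kj.
by rewrite gtn_eqF // (leq_trans ik kj).
Qed.

Lemma basis_nat_above k i : (k <= i)%N -> coord_space (predC (below k)) (basis_nat R p q i).
Proof.
move=> ki j; rewrite /= negbK /below mxE => jk.
by rewrite ltn_eqF // (leq_trans jk ki).
Qed.

Lemma ip_basis_nat i j : (i < p + q)%N ->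
  ip (basis_nat R p q i) (basis_nat R p q j) = (if (i < p)%N then 1 else -1) * (i == j)%:R.
Proof. by move=> ipq; rewrite (basis_natE (Ordinal ipq)) ip_basis mxE. Qed.

Lemma unit_vec_basis_nat i : (i < p + q)%N -> unit_vec (basis_nat R p q i).
Proof. by move=> ipq; rewrite (basis_natE (Ordinal ipq)); exact: unit_vec_basis. Qed.

Lemma ip_basis_nat_pos i : (i < p)%N -> ip (basis_nat R p q i) (basis_nat R p q i) = 1.
Proof. by move=> ip_; rewrite ip_basis_nat ?ip_ ?eqxx ?mulr1 // ltn_addr. Qed.

Lemma ip_basis_nat_neq i j : (i < p + q)%N -> i != j ->
  ip (basis_nat R p q i) (basis_nat R p q j) = 0.
Proof. by move=> ipq ij; rewrite ip_basis_nat // (negbTE ij) mulr0. Qed.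

Definition basis_seq k l : seq (Vec R p q) := [seq basis_nat R p q i | i <- iota k (l - k)].

Lemma eprodE k l : eprod R p q k l = vprod (basis_seq k l).
Proof. by rewrite -cl_prod_vec -map_comp. Qed.

Lemma size_basis_seq k l : size (basis_seq k l) = (l - k)%N.
Proof. by rewrite size_map size_iota. Qed.

Lemma basis_seqP k l v : v \in basis_seq k l ->
  exists i, [/\ (k <= i)%N, (i < l)%N & v = basis_nat R p q i].
Proof.
move=> /mapP[i + ->]; rewrite mem_iota => /andP[ki il].
by exists i; split=> //; move: il; lia.
Qed.

Lemma unit_basis_seq k l : (l <= p)%N -> unit_seq (coord_space (below l)) (basis_seq k l).
Proof.
move=> lp v /basis_seqP[i [_ il ->]]; split; first exact: basis_nat_below.
by apply: unit_vec_basis_nat; rewrite ltn_addr // (leq_trans il).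
Qed.

Lemma orthogonal_basis_seq k l : (l <= p)%N -> orthogonal_seq (basis_seq k l).
Proof.
move=> lp; rewrite /orthogonal_seq pairwise_map; have := iota_uniq k (l - k).
rewrite uniq_pairwise; apply: sub_in_pairwise (allss _) => i j.
rewrite mem_iota => /andP[ki il] _ /= ij.
by rewrite ip_basis_nat_neq //; move: il; lia.
Qed.

End BasisSequences.

Section Volume.
Variables (R : realType) (p q p' : nat).
Hypotheses (p'_mod4 : (p' %% 4 = 3)%N) (p'_le_p : (p' <= p)%N).
Local Notation clifford := (clifford R p q).
Local Notation E := (@coord_space R p q (below p')).
Local Notation E' := (@coord_space R p q (predC (below p'))).
Implicit Types (v : Vec R p q) (a c : clifford).

Definition volume : clifford := eprod R p q 0 p'.
Definition volume_tail : clifford := eprod R p q 1 p'.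

Lemma odd_p' : odd p'.
Proof. by rewrite (divn_eq p' 4) p'_mod4 oddD oddM andbF. Qed.

Lemma p'_gt2 : (2 < p')%N.
Proof. by rewrite (divn_eq p' 4) p'_mod4; lia. Qed.

Lemma ip_sign_below (i : 'I_(p + q)) : below p' i -> ip_sign R i = 1.
Proof. by rewrite /below /ip_sign => /leq_trans ->. Qed.

Lemma ip_sign_above (i : 'I_(p + q)) :
  p' = p -> predC (below p') i -> ip_sign R i = -1.
Proof. by move=> p'E; rewrite /= /below /ip_sign p'E => /negbTE ->. Qed.

Lemma below_nonempty : exists i : 'I_(p + q), below p' i.
Proof.
have p_gt0 : (0 < p + q)%N by have := p'_gt2; lia.
by exists (Ordinal p_gt0); rewrite /below /=; have := p'_gt2; lia.
Qed.

Lemma volume_Pin : PinIn E volume.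
Proof. by rewrite /volume eprodE; exact/PinIn_vprod/unit_basis_seq. Qed.

Lemma spinor_norm_volume : spinor_norm volume = -1.
Proof.
rewrite /volume eprodE spinor_norm_vprod.
have us := @unit_basis_seq R p q 0 p' p'_le_p.
rewrite (vprod_norm_definite ip_sign_below (or_introl erefl) us).
by rewrite size_basis_seq subn0 -signr_odd odd_p'.
Qed.

Lemma volumeE : volume = cvec (basis_nat R p q 0) * volume_tail.
Proof.
rewrite /volume /volume_tail !eprodE -vprod_cons /basis_seq subn0.
by rewrite -[in LHS](@prednK p') 1?ltnW 1?ltnW ?p'_gt2 // subn1.
Qed.

Lemma volume_tailE : volume_tail = - (cvec (basis_nat R p q 0) * volume).
Proof.
rewrite volumeE mulrA cvec_sqr ip_basis_nat_pos; first by rewrite scaleN1r mulN1r opprK.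
by have := p'_gt2; lia.
Qed.

Lemma volume_tail_Spin : Spin R p q volume_tail.
Proof.
rewrite /volume_tail eprodE; apply/SpinInP; exists (basis_seq R p q 1 p').
split=> //; first exact: unit_seqT (@unit_basis_seq R p q 1 p' p'_le_p).
by rewrite size_basis_seq oddB ?odd_p' //; have := p'_gt2; lia.
Qed.

Lemma volume_comm v : E v -> volume * cvec v = cvec v * volume.
Proof.
move=> Ev; have us := @unit_basis_seq R p q 0 p' p'_le_p.
have reflect_v : reflections (basis_seq R p q 0 p') v = - v.
  rewrite [v in LHS]vec_sum [v in RHS]vec_sum linear_sum -sumrN; apply: eq_bigr => i _.
  rewrite linearZZ /=; have [iE|/Ev->] := boolP (below p' i); last by rewrite !scale0r oppr0.
  rewrite reflections_orthogonal_mem ?scalerN //; first exact: orthogonal_basis_seq.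
    by rewrite -basis_natE map_f // mem_iota subn0.
  exact: unit_vec_basis.
have := cvec_reflections v us; rewrite reflect_v size_basis_seq subn0 -signr_odd odd_p'.
by rewrite linearN /= mulNr expr1 scaleN1r /volume eprodE => /oppr_inj.
Qed.

Lemma volume_Pin_comm a : PinIn E a -> volume * a = a * volume.
Proof.
move=> /PinInP[s us ->]; elim: s us => [_|u s IH /unit_seq_cons[Eu _ us]].
  by rewrite vprod_nil mulr1 mul1r.
by rewrite vprod_cons mulrA volume_comm // -!mulrA IH.
Qed.

Lemma volume_anticomm v : E' v -> volume * cvec v = - (cvec v * volume).
Proof.
move=> Ev; have us := @unit_basis_seq R p q 0 p' p'_le_p.
have := cvec_reflections v us; rewrite (reflections_fixl us Ev) size_basis_seq subn0.
by rewrite -signr_odd odd_p' expr1 scaleN1r /volume eprodE => ->; rewrite opprK.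
Qed.

Lemma volume_Pin_swap a c : PinIn E a -> PinIn E' c -> cl_even (a * c) ->
  volume * (a * c) = spinor_norm a *: (a * c * volume).
Proof.
move=> Pa /PinInP[h uh ->] ev; rewrite mulrA volume_Pin_comm // -!mulrA scalerAr.
congr (_ * _); case/PinInP: Pa ev => s us ->; rewrite -vprod_cat => ev.
have := odd_vprod_even (unit_seqT_cat us uh) ev; rewrite size_cat oddD => parity.
rewrite spinor_norm_vprod (vprod_norm_definite ip_sign_below (or_introl erefl) us).
rewrite -signr_odd (_ : odd (size s) = odd (size h)); last first.
  by move: parity; case: (odd _); case: (odd _).
elim: h uh {parity ev} => [_|v h IH /unit_seq_cons[Ev _ uh]].
  by rewrite vprod_nil mul1r mulr1 scale1r.
rewrite vprod_cons mulrA volume_anticomm // mulNr -!mulrA IH // -scalerAr -scaleNr.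
by rewrite !signr_odd exprS mulN1r.
Qed.

Lemma volume_sqr : volume * volume = 1.
Proof.
have odd_swaps : odd 'C(p', 2).
  have [k ->] : exists k, p' = (k * 4 + 3)%N.
    by exists (p' %/ 4)%N; rewrite {1}(divn_eq p' 4) p'_mod4.
  rewrite bin2 (_ : _ * _ = (((k * 4 + 3) * (k * 2 + 1)).*2))%N; last by lia.
  by rewrite doubleK oddM !oddD !oddM !andbF.
have := mul_Pin_reverse (PinIn_Pin volume_Pin); rewrite spinor_norm_volume.
rewrite {2}/volume eprodE reverse_vprod.
rewrite vprod_rev_orthogonal; last exact: orthogonal_basis_seq.
rewrite size_basis_seq subn0 -eprodE -/volume -signr_odd odd_swaps.
by rewrite expr1 !scaleN1r mulrN => /oppr_inj.
Qed.

End Volume.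

(** * The groups K and Khat *)

Section GeneratedGroups.
Variables (R : realType) (p q : nat).
Implicit Types (X G : set (Cl R p q)).

Lemma gen_group_min X G : subgroup_closed G -> X `<=` G -> gen_group X `<=` G.
Proof. by move=> groupG XG x; apply. Qed.

Lemma sub_gen_group X : X `<=` gen_group X.
Proof. by move=> x Xx G _; apply. Qed.

Lemma gen_group_closed X : subgroup_closed (gen_group X).
Proof.
split=> [G [] //|x y Xx Xy G groupG XG|x Xx G groupG XG]; case: (groupG) => G1 GM GV.
  by apply: GM; [exact: Xx|exact: Xy].
by apply: GV; exact: Xx.
Qed.

Lemma homog_connected_cover (G H C : set (Cl R p q)) :
  C `<=` G -> connected C ->
  (forall g, G g -> exists x h, [/\ C x, H h & g = cl_mul x h]) ->
  homog_connected G H.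
Proof.
move=> CG connC cover A B [U [oU AU]] [V [oV BV]] AB_G AB0 satA satB.
have disjoint_open (X Y W : set (Cl R p q)) : open W -> Y = W `&` G -> X `<=` G ->
    X `&` Y = set0 -> closure X `&` Y = set0.
  move=> oW YW XG XY0; apply/seteqP; split=> // y [clXy Yy].
  have Wy : W y by move: Yy; rewrite YW => -[].
  have [x [Xx Wx]] := clXy _ (open_nbhs_nbhs (conj oW Wy)).
  suff : (X `&` Y) x by rewrite XY0.
  by split=> //; rewrite YW; split=> //; exact: XG.
have [AG BG] : A `<=` G /\ B `<=` G by rewrite -AB_G; split=> x; [left|right].
have sep : separated A B.
  split; first exact: disjoint_open BV AG AB0.
  by rewrite setIC; apply: disjoint_open AU BG _ => //; rewrite setIC.
have empty (X Y : set (Cl R p q)) : C `<=` X -> X `&` Y = set0 -> Y `<=` G ->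
    (forall g h, X g -> H h -> X (cl_mul g h)) -> Y = set0.
  move=> CX XY0 YG satX; apply/seteqP; split=> // g Yg; rewrite -XY0; split=> //.
  by have [x [h [Cx Hh ->]]] := cover g (YG _ Yg); apply: satX => //; exact: CX.
have [|CA|CB] := connected_subset sep _ connC; first by rewrite AB_G.
  by right; exact: empty CA AB0 BG satA.
by left; apply: empty CB _ AG satB; rewrite setIC.
Qed.

End GeneratedGroups.

Section Khat.
Variables (R : realType) (p q p' : nat).
Hypotheses (p'_mod4 : (p' %% 4 = 3)%N) (p'_le_p : (p' <= p)%N).
Local Notation clifford := (clifford R p q).
Local Notation Cl := (Cl R p q).
Local Notation E := (@coord_space R p q (below p')).
Local Notation E' := (@coord_space R p q (predC (below p'))).
Local Notation e0 := (basis_nat R p q 0).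
Local Notation volume := (@volume R p q p').
Implicit Types (v w : Vec R p q) (a c x y : clifford).

Let subE : vec_subspace E := coord_space_subspace R _.
Let subE' : vec_subspace E' := coord_space_subspace R _.

Let p'_gt0 : (0 < p')%N. Proof. by have := p'_gt2 p'_mod4; lia. Qed.
Let p_gt1 : (1 < p)%N. Proof. by have := p'_gt2 p'_mod4; lia. Qed.
Let E_e0 : E e0. Proof. exact: basis_nat_below. Qed.
Let unit_e0 : unit_vec e0.
Proof. by apply: unit_vec_basis_nat; rewrite ltn_addr // (leq_trans p'_gt0). Qed.

(* As b (g s) (g t) = spinor_norm c * b s t for g = a c, this is the stabiliser of b among
   the elements of Spin that preserve E and E'. *)
Definition Khat_products : set Cl := [set x | exists a c : clifford,
  [/\ PinIn E a, PinIn E' c, cl_even (a * c), spinor_norm c = 1 & x = a * c]].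

Definition K_products : set Cl :=
  [set x | exists a c : clifford, [/\ SpinIn E a, Spin0In E' c & x = a * c]].

Lemma Khat_productsN x : Khat_products x -> Khat_products (- x).
Proof.
move=> [a [c [Pa Pc ev nc ->]]]; exists (- a), c; rewrite mulNr; split=> //.
  exact: PinInN E_e0 unit_e0 Pa.
exact: cl_evenN.
Qed.

Lemma Khat_products_Spin x : Khat_products x -> Spin R p q x.
Proof.
move=> [a [c [Pa Pc ev _ ->]]]; split=> //.
by apply: PinInM; [exact: PinIn_Pin Pa|exact: PinIn_Pin Pc].
Qed.

Lemma PinE_swap a c : PinIn E a -> PinIn E' c ->
  exists2 a' : clifford, PinIn E a' & c * a = a' * c.
Proof.
move=> Pa Pc; have [->|->] := PinIn_swap Pa Pc; first by exists a.
by exists (- a); rewrite ?mulNr //; exact: PinInN E_e0 unit_e0 Pa.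
Qed.

Lemma Khat_products_group : subgroup_closed Khat_products.
Proof.
split.
- exists 1, 1; rewrite mulr1 spinor_norm1.
  by split=> //; [exact: PinIn1|exact: PinIn1|exact: cl_even1].
- move=> _ _ [a [c [Pa Pc ev nc ->]]] [a' [c' [Pa' Pc' ev' nc' ->]]].
  have [b Pb swap] := PinE_swap Pa' Pc.
  have prodE : a * c * (a' * c') = a * b * (c * c').
    by rewrite !mulrA -(mulrA a c) swap !mulrA.
  exists (a * b), (c * c'); split; rewrite -?prodE //; try exact: PinInM.
    exact: cl_evenM.
  by rewrite spinor_normM ?nc ?nc' ?mulr1 //; exact: PinIn_Pin Pc.
- move=> _ [a [c [Pa Pc ev nc ->]]].
  have [Pa' Pc'] := (PinIn_Pin Pa, PinIn_Pin Pc).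
  have [b Pb swap] := PinE_swap (PinInV subE Pa) (PinInV subE' Pc).
  have [_ evV] : Spin R p q (cl_inv (a * c)) by apply: SpinV; split=> //; exact: PinInM.
  rewrite cl_invM_Pin // swap in evV *; exists b, (cl_inv c); split=> //.
    exact: PinInV.
  by rewrite spinor_normV.
Qed.

Lemma SpinE_Khat a : SpinIn E a -> Khat_products a.
Proof.
move=> [Pa ev]; exists a, 1; rewrite mulr1 spinor_norm1; split=> //; exact: PinIn1.
Qed.

Lemma Spin0E'_Khat c : Spin0In E' c -> Khat_products c.
Proof.
move=> c0; have [Pc ev] := Spin0In_SpinIn c0; exists 1, c; rewrite mul1r.
by split=> //; [exact: PinIn1|exact: spinor_norm_Spin0In c0].
Qed.

Lemma K_products_sub_Khat : K_products `<=` Khat_products.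
Proof.
move=> _ [a [c [Sa c0 ->]]]; have [_ KM _] := Khat_products_group.
by apply: KM; [exact: SpinE_Khat|exact: Spin0E'_Khat].
Qed.

Lemma K_products_group : subgroup_closed K_products.
Proof.
split.
- by exists 1, 1; rewrite mulr1; split=> //; [exact: SpinIn1|exact: Spin0In1].
- move=> _ _ [a [c [Sa c0 ->]]] [a' [c' [Sa' c0' ->]]].
  exists (a * a'), (c * c'); split; [exact: SpinInM|exact: Spin0InM|].
  have [Pc _] := Spin0In_SpinIn c0.
  by rewrite cl_mulE !mulrA -(mulrA a) (SpinIn_comm Sa' Pc) !mulrA.
- move=> _ [a [c [Sa c0 ->]]]; have [Pc _] := Spin0In_SpinIn c0.
  exists (cl_inv a), (cl_inv c); split; [exact: SpinInV|exact: Spin0InV|].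
  rewrite cl_invM_Pin; [|by case: Sa => /PinIn_Pin|exact: PinIn_Pin Pc].
  exact: SpinIn_comm (SpinInV subE Sa) (PinInV subE' Pc).
Qed.

Lemma Kgrp_eq_products : Kgrp R p q p' = K_products.
Proof.
rewrite /Kgrp EE_coord_space EE'_coord_space; apply/seteqP; split.
  apply: gen_group_min; first exact: K_products_group.
  move=> x [Sx|x0]; [exists x, 1|exists 1, x]; rewrite ?mulr1 ?mul1r; split=> //.
    exact: Spin0In1.
  exact: SpinIn1.
move=> _ [a [c [Sa c0 ->]]]; have [_ GM _] := gen_group_closed (SpinIn E `|` Spin0In E').
by apply: GM; apply: sub_gen_group; [left|right].
Qed.

Lemma Spin0In_N1_sub (S : set (Vec R p q)) : vec_subspace S -> E `<=` S ->
  Spin0In S (-1 : clifford).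
Proof.
move=> subS ES; have E_e1 : E (basis_nat R p q 1).
  by apply: basis_nat_below; have := p'_gt2 p'_mod4; lia.
apply: (Spin0In_N1 subS (ES _ E_e0) (ES _ E_e1)) => //.
  by rewrite !ip_basis_nat_pos // ltnW.
by rewrite ip_basis_nat_neq // ltn_addr // ltnW.
Qed.

Lemma SpinE_Spin0 : SpinIn E `<=` Spin0In E.
Proof.
move=> a Sa; apply/(Spin0InP subE); first exact: Spin0In_N1_sub.
split=> //; case/SpinInP: Sa => s [us es ->]; rewrite spinor_norm_vprod.
rewrite (vprod_norm_definite (ip_sign_below R p'_le_p) (or_introl erefl) us).
by rewrite -signr_odd (negbTE es).
Qed.

Lemma K_products_component (G : set Cl) : K_products `<=` G ->
  K_products `<=` connected_component G (1 : clifford).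
Proof.
move=> KG _ [a [c [Sa c0 ->]]].
have a_comp : connected_component G (1 : clifford) a.
  suff : Spin0In E `<=` connected_component G (1 : clifford).
    by apply; exact: SpinE_Spin0.
  apply: connected_component_max; [exact: Spin0In1| |exact: component_connected].
  move=> x /Spin0In_SpinIn Sx; apply: KG; exists x, 1.
  by rewrite mulr1; split=> //; exact: Spin0In1.
apply: (connected_component_trans a_comp).
suff : [set cl_mul a z | z in Spin0In E'] `<=` connected_component G a by apply; exists c.
apply: connected_component_max; last exact: connected_mull_Spin0In.
  by exists (1 : clifford); [exact: Spin0In1|rewrite cl_mulE mulr1].
by move=> _ [z z0 <-]; apply: KG; exists a, z.
Qed.

Lemma Khat_products_norm1 x : Khat_products x -> spinor_norm x = 1 -> K_products x.
Proof.
move=> [a [c [Pa Pc ev nc ->]]].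
rewrite spinor_normM ?nc ?mulr1 => [na|]; last exact: PinIn_Pin Pa.
have Sa : SpinIn E a.
  split=> //; case/PinInP: Pa na => s us ->; rewrite spinor_norm_vprod.
  rewrite (vprod_norm_definite (ip_sign_below R p'_le_p) (or_introl erefl) us) -signr_odd.
  by case: (boolP (odd _)) => [_|/cl_even_vprod//]; rewrite expr1; lra.
have [_ eaV] := SpinInV subE Sa.
have Sc : SpinIn E' c.
  split=> //; have := cl_evenM eaV ev.
  by rewrite mulrA mulVr_Pin ?mul1r //; exact: PinIn_Pin Pa.
have [c0|c0] := SpinIn_norm1_pmSpin0In subE' Sc nc; first by exists a, c.
by exists (- a), (- c); rewrite mulrNN; split=> //; exact: SpinInN E_e0 unit_e0 Sa.
Qed.

Lemma Khat_component :
  connected_component Khat_products (1 : clifford) = K_products /\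
  K_products = Khat_products `&` Spin0 R p q.
Proof.
have sub1 := K_products_component K_products_sub_Khat.
have sub2 : connected_component Khat_products (1 : clifford) `<=`
    Khat_products `&` Spin0 R p q.
  move=> x xK; split; first exact: connected_component_sub xK.
  move: x xK; apply: connected_component_max.
  - by apply: connected_component_refl; case: Khat_products_group.
  - by move=> x /connected_component_sub/Khat_products_Spin.
  - exact: component_connected.
have sub3 : Khat_products `&` Spin0 R p q `<=` K_products.
  by move=> x [xK /spinor_norm_Spin0In]; exact: Khat_products_norm1.
by split; apply/seteqP; split=> //;
  [exact: subset_trans sub2 sub3|exact: subset_trans sub1 sub2].
Qed.

(* Represents the coset of spinor norm -1. *)
Definition volume_negative : clifford := volume * cvec (basis_nat R p q p).

Lemma negative_vec : (0 < q)%N ->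
  E' (basis_nat R p q p) /\ ip (basis_nat R p q p) (basis_nat R p q p) = -1.
Proof.
move=> q_gt0; split; first exact: basis_nat_above.
by rewrite ip_basis_nat ?ltnn ?eqxx ?mulr1 // -[X in (X < _)%N]addn0 ltn_add2l.
Qed.

Lemma volume_mul_Khat v : E' v -> ip v v = -1 -> Khat_products (volume * cvec v).
Proof.
move=> Ev vv; have uv : unit_vec v by right.
exists volume, (cvec v); split=> //; [exact: volume_Pin|exact: PinIn_cvec| |].
  rewrite /volume eprodE -vprod1 -vprod_cat; apply: cl_even_vprod.
  by rewrite size_cat size_basis_seq subn0 addn1 /= negbK (odd_p' p'_mod4).
by rewrite spinor_norm_cvec vv opprK.
Qed.

Lemma volume_mulM v w : E' v ->
  volume * cvec v * (volume * cvec w) = - (cvec v * cvec w).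
Proof.
move=> Ev; rewrite mulrA -(mulrA volume) -[cvec v * volume]opprK.
rewrite -(volume_anticomm p'_mod4 p'_le_p Ev) mulrN mulNr mulrA.
by rewrite (volume_sqr R q p'_mod4 p'_le_p) mul1r.
Qed.

Lemma volume_mul_sqr v : E' v -> volume * cvec v * (volume * cvec v) = (ip v v)%:A.
Proof. by move=> Ev; rewrite volume_mulM // cvec_sqr scaleNr opprK. Qed.

Lemma volume_negative_Khat : (0 < q)%N -> Khat_products volume_negative.
Proof. by move=> /negative_vec[Ef ff]; exact: volume_mul_Khat. Qed.

Lemma volume_negative_inv : (0 < q)%N ->
  cl_inv volume_negative = - volume_negative :> clifford.
Proof.
move=> /negative_vec[Ef ff].
by apply: cl_inv_uniq; rewrite ?mulrN ?mulNr volume_mul_sqr // ff scaleN1r opprK.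
Qed.

Lemma spinor_norm_volume_negative : (0 < q)%N -> spinor_norm volume_negative = -1.
Proof.
move=> /negative_vec[Ef ff]; rewrite spinor_normM; last exact/PinIn_Pin/volume_Pin.
by rewrite (spinor_norm_volume R q p'_mod4 p'_le_p) spinor_norm_cvec ff opprK mulr1.
Qed.

Lemma Spin_norm_cases x : Spin R p q x -> spinor_norm x = 1 \/
  (0 < q)%N /\ spinor_norm (x * volume_negative) = 1.
Proof.
move=> Sx; have [Px _] := Sx; have [nx|nx] := spinor_norm_pm1 Px; [by left|right].
have q_gt0 : (0 < q)%N.
  rewrite lt0n; apply/eqP => q0; case/SpinInP: Sx nx => s [us es ->].
  have sign_pos (i : 'I_(p + q)) : predT i -> ip_sign R i = 1.
    by move=> _; exact: ip_sign_definite.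
  have usT : unit_seq (coord_space predT) s by move=> v /us[_ uv]; split.
  rewrite spinor_norm_vprod (vprod_norm_definite sign_pos (or_introl erefl) usT).
  by rewrite -signr_odd (negbTE es) expr0; lra.
by split=> //; rewrite spinor_normM // nx spinor_norm_volume_negative // mulrNN mulr1.
Qed.

Lemma Khat_cases x : Khat_products x -> K_products x \/
  (0 < q)%N /\ K_products (x * volume_negative).
Proof.
move=> Kx; have [nx|[q_gt0 nx]] := Spin_norm_cases (Khat_products_Spin Kx).
  by left; exact: Khat_products_norm1.
right; split=> //; apply: Khat_products_norm1 => //; have [_ KM _] := Khat_products_group.
by apply: KM => //; exact: volume_negative_Khat.
Qed.

Lemma Spin_Spin0_mul_Khat x : Spin R p q x ->
  exists y k : clifford, [/\ Spin0 R p q y, Khat_products k & x = y * k].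
Proof.
have subT := vec_subspaceT R p q.
have Spin0P := Spin0InP subT _ (Spin0In_N1_sub subT (@subsetT _ _)).
move=> Sx; have [nx|[q_gt0 nx]] := Spin_norm_cases Sx.
  exists x, 1; rewrite mulr1; split=> //; first exact/Spin0P.
  by case: Khat_products_group.
have Kv := volume_negative_Khat q_gt0.
exists (x * volume_negative), (- volume_negative); split.
- by apply/Spin0P; split=> //; apply: SpinInM => //; exact: Khat_products_Spin.
- exact: Khat_productsN.
have [Pv _] := Khat_products_Spin Kv.
by rewrite -volume_negative_inv // -mulrA mulrV_Pin // mulr1.
Qed.

Lemma homog_connected_Khat : homog_connected (Spin R p q) Khat_products.
Proof.
apply: (@homog_connected_cover _ _ _ _ _ (Spin0 R p q)); first exact: Spin0In_SpinIn.
  exact: component_connected.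
by move=> x Sx; have [y [k [y0 Kk ->]]] := Spin_Spin0_mul_Khat Sx; exists y, k.
Qed.

End Khat.

(** * The embedding of Pin(q) *)

Section Iota.
Variables (R : realType) (p q p' : nat).
Hypotheses (p'_mod4 : (p' %% 4 = 3)%N) (p'_le_p : (p' <= p)%N).
Local Notation clV := (clifford R p q).
Local Notation clQ := (clifford R q 0).
Local Notation E := (@coord_space R p q (below p')).
Local Notation E' := (@coord_space R p q (predC (below p'))).
Local Notation volume := (@volume R p q p').
Local Notation Khat_products := (@Khat_products R p q p').
Implicit Types (i j k : 'I_(q + 0)) (v w : Vec R q 0) (s : seq (Vec R q 0)) (a c : clV).

Definition neg_index k : 'I_(p + q) := rshift p (cast_ord (addn0 q) k).

Lemma neg_index_inj : injective neg_index.
Proof. by move=> i j /rshift_inj/cast_ord_inj. Qed.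

Lemma neg_index_above k : predC (below p') (neg_index k).
Proof. by rewrite /= /below -leqNgt /= (leq_trans p'_le_p) // leq_addr. Qed.

Lemma ip_sign_neg_index k : ip_sign R (neg_index k) = -1.
Proof. by rewrite /ip_sign ltnNge leq_addr. Qed.

Definition embed v : Vec R p q := \sum_k v ord0 k *: basis_vec R (neg_index k).

Fact embed_is_linear : linear embed.
Proof.
move=> a v w; rewrite /embed scaler_sumr -big_split; apply: eq_bigr => k _ /=.
by rewrite !mxE scalerDl scalerA.
Qed.

HB.instance Definition _ :=
  GRing.isLinear.Build R (Vec R q 0) (Vec R p q) _ embed embed_is_linear.

Lemma embed_E' v : E' (embed v).
Proof.
have subE' := coord_space_subspace R (predC (@below p q p')).
apply: (vec_subspace_sum subE') => k _; apply: (vec_subspaceZ subE').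
exact/coord_space_basis/neg_index_above.
Qed.

Lemma embed_coef v k : embed v ord0 (neg_index k) = v ord0 k.
Proof.
rewrite summxE (bigD1 k) //= mxE basis_vecE eqxx mulr1 big1 ?addr0 // => i ik.
by rewrite mxE basis_vecE (inj_eq neg_index_inj) eq_sym (negbTE ik) mulr0.
Qed.

Lemma embed_inj : injective embed.
Proof. by move=> v w vw; apply/rowP => k; rewrite -!embed_coef vw. Qed.

Lemma embed_basis k : embed (basis_vec R k) = basis_vec R (neg_index k).
Proof.
rewrite /embed (bigD1 k) //= basis_vecE eqxx scale1r big1 ?addr0 // => i ik.
by rewrite basis_vecE (negbTE ik) scale0r.
Qed.

Lemma ip_embed v w : ip (embed v) (embed w) = - ip v w.
Proof.
have expand u : ip (embed v) u = \sum_k v ord0 k * ip (basis_vec R (neg_index k)) u.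
  by rewrite /embed; elim/big_ind2: _ => [|x a y b <- <-|k _];
    rewrite ?ip0l ?ipDl ?ipZl.
rewrite expand /ip -sumrN; apply: eq_bigr => k _; rewrite -/(ip _ _) ip_basis embed_coef.
by rewrite ip_sign_neg_index ip_sign_definite; ring.
Qed.

Lemma embed_unit v : unit_vec v -> ip (embed v) (embed v) = -1.
Proof.
have sign_pos k : predT k -> ip_sign R k = 1 by rewrite ip_sign_definite.
by move=> uv; rewrite ip_embed (ip_definite_unit sign_pos _ _ uv) //; left.
Qed.

Lemma embed_reflection v w : embed (reflection v w) = reflection (embed v) (embed w).
Proof. by rewrite /reflection linearB linearZZ /= !ip_embed; congr (_ - _ *: _); ring. Qed.

Definition iota_gen k : clV := volume * cvec (basis_vec R (neg_index k)).

Lemma sum_iota_gen v : \sum_k v ord0 k *: iota_gen k = volume * cvec (embed v).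
Proof.
rewrite /embed linear_sum mulr_sumr; apply: eq_bigr => k _.
by rewrite linearZZ -scalerAr.
Qed.

Lemma iota_gen_anticomm i j : i != j ->
  iota_gen i * iota_gen j = - (iota_gen j * iota_gen i).
Proof.
move=> ij; have E'k k : E' (basis_vec R (neg_index k)).
  exact/coord_space_basis/neg_index_above.
rewrite !volume_mulM // basis_vec_anticomm //.
by rewrite (inj_eq neg_index_inj).
Qed.

Lemma iota_gen_sqr k : iota_gen k * iota_gen k = (- ip_sign R k)%:A.
Proof.
rewrite volume_mul_sqr //; last exact/coord_space_basis/neg_index_above.
by rewrite ip_basis_basis eqxx mulr1 ip_sign_neg_index ip_sign_definite.
Qed.

Lemma cl_iotaE (x : Cl R q 0) : cl_iota R p q p' x = clifford_lift iota_gen x.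
Proof.
rewrite /cl_iota /clifford_lift.
transitivity (\sum_(A : blade q 0) x A *: (cl_prod [seq cl_mul (eprod R p q 0 p')
   (vec (basis_nat R p q (p + nat_of_ord k))) | k <- enum A] : clV)) => //.
apply: eq_bigr => A _; congr (_ *: _); rewrite cl_prodE big_map.
by apply: eq_bigr => k _; rewrite (basis_natE R (neg_index k)).
Qed.

Lemma cl_iota1 : cl_iota R p q p' (1 : clQ) = 1 :> clV.
Proof. by rewrite cl_iotaE clifford_lift1. Qed.

Lemma cl_iotaN (x : clQ) :
  cl_iota R p q p' (- x) = - (cl_iota R p q p' x : clV) :> clV.
Proof. by rewrite !cl_iotaE linearN. Qed.

Lemma cl_iotaM_Pin (x y : clQ) : Pin R q 0 x ->
  cl_iota R p q p' (x * y) = (cl_iota R p q p' x : clV) * cl_iota R p q p' y.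
Proof.
move=> /PinInP[s _ ->]; rewrite !cl_iotaE.
exact: (clifford_lift_vprodM iota_gen_anticomm iota_gen_sqr).
Qed.

Lemma cl_iota_vprod s :
  cl_iota R p q p' (vprod s) = \prod_(v <- s) (volume * cvec (embed v)) :> clV.
Proof.
rewrite cl_iotaE (clifford_lift_vprod iota_gen_anticomm iota_gen_sqr).
by apply: eq_bigr => v _; exact: sum_iota_gen.
Qed.

Lemma iotaPinP (c : clV) : iotaPin R p q p' c <->
  exists2 s, unit_seq setT s & c = \prod_(v <- s) (volume * cvec (embed v)).
Proof.
split=> [[y [/PinInP[s us ->] ->]]|[s us ->]]; first by exists s; rewrite ?cl_iota_vprod.
by exists (vprod s); split; [exact: PinIn_vprod|rewrite cl_iota_vprod].
Qed.

Lemma iotaPin_Khat (c : clV) : iotaPin R p q p' c -> Khat_products c.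
Proof.
have [K1 KM _] := Khat_products_group R q p'_mod4 p'_le_p.
move=> /iotaPinP[s us ->]; elim: s us => [_|v s IH /unit_seq_cons[_ uv us]].
  by rewrite big_nil.
rewrite big_cons; apply: KM; last exact: IH.
by apply: volume_mul_Khat => //; [exact: embed_E'|exact: embed_unit].
Qed.

Lemma volume_negative_iota : (0 < q)%N -> iotaPin R p q p' (@volume_negative R p q p').
Proof.
move=> q_gt0; have q0_gt0 : (0 < q + 0)%N by rewrite addn0.
apply/iotaPinP; exists [:: basis_vec R (Ordinal q0_gt0)].
  by apply: unit_seq1 => //; exact: unit_vec_basis.
rewrite big_cons big_nil mulr1 embed_basis -basis_natE /= addn0.
by [].
Qed.

Lemma Khat_eq_products : Khat R p q p' = Khat_products.
Proof.
rewrite /Khat Kgrp_eq_products //; apply/seteqP; split.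
  apply: gen_group_min; first exact: Khat_products_group.
  by move=> c [/K_products_sub_Khat|/iotaPin_Khat]; [exact|].
move=> x /(Khat_cases p'_mod4 p'_le_p)[Kx|[q_gt0 Kx]]; first by apply: sub_gen_group; left.
pose f := @volume_negative R p q p'.
have [_ GM GV] := gen_group_closed (@K_products R p q p' `|` iotaPin R p q p').
have [Pf _] := Khat_products_Spin (volume_negative_Khat R p'_mod4 p'_le_p q_gt0).
have -> : x = cl_mul (cl_mul x f) (cl_inv f) by rewrite !cl_mulE -mulrA mulrV_Pin // mulr1.
apply: GM; first by apply: sub_gen_group; left.
by apply: GV; apply: sub_gen_group; right; exact: volume_negative_iota.
Qed.

Lemma SpinE_iota_comm a c : SpinIn E a -> iotaPin R p q p' c -> c * a = a * c.
Proof.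
move=> Sa /iotaPinP[s us ->]; elim: s us => [_|v s IH /unit_seq_cons[_ uv us]].
  by rewrite big_nil mul1r mulr1.
rewrite big_cons -mulrA IH // !mulrA; congr (_ * _).
have Pv : PinIn E' (cvec (embed v)).
  by apply: PinIn_cvec; [exact: embed_E'|right; exact: embed_unit].
rewrite -mulrA (SpinIn_comm Sa Pv) mulrA (volume_Pin_comm p'_mod4 p'_le_p) //.
by case: Sa.
Qed.

End Iota.

(** * Invariance of the canonical form *)

Section Invariance.
Variables (R : realType) (p q p' m : nat).
Hypotheses (p'_mod4 : (p' %% 4 = 3)%N) (p'_le_p : (p' <= p)%N).
Variables (rho : Cl R p q -> 'M[R]_m) (Pi : 'cV[R]_m -> 'cV[R]_m -> Vec R p q).
Hypotheses (rhoP : is_Cl0_module rho) (PiP : is_wedge2_map Pi).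
Hypothesis Pi_equivariant : equivariant rho Pi.
Local Notation clifford := (clifford R p q).
Local Notation E := (@coord_space R p q (below p')).
Local Notation E' := (@coord_space R p q (predC (below p'))).
Local Notation e0 := (basis_nat R p q 0).
Local Notation volume := (@volume R p q p').
Local Notation volume_tail := (@volume_tail R p q p').
Local Notation b := (bform p' rho Pi).
Implicit Types (a c g : clifford) (s t : 'cV[R]_m).

Let ip_e0 : ip e0 e0 = 1.
Proof. by rewrite ip_basis_nat_pos //; have := p'_gt2 p'_mod4; lia. Qed.

Let even_tail : cl_even volume_tail.
Proof. by case: (volume_tail_Spin R q p'_mod4 p'_le_p). Qed.

Lemma volume_tail_swap a c (g := a * c) (f := spin_act (cl_inv g : clifford) e0) :
  PinIn E a -> PinIn E' c -> cl_even g ->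
  volume_tail * g = (- spinor_norm a) *: (g * (cvec f * cvec e0 * volume_tail)).
Proof.
move=> Pa Pc ev; have Sg : Spin R p q g.
  by split=> //; apply: PinInM; [exact: PinIn_Pin Pa|exact: PinIn_Pin Pc].
have e0g : cvec e0 * g = g * cvec f.
  have [us [uus ess gE]] := (SpinInP setT g).1 Sg.
  have := cvec_reflections f uus; rewrite -gE -signr_odd (negbTE ess) scale1r => <-.
  by rewrite -(spin_act_vprod _ uus) // -gE spin_actVK.
have volume_g : volume * g = spinor_norm a *: (g * volume).
  exact: (volume_Pin_swap p'_mod4 p'_le_p).
rewrite {1}volume_tailE // mulNr -(mulrA _ volume g) volume_g -scalerAr.
rewrite scaleNr; congr (- (_ *: _)).
by rewrite [LHS]mulrA e0g -!(mulrA _ (cvec f)) -(mulrA _ (cvec e0)) -(volumeE R q p'_mod4).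
Qed.

Lemma bform_split_action a c s t : PinIn E a -> PinIn E' c -> cl_even (a * c) ->
  b (rho (a * c) *m s) (rho (a * c) *m t) = spinor_norm c * b s t.
Proof.
move=> Pa Pc; set g := a * c => ev; have Sg : Spin R p q g.
  by split=> //; apply: PinInM; [exact: PinIn_Pin Pa|exact: PinIn_Pin Pc].
pose f := spin_act (cl_inv g : clifford) e0.
have even_fe := cl_even_cvecM f e0.
have even_y := cl_evenM even_fe even_tail.
have gf : spin_act g f = e0 by exact: spin_actVK.
have ff : ip f f = 1 by rewrite -(ip_spin_act _ _ Sg) gf.
rewrite /bform mulmxA -(rhoM rhoP) // volume_tail_swap // -/f.
rewrite (rhoZ rhoP _ (cl_evenM ev even_y)) (rhoM rhoP ev even_y) -scalemxAl (PiZl PiP) ipZr.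
rewrite -mulmxA (Pi_Spin rhoP PiP Pi_equivariant) // ipZr -{1}gf ip_spin_act //.
rewrite (rhoM rhoP even_fe even_tail) -mulmxA (Pi_contract rhoP PiP Pi_equivariant) //.
rewrite spinor_normM; last exact: PinIn_Pin Pa.
have := spinor_norm_sqr (PinIn_Pin Pa); move: (spinor_norm a) => n nn.
set B := ip e0 _; transitivity (n * n * spinor_norm c * B); first by ring.
by rewrite nn mul1r.
Qed.

Lemma bform_neq0 : (exists s t, Pi s t != 0) -> exists s t, b s t != 0.
Proof.
move=> [s [t st]]; apply: contrapT => b_eq0.
have b0 x y : b x y = 0.
  by apply/eqP/negPn/negP => xy; apply: b_eq0; exists x, y.
have e0_Pi x y : ip e0 (Pi x y) = 0.
  have Stail := volume_tail_Spin R q p'_mod4 p'_le_p; have [Ptail _] := Stail.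
  have [_ even_inv] := SpinV Stail.
  have := b0 (rho (cl_inv volume_tail) *m x) y.
  by rewrite /bform mulmxA -(rhoM rhoP) // mulrV_Pin // (rho1 rhoP) mul1mx.
have Pi_orth v : ip v (Pi s t) = 0.
  by rewrite -[LHS]opprK -(Pi_contract rhoP PiP Pi_equivariant _ _ _ ip_e0) e0_Pi oppr0.
move/eqP: st; apply; apply/rowP => i; rewrite mxE.
by apply: (@coord_space_orth _ _ _ pred0) => // j _; exact: Pi_orth.
Qed.

Lemma Khat_products_stabiliser g : (exists s t, Pi s t != 0) ->
  Khat_products p' g <-> [/\ Spin R p q g, Ad_preserves g E, Ad_preserves g E' &
    forall s t, b (rho g *m s) (rho g *m t) = b s t].
Proof.
move=> Pi_neq0; split=> [Kg|[Sg /(Ad_preservesP _ Sg) gE /(Ad_preservesP _ Sg) gE' gb]].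
  have Sg := Khat_products_Spin Kg; case: Kg => a [c [Pa Pc ev nc gE]].
  have [actE actE'] := spin_act_split Pa Pc ev.
  split=> // [||s t]; first by apply/(Ad_preservesP _ Sg); rewrite gE.
    by apply/(Ad_preservesP _ Sg); rewrite gE.
  by rewrite gE bform_split_action // nc mul1r.
have [i Ei] := below_nonempty q p'_mod4 p'_le_p.
have [a [c [Pa Pc gac]]] := Spin_split Ei Sg gE gE'.
have ev : cl_even (a * c) by rewrite -gac; case: Sg.
exists a, c; split=> //; have [s [t bst]] := bform_neq0 Pi_neq0.
by apply: (mulIf bst); rewrite mul1r -(bform_split_action s t Pa Pc ev) -gac gb.
Qed.

End Invariance.

(** * Compactness *)

Section CompactPin.
Variable R : realType.

Lemma closed_level_set (T : topologicalType) (f : T -> R) (a : R) :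
  continuous f -> closed [set x | f x = a].
Proof.
move=> cf; apply: (@preimage_closed _ _ f [set y | y = a]); last exact: closed_eq.
by move=> x _; apply: cf.
Qed.

Lemma compact_unit_sphere (I : finType) (J : pred I) :
  compact [set f : {ptws I -> R} |
    (forall i, ~~ J i -> f i = 0) /\ \sum_i f i ^+ 2 = 1].
Proof.
pose box : set {ptws I -> R} := [set f | forall i, `[-1, 1]%classic (f i)].
have compact_box : compact box.
  by apply: (@tychonoff _ (fun=> R) (fun=> `[-1, 1]%classic)) => i; exact: segment_compact.
rewrite (_ : [set f | _] = box `&` (\bigcap_(i in [set i | ~~ J i]) [set f | f i = 0] `&`
    [set f | \sum_i f i ^+ 2 = 1])); last first.
  apply/seteqP; split=> f [] => [supp sum1|_ [supp sum1]]; split=> // i /=.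
  rewrite in_itv /= -ler_norml -(@ler_pXn2r _ 2) ?nnegrE //.
  rewrite expr1n real_normK ?num_real // -sum1 (bigD1 i) //= lerDl sumr_ge0 // => j _.
  exact: sqr_ge0.
apply: compact_closedI => //; apply: closedI.
  by apply: closed_bigI => i _; apply: closed_level_set; exact: ptws_eval_continuous.
apply: (@closed_level_set {ptws I -> R} (fun f => \sum_i f i ^+ 2)) => f.
apply: (@sum_cvg R _ _ (nbhs f) _ _ _ (fun i (g : {ptws I -> R}) => g i * g i)) => i _.
have eval_i := @ptws_eval_continuous I R i f.
exact: (cvgM eval_i eval_i).
Qed.

Variables (p q : nat).
Local Notation clifford := (clifford R p q).
Local Notation Cl := (Cl R p q).

Lemma cl_even_closed (T : topologicalType) (f : T -> Cl) :
  continuous f -> closed [set x | cl_even (f x)].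
Proof.
move=> cf.
have -> : [set x | cl_even (f x)] =
    \bigcap_(C in [set C : blade p q | odd #|C|]) [set x | f x C = 0].
  by apply/seteqP; split=> x /= ex C oC; exact: ex.
apply: closed_bigI => C _; apply: closed_level_set => x.
exact: (ptws_eval_cvg (nbhs_filter x) (i := C) (cf x)).
Qed.

Lemma cl_mul_pair_continuous : continuous (fun z : Cl * Cl => cl_mul z.1 z.2).
Proof. by move=> z; apply: cl_mul_continuous => x; [exact: cvg_fst|exact: cvg_snd]. Qed.

Lemma compact_image_mul (A : set (Cl * Cl)) :
  compact A -> compact [set cl_mul z.1 z.2 | z in A].
Proof.
by apply: continuous_compact; exact/continuous_subspaceT/cl_mul_pair_continuous.
Qed.

Fixpoint bounded_products (X : set Cl) n : set Cl := if n is n.+1 then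
  [set cl_mul z.1 z.2 | z in (X `|` [set (1 : clifford)]) `*` bounded_products X n]
  else [set (1 : clifford)].

Lemma compact_bounded_products X n : compact X -> compact (bounded_products X n).
Proof.
move=> cX; elim: n => [|n IH] /=; first exact: compact_set1.
apply: compact_image_mul; apply: compact_setX => //.
by apply: compactU => //; exact: compact_set1.
Qed.

Section Definite.
Variables (J : pred 'I_(p + q)) (e : R).
Hypotheses (sign_J : forall i, J i -> ip_sign R i = e) (e_unit : e = 1 \/ e = -1).

Definition unit_cvecs : set Cl :=
  [set x | exists v, [/\ coord_space J v, unit_vec v & x = cvec v]].

Lemma compact_unit_cvecs : compact unit_cvecs.
Proof.
pose to_cvec (f : {ptws 'I_(p + q) -> R}) : Cl := vec (\row_i f i).
have to_cvec_continuous : continuous to_cvec.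
  move=> f; apply: (vec_cvg (nbhs_filter f)) => i.
  by rewrite mxE; under eq_cvg do rewrite mxE; exact: ptws_eval_continuous.
have norm_sum (v : Vec R p q) : coord_space J v -> unit_vec v <-> \sum_i v ord0 i ^+ 2 = 1.
  move=> Jv; split=> [/(ip_definite_unit sign_J e_unit Jv)|sum1].
    by rewrite (ip_definite sign_J Jv); case: e_unit => ->; lra.
  by rewrite /unit_vec (ip_definite sign_J Jv) sum1 mulr1.
rewrite (_ : unit_cvecs = to_cvec @` [set f : {ptws 'I_(p + q) -> R} |
    (forall i, ~~ J i -> f i = 0) /\ \sum_i f i ^+ 2 = 1]).
  by apply: continuous_compact; [exact: continuous_subspaceT|exact: compact_unit_sphere].
apply/seteqP; split=> [_ [v [Jv /(norm_sum v Jv) sum1 ->]]|_ [f [supp sum1] <-]].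
  by exists (v ord0) => //; congr vec; apply/rowP => i; rewrite mxE.
have Jf : coord_space J (\row_i f i : Vec R p q) by move=> i /supp fi; rewrite mxE.
exists (\row_i f i : Vec R p q); split=> //; apply/norm_sum => //.
by rewrite -[RHS]sum1; apply: eq_bigr => i _; rewrite mxE.
Qed.

Lemma bounded_products_vprod n s : unit_seq (coord_space J) s -> (size s <= n)%N ->
  bounded_products unit_cvecs n (vprod s).
Proof.
elim: n s => [|n IH] [|v s] //=.
- by rewrite vprod_nil.
- move=> _ _; exists ((1 : clifford), vprod [::]); last by rewrite /= cl_mulE mul1r.
  by split=> /=; [right|apply: IH].
- move=> /unit_seq_cons[Jv uv us]; rewrite ltnS => sn; rewrite vprod_cons.
  exists (cvec v, vprod s) => //; split=> /=; last exact: IH.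
  by left; exists v.
Qed.

Lemma bounded_products_PinIn n : bounded_products unit_cvecs n `<=` PinIn (coord_space J).
Proof.
elim: n => [|n IH] /=; first by move=> x ->; exact: PinIn1.
move=> _ [[x y] /= [Xx /IH Py] <-]; apply: PinInM => //.
by case: Xx => [[v [Jv uv ->]]|->]; [exact: PinIn_cvec|exact: PinIn1].
Qed.

Lemma compact_PinIn_definite : compact (PinIn (@coord_space R p q J)).
Proof.
have -> : PinIn (@coord_space R p q J) = bounded_products unit_cvecs (2 * (p + q) + 2).
  apply/seteqP; split; last exact: bounded_products_PinIn.
  move=> _ /PinIn_coord_space_bounded[h [uh sh ->]].
  exact: bounded_products_vprod.
exact/compact_bounded_products/compact_unit_cvecs.
Qed.

End Definite.
End CompactPin.

Section CompactKhat.
Variables (R : realType) (p q p' : nat).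
Local Notation clifford := (clifford R p q).
Local Notation Cl := (Cl R p q).
Local Notation E := (@coord_space R p q (below p')).
Local Notation E' := (@coord_space R p q (predC (below p'))).
Local Notation Khat_products := (@Khat_products R p q p').

Lemma Khat_products_image : Khat_products = [set cl_mul z.1 z.2 | z in
  (PinIn E `*` PinIn E') `&` [set z | cl_even (cl_mul z.1 z.2)] `&`
  [set z | spinor_norm z.2 = 1]].
Proof.
apply/seteqP; split=> [_ [a [c [Pa Pc ev nc ->]]]|_ [[a c] [[[Pa Pc] ev] nc] <-]].
  by exists (a, c).
by exists a, c.
Qed.

Lemma Khat_products_compact (e : R) : (p' <= p)%N -> e = 1 \/ e = -1 ->
  (forall i : 'I_(p + q), predC (below p') i -> ip_sign R i = e) -> compact Khat_products.
Proof.
move=> p'_le_p e_unit sign_E'; rewrite Khat_products_image; apply: compact_image_mul.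
apply: compact_closedI.
  apply: compact_closedI; last by apply: cl_even_closed; exact: cl_mul_pair_continuous.
  apply: compact_setX; last exact: (compact_PinIn_definite sign_E').
  by apply: (@compact_PinIn_definite _ _ _ _ 1); [exact: ip_sign_below|left].
apply: (@closed_level_set _ _ (fun z : Cl * Cl => spinor_norm z.2)) => z.
apply: (@continuous_comp _ _ _ (@snd Cl Cl) (@spinor_norm R p q)); first exact: cvg_snd.
exact: spinor_norm_continuous.
Qed.

Section Hyperbolic.
Variables (i j : 'I_(p + q)).
Hypotheses (sign_i : ip_sign R i = 1) (sign_j : ip_sign R j = -1).

Definition hyperbolic_vec t : Vec R p q :=
  Num.sqrt (1 + t ^+ 2) *: basis_vec R i + t *: basis_vec R j.

Let ij : i != j.
Proof. by apply/eqP => ij; move: sign_j; rewrite -ij sign_i; lra. Qed.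

Lemma ip_hyperbolic_vec t : ip (hyperbolic_vec t) (hyperbolic_vec t) = 1.
Proof.
have sqrtK : Num.sqrt (1 + t ^+ 2) * Num.sqrt (1 + t ^+ 2) = 1 + t ^+ 2.
  by rewrite -expr2 sqr_sqrtr // addr_ge0 ?sqr_ge0.
rewrite /hyperbolic_vec !ip_bilinear !ip_basis_basis !eqxx sign_i sign_j (eq_sym j).
by rewrite (negbTE ij) !(mulr0, mulr1, addr0, add0r) sqrtK expr2; ring.
Qed.

Lemma cl_coef_hyperbolic t :
  (cvec (basis_vec R i) * cvec (hyperbolic_vec t)) (symdiff (blade1 i) (blade1 j)) =
  t * blade_sign R (blade1 i) (blade1 j).
Proof.
have -> : cvec (hyperbolic_vec t) =
    Num.sqrt (1 + t ^+ 2) *: cvec (basis_vec R i) + t *: cvec (basis_vec R j).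
  by rewrite linearP linearZZ.
rewrite mulrDr -!(scalerAr _ (cvec _) (cvec _)) cvec_sqr !cvec_basis basis_bladeM.
rewrite cl_coefD !cl_coefZ cl_coef1 basis_bladeE eqxx symdiff_eq symdiffs0.
by rewrite (inj_eq set1_inj) (eq_sym j) (negbTE ij) !mulr0 add0r mulr1.
Qed.

End Hyperbolic.

Lemma Khat_products_noncompact : (p' < p)%N -> (0 < q)%N -> ~ compact Khat_products.
Proof.
move=> p'_lt_p q_gt0 compactK.
have pq : (p < p + q)%N by rewrite -[X in (X < _)%N]addn0 ltn_add2l.
pose i := Ordinal (ltn_trans p'_lt_p pq); pose j := Ordinal pq.
have sign_i : ip_sign R i = 1 by rewrite /ip_sign /= p'_lt_p.
have sign_j : ip_sign R j = -1 by rewrite /ip_sign /= ltnn.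
have E'_i : E' (basis_vec R i) by apply: coord_space_basis; rewrite /= /below ltnn.
have E'_j : E' (basis_vec R j).
  by apply: coord_space_basis; rewrite /= /below -leqNgt /= ltnW.
pose x t : clifford := cvec (basis_vec R i) * cvec (hyperbolic_vec i j t).
have Kx t : Khat_products (x t).
  have E'_t : E' (hyperbolic_vec i j t).
    have subE' := coord_space_subspace R (predC (@below p q p')).
    by apply: (vec_subspaceD subE'); exact: (vec_subspaceZ subE').
  have unit_t : unit_vec (hyperbolic_vec i j t) by left; exact: ip_hyperbolic_vec.
  have P_i : PinIn E' (cvec (basis_vec R i)).
    by apply: PinIn_cvec => //; exact: unit_vec_basis.
  exists 1, (x t); rewrite mul1r; split=> //; [exact: PinIn1| |exact: cl_even_cvecM|].
    by apply: PinInM => //; exact: PinIn_cvec.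
  rewrite spinor_normM; last exact: PinIn_Pin P_i.
  rewrite !spinor_norm_cvec ip_hyperbolic_vec // ip_basis_basis eqxx mulr1 sign_i.
  by rewrite mulrNN mulr1.
have coef_continuous := @ptws_eval_continuous (blade p q) R (symdiff (blade1 i) (blade1 j)).
have K_neq0 : Khat_products !=set0 by exists (x 0); exact: Kx.
have [y _ max_y] := compact_EVT_max K_neq0 compactK (continuous_subspaceT coef_continuous).
pose s := blade_sign R (blade1 i) (blade1 j).
have := max_y (x ((y (symdiff (blade1 i) (blade1 j)) + 1) * s)) (mem_set (Kx _)).
by rewrite /x cl_coef_hyperbolic // -mulrA blade_sign_sqr mulr1; lra.
Qed.

Lemma Khat_products_compactP : (p' <= p)%N ->
  compact Khat_products <-> q = 0%N \/ p' = p.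
Proof.
move=> p'_le_p; split=> [compactK|[q0|p'E]].
- have [->|q_gt0] := posnP q; [by left|right]; apply/eqP; rewrite eqn_leq p'_le_p leqNgt.
  by apply/negP => p'_lt_p; exact: Khat_products_noncompact compactK.
- apply: (@Khat_products_compact 1) => // [|i _]; first by left.
  exact: ip_sign_definite.
- apply: (@Khat_products_compact (-1)) => // [|i iE]; first by right.
  exact: ip_sign_above iE.
Qed.

End CompactKhat.

(** * The case p'' = 0 *)

Section IotaKernel.
Variables (R : realType) (p q p' : nat).
Hypotheses (p'_mod4 : (p' %% 4 = 3)%N) (p'_le_p : (p' <= p)%N).
Local Notation clV := (clifford R p q).
Local Notation clQ := (clifford R q 0).
Local Notation E := (@coord_space R p q (below p')).
Local Notation E' := (@coord_space R p q (predC (below p'))).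
Local Notation iota x := (cl_iota R p q p' x : clV).
Local Notation embed := (@embed R p q).

Lemma cl_iota_continuous : continuous (cl_iota R p q p').
Proof.
move=> x; apply: (ptws_cvg (nbhs_filter x)) => C.
have coefE (y : Cl R q 0) : cl_iota R p q p' y C =
    \sum_B y B * lift_blade (@iota_gen R p q p') B C.
  by rewrite cl_iotaE /clifford_lift cl_coef_sum.
rewrite coefE (funext coefE).
apply: (@sum_cvg R _ _ (nbhs x) _ _ _
  (fun B (y : Cl R q 0) => y B * lift_blade (@iota_gen R p q p') B C)
  (fun B => x B * lift_blade (@iota_gen R p q p') B C)) => B _.
have eval_B := @ptws_eval_continuous (blade q 0) R B x.
exact: (cvgM eval_B (cvg_cst _)).
Qed.

Lemma cl_iota_vprod_reflections (s : seq (Vec R q 0)) : unit_seq setT s ->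
  exists l, [/\ unit_seq setT l, iota (vprod s) = vprod l &
    forall w, reflections l (embed w) = embed (reflections s w)].
Proof.
elim: s => [_|v s IH /unit_seq_cons[_ uv /IH[l [ul lE actl]]]].
  by exists [::]; rewrite cl_iota_vprod // big_nil vprod_nil.
have u_vol := @unit_basis_seq R p q 0 p' p'_le_p.
have u_v : unit_seq E' [:: embed v].
  by apply: unit_seq1; [exact: embed_E'|right; exact: embed_unit].
exists (basis_seq R p q 0 p' ++ [:: embed v] ++ l); split.
- apply/unit_seq_cat; split; first exact: unit_seqT u_vol.
  exact: unit_seqT_cat u_v ul.
- rewrite cl_iota_vprod // big_cons -cl_iota_vprod // lE !vprod_cat vprod1 -eprodE.
  by rewrite mulrA.
move=> w; rewrite !reflections_cat actl /= -embed_reflection (reflections_fixl u_vol) //.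
exact: embed_E'.
Qed.

Lemma mul_cl_iota_eq1 (a : clV) (x : clQ) : SpinIn E a -> Pin R q 0 x ->
  a * iota x = 1 -> (a = 1 /\ x = 1) \/ (a = -1 /\ x = -1).
Proof.
move=> [/PinInP[h uh aE] _] /PinInP[s us xE] ax1.
have [l [ul lE actl]] := cl_iota_vprod_reflections us.
have prod1 : vprod (h ++ l) = 1 by rewrite vprod_cat -aE -lE -xE.
have uhl := unit_seqT_cat uh ul.
have even_hl : ~~ odd (size (h ++ l)).
  by apply: (odd_vprod_even uhl); rewrite prod1; exact: cl_even1.
have act_s w : reflections s w = w.
  apply: (@embed_inj R p q); rewrite -actl -[LHS](reflections_fixl uh); last first.
    by rewrite actl; exact: embed_E'.
  by rewrite -reflections_cat -(spin_act_vprod _ uhl) // prod1 spin_act1.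
have := vprod_trivial_action us (fun i => act_s (basis_vec R i)); rewrite -xE => -[x1|x1].
  by left; move: ax1; rewrite x1 cl_iota1 // mulr1.
right; move: ax1; rewrite x1 cl_iotaN // cl_iota1 // mulrN1 => /(congr1 -%R).
by rewrite opprK.
Qed.

End IotaKernel.

Section MaximalCompact.
Variables (R : realType) (p q p' : nat).
Hypotheses (p'_mod4 : (p' %% 4 = 3)%N) (p'E : p' = p).
Local Notation clV := (clifford R p q).
Local Notation E := (@coord_space R p q (below p')).
Local Notation E' := (@coord_space R p q (predC (below p'))).
Local Notation volume := (@volume R p q p').
Local Notation Khat_products := (@Khat_products R p q p').
Local Notation iota x := (cl_iota R p q p' x : clV).
Implicit Types (u v w z : Vec R p q) (a c x : clV).

Let p'_le_p : (p' <= p)%N. Proof. by rewrite p'E. Qed.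
Let sign_E' (i : 'I_(p + q)) : predC (below p') i -> ip_sign R i = -1.
Proof. exact: ip_sign_above. Qed.
Let subE : vec_subspace E := coord_space_subspace R _.
Let subE' : vec_subspace E' := coord_space_subspace R _.

Lemma spinor_norm_PinE' c : PinIn E' c -> spinor_norm c = 1.
Proof.
move=> /PinInP[h uh ->]; rewrite spinor_norm_vprod.
by rewrite (vprod_norm_definite sign_E' (or_intror erefl) uh) opprK expr1n.
Qed.

Lemma mul_Khat_products a c : PinIn E a -> PinIn E' c -> cl_even (a * c) ->
  Khat_products (a * c).
Proof. by move=> Pa Pc ev; exists a, c; split=> //; exact: spinor_norm_PinE'. Qed.

Lemma embed_surjective v : E' v -> exists w : Vec R q 0, embed p w = v.
Proof.
move=> Ev; exists (\row_k v ord0 (neg_index p k)); apply/rowP => i.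
have [iE|iE] := boolP (below p' i); first by rewrite (embed_E' p'_le_p) ?Ev //= iE.
have p_le_i : (p <= i)%N by move: iE; rewrite /below -leqNgt p'E.
have iq : (i - p < q + 0)%N by rewrite addn0 ltn_subLR // ltn_ord.
have -> : i = neg_index p (Ordinal iq) by apply/val_inj; rewrite /= subnKC.
by rewrite embed_coef mxE.
Qed.

Lemma PinE'_iota c : PinIn E' c ->
  exists a d : clV, [/\ PinIn E a, iotaPin R p q p' d & c = a * d].
Proof.
move=> /PinInP[h uh ->]; elim: h uh => [_|v h IH].
  exists 1, 1; rewrite vprod_nil mulr1; split=> //; first exact: PinIn1.
  by apply/(iotaPinP p'_mod4 p'_le_p); exists [::]; rewrite ?big_nil.
move=> /unit_seq_cons[Ev uv /IH[a [d [Pa iota_d hE]]]]; have [w vE] := embed_surjective Ev.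
have [b Pb swap] := PinE_swap p'_mod4 p'_le_p Pa (PinIn_cvec Ev uv).
exists (b * volume), (volume * cvec v * d); split.
- by apply: PinInM => //; exact: volume_Pin.
- case/(iotaPinP p'_mod4 p'_le_p): iota_d => s us ->; apply/(iotaPinP p'_mod4 p'_le_p).
  exists (w :: s); last by rewrite big_cons vE.
  apply/unit_seq_cons; split=> //; left; apply: oppr_inj; rewrite -(ip_embed p) vE.
  exact: (ip_definite_unit sign_E' (or_intror erefl)).
- by rewrite vprod_cons hE mulrA swap !mulrA -(mulrA b volume) volume_sqr // mulr1.
Qed.

Lemma Khat_products_SpinE_mul_iota : Khat_products =
  [set x | exists a c, SpinIn E a /\ iotaPin R p q p' c /\ x = cl_mul a c].
Proof.
have [_ KM _] := Khat_products_group R q p'_mod4 p'_le_p.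
apply/seteqP; split=> [x Kx|_ [a [d [Sa [iota_d ->]]]]]; last first.
  by apply: KM; [exact: SpinE_Khat|exact: iotaPin_Khat].
have Sx := Khat_products_Spin Kx; case: Kx => a [c [Pa Pc ev _ xE]].
have [b [d [Pb iota_d cE]]] := PinE'_iota Pc.
have Sd := Khat_products_Spin (iotaPin_Khat p'_mod4 p'_le_p iota_d).
exists (a * b), d; split; last by split=> //; rewrite xE cE cl_mulE mulrA.
split; first exact: PinInM.
have -> : a * b = (x : clV) * cl_inv d.
  by rewrite xE cE !mulrA -(mulrA _ d) mulrV_Pin ?mulr1 //; case: Sd.
by have [_] : Spin R p q ((x : clV) * cl_inv d) by apply: SpinInM => //; exact: SpinV.
Qed.

Lemma Khat_double_cover : exists phi : Cl R p q * Cl R q 0 -> Cl R p q,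
  let D := [set ab : Cl R p q * Cl R q 0 | SpinIn E ab.1 /\ Pin R q 0 ab.2] in
  [/\ {within D, continuous phi},
      (forall ab ab', D ab -> D ab' ->
         phi (cl_mul ab.1 ab'.1, cl_mul ab.2 ab'.2) = cl_mul (phi ab) (phi ab')),
      phi @` D = Khat_products &
      (forall ab, D ab -> (phi ab = cl_one R p q <->
         (ab = (cl_one R p q, cl_one R q 0)
          \/ ab = (cl_scale (-1) (cl_one R p q), cl_scale (-1) (cl_one R q 0)))))].
Proof.
exists (fun ab => cl_mul ab.1 (cl_iota R p q p' ab.2)); split.
- apply: continuous_subspaceT; apply: (@cl_mul_continuous R p q _ fst
    (fun ab : Cl R p q * Cl R q 0 => cl_iota R p q p' ab.2)) => z; first exact: cvg_fst.
  apply: (@continuous_comp _ _ _ (@snd (Cl R p q) (Cl R q 0)) (cl_iota R p q p')).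
    exact: cvg_snd.
  exact: cl_iota_continuous.
- move=> [a x] [a' x'] /= [Sa Px] [Sa' _]; rewrite !cl_mulE cl_iotaM_Pin //.
  have comm : iota x * a' = (a' : clV) * iota x.
    by apply: (SpinE_iota_comm p'_mod4 p'_le_p Sa'); exists x.
  by rewrite !mulrA -(mulrA (a : clV) a') -comm !mulrA.
- rewrite Khat_products_SpinE_mul_iota; apply/seteqP; split=> y.
    move=> [[a x] [/= Sa Px] <-]; exists a, (cl_iota R p q p' x).
    by split=> //; split=> //; exists x.
  by move=> [a [_ [Sa [[x [Px ->]] ->]]]]; exists (a, x).
- move=> [a x] /= [Sa Px].
  split=> [/(mul_cl_iota_eq1 p'_mod4 p'_le_p Sa Px) [[-> ->]|[-> ->]]|].
  + by left.
  + by right; rewrite !cl_scaleE !scaleN1r.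
  case=> -[-> ->]; first by rewrite cl_mulE cl_iota1 // mulr1.
  by rewrite !cl_scaleE !scaleN1r cl_mulE cl_iotaN // cl_iota1 // mulrNN mulr1.
Qed.

Lemma gen_alg_Khat x : cl_even x <-> gen_alg Khat_products x.
Proof.
split=> [ex S S1 KS SD SZ SM|gx]; last first.
  apply: gx => [|y /Khat_products_Spin[] //|y z|r y|y z]; first exact: cl_even1.
  - exact: cl_evenD.
  - exact: cl_evenZ.
  - exact: cl_evenM.
apply: cl_even_ind => // i j; apply: KS.
have PE k : below p' k -> PinIn E (cvec (basis_vec R k)).
  by move=> kE; apply: PinIn_cvec; [exact: coord_space_basis|exact: unit_vec_basis].
have PE' k : ~~ below p' k -> PinIn E' (cvec (basis_vec R k)).
  by move=> kE; apply: PinIn_cvec; [exact: coord_space_basis|exact: unit_vec_basis].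
have ev := cl_even_cvecM (basis_vec R i) (basis_vec R j).
have [iE|iE] := boolP (below p' i); have [jE|jE] := boolP (below p' j).
- by apply: SpinE_Khat => //; split=> //; apply: PinInM; exact: PE.
- by apply: mul_Khat_products => //; [exact: PE|exact: PE'].
- have ij : i != j by apply: contraNneq iE => ->.
  rewrite basis_vec_anticomm //; apply: (Khat_productsN p'_mod4 p'_le_p).
  by apply: mul_Khat_products; [exact: PE|exact: PE'|exact: cl_even_cvecM].
- rewrite -[_ * _]mul1r; apply: mul_Khat_products; rewrite ?mul1r //; first exact: PinIn1.
  by apply: PinInM; exact: PE'.
Qed.

(* For a unit vector of positive norm, sinh^2 of its hyperbolic angle with E. *)
Definition boost v : R := \sum_(i | ~~ below p' i) v ord0 i ^+ 2.

Lemma boost_ge0 v : 0 <= boost v.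
Proof. by apply: sumr_ge0 => i _; exact: sqr_ge0. Qed.

Lemma boost_eq0 v : boost v = 0 -> E v.
Proof.
move/eqP; rewrite psumr_eq0 => [|i _]; last exact: sqr_ge0.
by move=> /allP v0 i iE; apply/eqP; have := v0 i (mem_index_enum _); rewrite iE sqrf_eq0.
Qed.

Lemma ip_boost v : ip v v = \sum_(i | below p' i) v ord0 i ^+ 2 - boost v.
Proof.
rewrite /ip (bigID (below p')) /= /boost -sumrN; congr (_ + _); apply: eq_bigr => i iE.
  by rewrite (ip_sign_below R p'_le_p iE) expr2 mul1r.
by rewrite sign_E' // expr2 -mulrA mulN1r.
Qed.

Lemma boost_split w : exists wE wE',
  [/\ E wE, E' wE', w = wE + wE' & ip wE' wE' = - boost w].
Proof.
exists (\row_i (if below p' i then w ord0 i else 0)).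
exists (\row_i (if below p' i then 0 else w ord0 i)); split.
- by move=> i /negbTE iE; rewrite mxE iE.
- by move=> i /=; rewrite negbK mxE => ->.
- by apply/rowP => i; rewrite !mxE; case: ifP; rewrite ?addr0 ?add0r.
rewrite ip_boost big1 ?sub0r => [|i iE]; last by rewrite mxE iE expr0n.
by congr (- _); apply: eq_bigr => i /negbTE iE; rewrite mxE iE.
Qed.

Lemma exists_unit_orth u : exists2 a, E a /\ unit_vec a & ip a u = 0.
Proof.
pose e k := basis_nat R p q k.
have [p'_gt0 p'_gt1] : (0 < p')%N /\ (1 < p')%N by have := p'_gt2 p'_mod4; lia.
have Ee k : (k < p')%N -> E (e k) by exact: basis_nat_below.
have norm_e k : (k < p')%N -> ip (e k) (e k) = 1.
  by move=> kp'; rewrite ip_basis_nat_pos // (leq_trans kp').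
have e01 : ip (e 0%N) (e 1%N) = 0 by rewrite ip_basis_nat_neq // ltn_addr // -p'E.
pose y := ip (e 1%N) u *: e 0%N - ip (e 0%N) u *: e 1%N.
have yu : ip y u = 0 by rewrite /y !ip_bilinear; ring.
have yy : ip y y = ip (e 1%N) u ^+ 2 + ip (e 0%N) u ^+ 2.
  by rewrite /y !ip_bilinear (ipC (e 1%N) (e 0%N)) e01 !norm_e //; ring.
have [y0|y0] := eqVneq (ip y y) 0.
  exists (e 0%N); first by split; [exact: Ee|left; exact: norm_e].
  move: y0; rewrite yy => /eqP; rewrite paddr_eq0 ?sqr_ge0 // !sqrf_eq0.
  by case/andP => _ /eqP.
have [r [ur _]] := unit_vec_normalise y0; exists (r *: y); last by rewrite ipZl yu mulr0.
split=> //; apply: (vec_subspaceZ subE); apply: (vec_subspaceD subE).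
  exact/(vec_subspaceZ subE)/Ee.
exact/(vec_subspaceN subE)/(vec_subspaceZ subE)/Ee.
Qed.

Lemma Khat_negates_E'_component wE wE' : E wE -> E' wE' -> ip wE' wE' != 0 ->
  exists2 k : clV, Khat_products k & spin_act k (wE + wE') = wE - wE'.
Proof.
move=> Ew E'w nz; have [a [Ea ua] aw] := exists_unit_orth wE.
have [r [ur reflect_r]] := unit_vec_normalise nz; pose z := r *: wE'.
have E'z : E' z by exact: (vec_subspaceZ subE').
exists (cvec a * cvec z).
  by apply: mul_Khat_products; [exact: PinIn_cvec|exact: PinIn_cvec|exact: cl_even_cvecM].
rewrite -vprod2 (@spin_act_vprod _ _ _ setT) //=; last exact: unit_seq2.
have reflect_wE : reflection z wE = wE.
  by rewrite reflection_orth // ipC; exact: ip_coord_spaceC Ew E'z.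
have reflect_wE' : reflection z wE' = - wE'.
  by rewrite reflect_r mulfK // scaler_nat mulr2n opprD addNKr.
rewrite [reflection z _]linearD /= reflect_wE reflect_wE' linearB /=.
rewrite (reflection_orth aw) reflection_orth //; exact: ip_coord_spaceC Ea E'w.
Qed.

(* If x moves a basis vector of E by a hyperbolic angle t, then x^-1 k x moves it by 2 t. *)
Lemma boost_double x (i : 'I_(p + q)) : Spin R p q x -> below p' i ->
  exists2 k : clV, Khat_products k & 4 * boost (spin_act x (basis_vec R i)) <=
    boost (spin_act ((cl_inv x : clV) * k * x) (basis_vec R i)).
Proof.
move=> Sx iE; set e := basis_vec R i; set w := spin_act x e; have SxV := SpinV Sx.
have ip_e v : ip e v = v ord0 i by rewrite ip_basis (ip_sign_below R p'_le_p iE) mul1r.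
have norm_e : ip e e = 1 by rewrite ip_e basis_vecE eqxx.
have [b0|b0] := eqVneq (boost w) 0.
  exists 1; last by rewrite b0 mulr0 boost_ge0.
  by case: (Khat_products_group R q p'_mod4 p'_le_p).
have [wE [wE' [Ew E'w wD ipE']]] := boost_split w.
have orth : ip wE wE' = 0 := ip_coord_spaceC Ew E'w.
have [|k Kk act_k] := Khat_negates_E'_component Ew E'w; first by rewrite ipE' oppr_eq0.
exists k => //; have Sk := Khat_products_Spin Kk.
have SkV : Spin R p q ((cl_inv x : clV) * k) by exact: SpinInM.
set v := spin_act _ e.
have norm_v : ip v v = 1 by rewrite ip_spin_act //; exact: SpinInM.
have norm_wE : ip wE wE = 1 + boost w.
  have : ip (wE + wE') (wE + wE') = 1 by rewrite -wD ip_spin_act.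
  by rewrite !ip_bilinear (ipC wE') orth ipE'; lra.
have v_i : v ord0 i = 1 + 2 * boost w.
  rewrite -ip_e /v spin_actM // spin_actM // -(ip_spin_act _ _ Sx) spin_actVK // -/w.
  rewrite (_ : ip w _ = ip (wE + wE') (wE - wE')); last by rewrite -act_k -wD.
  by rewrite !ip_bilinear (ipC wE') orth norm_wE ipE'; ring.
have : v ord0 i ^+ 2 <= 1 + boost v.
  rewrite -norm_v ip_boost subrK (bigD1 i) //= lerDl sumr_ge0 // => j _.
  exact: sqr_ge0.
have := boost_ge0 w; rewrite v_i; nra.
Qed.

Lemma boost_spin_act_continuous v : continuous (fun x : Cl R p q => boost (spin_act x v)).
Proof.
have conj_continuous : continuous
    (fun x : Cl R p q => cl_mul (cl_mul x (cvec v)) (reverse x : Cl R p q)).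
  apply: (@cl_mul_continuous R p q _ (fun x : Cl R p q => cl_mul x (cvec v))).
    apply: (@cl_mul_continuous R p q _ id (fun=> cvec v)) => x; first exact: cvg_id.
    exact: cst_continuous.
  exact: reverse_continuous.
move=> x; pose coef i (y : Cl R p q) := spin_act y v ord0 i.
apply: (@sum_cvg R _ _ (nbhs x) _ _ _ (fun i y => coef i y ^+ 2)
  (fun i => coef i x ^+ 2)) => i _.
have coef_cvg : coef i y @[y --> x] --> coef i x.
  have conj_cvg := ptws_eval_cvg (nbhs_filter x) (i := blade1 i) (conj_continuous x).
  rewrite /coef mxE; under eq_cvg do rewrite mxE.
  exact: (cvgM (@spinor_norm_continuous R p q x) conj_cvg).
exact: (cvgM coef_cvg coef_cvg).
Qed.

Lemma compact_supergroup_preserves_E (H : set (Cl R p q)) :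
  H `<=` Spin R p q -> subgroup_closed H -> compact H -> Khat_products `<=` H ->
  forall x v, H x -> E v -> E (spin_act x v).
Proof.
move=> HS [H1 HM HV] compactH KH x v Hx.
apply: (coord_space_linear_image subE) => i iE; apply: boost_eq0; set e := basis_vec R i.
have H_neq0 : H !=set0 by exists x.
have [y /set_mem Hy max_y] := compact_EVT_max H_neq0 compactH
  (continuous_subspaceT (@boost_spin_act_continuous e)).
have [k Kk double] := boost_double (HS _ Hy) iE.
have := le_trans double (max_y _ (mem_set (HM _ _ (HM _ _ (HV _ Hy) (KH _ Kk)) Hy))).
have := max_y _ (mem_set Hx); have := boost_ge0 (spin_act x e).
rewrite -/e; lra.
Qed.

Lemma Khat_max_compact : max_compact_subgroup (Spin R p q) Khat_products.
Proof.
split.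
- by move=> x; exact: Khat_products_Spin.
- exact: Khat_products_group.
- by apply/(Khat_products_compactP R q p'_le_p); right.
move=> H HS groupH compactH KH; apply/seteqP; split=> // x Hx; have Sx := HS _ Hx.
have preserve_E := compact_supergroup_preserves_E HS groupH compactH KH.
have [i iE] := below_nonempty q p'_mod4 p'_le_p.
have [|v E'v|a [c [Pa Pc xE]]] := Spin_split iE Sx; first by move=> v; exact: preserve_E.
  apply: coord_space_orth => j /= /negPn jE.
  rewrite -(ip_spin_act _ _ (SpinV Sx)) spin_actK // (ip_coord_spaceC _ E'v) //.
  by apply: preserve_E; [case: groupH => _ _; apply|exact: coord_space_basis].
by rewrite xE; apply: mul_Khat_products => //; rewrite -xE; case: Sx.
Qed.

End MaximalCompact.

Theorem mainTheorem5 (R : realType) (p' p'' q m : nat)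
  (rho : Cl R (p' + p'') q -> 'M[R]_m)
  (Pi : 'cV[R]_m -> 'cV[R]_m -> Vec R (p' + p'') q) :
  (p' %% 4 = 3)%N ->
  is_Cl0_module rho ->
  is_wedge2_map Pi ->
  equivariant rho Pi ->
  (exists s t, Pi s t != 0) ->
  let p := (p' + p'')%N in
  let E := EE R p q p' in
  let E' := EE' R p q p' in
  let K := Kgrp R p q p' in
  let Kh := Khat R p q p' in
  let b := bform p' rho Pi in
  (* (1) *)
  [/\ (forall g, Kh g <->
         [/\ Spin R p q g, Ad_preserves g E, Ad_preserves g E' &
             forall s t, b (rho g *m s) (rho g *m t) = b s t]),
      connected_component Kh (cl_one R p q) = K &
      K = Kh `&` Spin0 R p q]
  (* (2) *)
  /\ homog_connected (Spin R p q) Kh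
  (* (3) *)
  /\ (compact Kh <-> (q = 0 \/ p'' = 0)%N)
  /\ (p'' = 0%N ->
      [/\ Kh = [set x | exists a c, SpinIn E a /\ iotaPin R p q p' c
                                    /\ x = cl_mul a c],
          max_compact_subgroup (Spin R p q) Kh,
          (exists phi : Cl R p q * Cl R q 0 -> Cl R p q,
             let D := [set ab : Cl R p q * Cl R q 0 | SpinIn E ab.1 /\ Pin R q 0 ab.2] in
             [/\ {within D, continuous phi},
                 (forall ab ab', D ab -> D ab' ->
                    phi (cl_mul ab.1 ab'.1, cl_mul ab.2 ab'.2)
                    = cl_mul (phi ab) (phi ab')),
                 phi @` D = Kh &
                 (forall ab, D ab -> (phi ab = cl_one R p q <->
                    (ab = (cl_one R p q, cl_one R q 0)
                     \/ ab = (cl_scale (-1) (cl_one R p q),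
                              cl_scale (-1) (cl_one R q 0)))))]) &
          (forall x, cl_even x <-> gen_alg Kh x)]).
Proof.
move=> p'_mod4 rhoP PiP Pi_equivariant Pi_neq0 p E E' K Kh b.
have p'_le_p : (p' <= p)%N := leq_addr p'' p'.
have p''E : (p'' = 0)%N <-> p' = p by rewrite /p; split; lia.
rewrite (_ : Kh = Khat_products p'); last exact: Khat_eq_products.
rewrite (_ : K = K_products p'); last exact: Kgrp_eq_products.
rewrite /E /E' EE_coord_space EE'_coord_space; split; last split; last split.
- have [component intersection] := Khat_component R q p'_mod4 p'_le_p; split=> // g.
  exact: (Khat_products_stabiliser p'_mod4 p'_le_p rhoP PiP Pi_equivariant).
- exact: homog_connected_Khat.
- by rewrite p''E; exact: Khat_products_compactP.
move=> /p''E p'E; split.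
- exact: Khat_products_SpinE_mul_iota.
- exact: Khat_max_compact.
- exact: Khat_double_cover.
- by move=> x; exact: gen_alg_Khat.
Qed.
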